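(* Let $(\mathbb{Q},\gamma)$ be a supermixed quiver setting. The points in $\mathrm{Diss}(\mathbb{Q},\gamma)=\mathrm{DRep}(\mathbb{Q},\gamma)/\!\!/\mathrm{DGL}_\gamma$ parameterize the semisimple $\epsilon$-mixed modules (with underlying space $\mathbb{C}^{\bar\gamma}$ and form $\langle\,,\rangle$) up to isomorphism: the quotient map induces a bijection between the isomorphism classes of points of $\mathrm{DRep}(\mathbb{Q},\gamma)$ that are semisimple as $\mathbb{C}Q$-modules and the points of $\mathrm{Diss}(\mathbb{Q},\gamma)$.
   Context: Everything is over $\mathbb{C}$. A quiver $Q$ has finite vertex set $Q_0$, finite arrow set $Q_1$, head and tail maps $h,t:Q_1\to Q_0$. Its path algebra $\mathbb{C}Q$ has as basis the paths $a_1\cdots a_k$ with $t(a_i)=h(a_{i+1})$, and the vertices (paths of length zero), with multiplication by concatenation. A supermixed quiver $\mathbb{Q}=(Q,\phi,\epsilon,\sigma)$ consists of a quiver $Q$, involutions $\phi$ on $Q_0$ and on $Q_1$, and sign maps $\epsilon:Q_0\to\{\pm1\}$, $\sigma:Q_1\to\{\pm1\}$ such that $h(\phi(a))=\phi(t(a))$; $h(a)=h(\phi(a))\Rightarrow a=\phi(a)$; $\epsilon_v\epsilon_{\phi(v)}=1=\sigma_a\sigma_{\phi(a)}$. A supermixed quiver setting $(\mathbb{Q},\gamma)$ also has an invertible complex square matrix $\gamma_v$ for each $v\in Q_0$ with $\gamma_v=\epsilon_v\gamma_{\phi(v)}^{\top}$; $\bar\gamma_v$ is the size of $\gamma_v$.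 Put $S_\gamma=\bigoplus_{v}\mathrm{Mat}_{\bar\gamma_v\times\bar\gamma_v}(\mathbb{C})$, $\mathbb{C}^{\bar\gamma}=\bigoplus_v\mathbb{C}^{\bar\gamma_v}$, $\mathrm{Rep}(\mathbb{Q},\gamma)=\bigoplus_{a}\mathrm{Mat}_{\bar\gamma_{h(a)}\times\bar\gamma_{t(a)}}(\mathbb{C})$. A point $W$ of $\mathrm{Rep}(\mathbb{Q},\gamma)$ makes $\mathbb{C}^{\bar\gamma}$ a left $\mathbb{C}Q$-module: $v$ acts as the projection onto $\mathbb{C}^{\bar\gamma_v}$, and $a$ acts as $W_a:\mathbb{C}^{\bar\gamma_{t(a)}}\to\mathbb{C}^{\bar\gamma_{h(a)}}$ and as zero on the other summands. Involutions: $$(s^* )_v=\gamma_{\phi(v)}^{-1}s_{\phi(v)}^{\top}\gamma_{\phi(v)}\ (s\in S_\gamma),\qquad (m^* )_a=\sigma_a\epsilon_{t(a)}\gamma_{\phi(h(a))}^{-1}m_{\phi(a)}^{\top}\gamma_{\phi(t(a))}\ (m\in\mathrm{Rep}(\mathbb{Q},\gamma)).$$ Set $\mathrm{DGL}_\gamma=\{g\in S_\gamma: gg^*=1\}$ and $\mathrm{DRep}(\mathbb{Q},\gamma)=\{m: m^*=m\}$, with action $m\mapsto gmg^*$, i.e. $m_a\mapsto g_{h(a)}m_ag_{t(a)}^{-1}$. The categorical quotient $\mathrm{Diss}(\mathbb{Q},\gamma)$ is the affine variety with coordinate ring $\mathbb{C}[\mathrm{DRep}(\mathbb{Q},\gamma)]^{\mathrm{DGL}_\gamma}$.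 The form on $\mathbb{C}^{\bar\gamma}$ is $\langle x,y\rangle=\sum_v x_v^{\top}\gamma_v y_{\phi(v)}$ (column vectors). Write $\epsilon=\sum_v\epsilon_v v\in\mathbb{C}Q$, and let $*$ be the anti-automorphism of $\mathbb{C}Q$ ($(xy)^*=y^*x^*$) with $v^*=\phi(v)$, $a^*=\sigma_a\epsilon_{h(a)}\phi(a)$. An $\epsilon$-mixed module is a finite dimensional left $\mathbb{C}Q$-module $V$ with a nondegenerate bilinear form such that $\langle v,w\rangle=\langle w,\epsilon v\rangle$ and $\langle xv,w\rangle=\langle v,x^*w\rangle$ for all $v,w\in V$, $x\in\mathbb{C}Q$. Points of $\mathrm{DRep}(\mathbb{Q},\gamma)$ are exactly the elements of $\mathrm{Rep}(\mathbb{Q},\gamma)$ for which $(\mathbb{C}^{\bar\gamma},\langle\,,\rangle)$ is $\epsilon$-mixed. Isomorphism means module isomorphism; it is a known fact (adapted from Derksen–Weyman) that two $\epsilon$-mixed modules are isomorphic via a form-preserving isomorphism if and only if they are isomorphic as $\mathbb{C}Q$-modules. *)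

(* Defs.v *)
From HB Require Import structures.
From mathcomp Require Import all_boot all_order all_algebra.
From mathcomp Require Import finmap monalg.
From mathcomp Require mpoly.
From mathcomp Require Import boolp classical_sets functions reals complex.

Set Implicit Arguments.
Unset Strict Implicit.
Unset Printing Implicit Defensive.

Import GRing.Theory.
Local Open Scope ring_scope.

Section Modules.
Variable A : pzRingType.

Definition simple_submodule (M : lmodType A) (S : {pred M}) : Prop :=
  [/\ submod_closed S,
      exists2 x, x \in S & x != 0
    & forall T : {pred M}, submod_closed T -> {subset T <= S} ->
        {subset T <= pred1 0} \/ {subset S <= T}].

(* Internal direct sum of simple submodules.  Finite families suffice for the
   finite dimensional modules considered here. *)
Definition semisimple (M : lmodType A) : Prop :=
  exists (n : nat) (S : 'I_n -> {pred M}),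
    (forall i, simple_submodule (S i)) /\
    (forall x : M, exists! u : {ffun 'I_n -> M},
       (forall i, u i \in S i) /\ x = \sum_i u i).

Definition mod_isomorphic (M N : lmodType A) : Prop :=
  exists f : {linear M -> N}, bijective f.

End Modules.

Record quiver := Quiver {
  vert : finType;
  arr : finType;
  qhead : arr -> vert;
  qtail : arr -> vert
}.

Section Paths.
Variable Q : quiver.

(* The pair (v, [:: a_1; ...; a_k]) encodes the path a_1 ... a_k, with
   qtail a_i = qhead a_(i+1), starting at v = qtail a_k; (v, [::]) is the vertex
   v seen as a path of length 0. *)
Definition word_head (p : vert Q * seq (arr Q)) : vert Q :=
  if p.2 is a :: _ then qhead a else p.1.

Fixpoint is_path (v : vert Q) (s : seq (arr Q)) : bool :=
  if s is a :: s' then (qtail a == word_head (v, s')) && is_path v s' else true.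

Definition qpath := {p : vert Q * seq (arr Q) | is_path p.1 p.2}.

Definition vpath (v : vert Q) : qpath := exist _ (v, [::]) isT.

Lemma arr_is_path (a : arr Q) : is_path (qtail a) [:: a].
Proof. by rewrite /= /word_head /= eqxx. Qed.

Definition apath (a : arr Q) : qpath := exist _ (qtail a, [:: a]) (arr_is_path a).

(* The concatenation pq is a path when p starts where q ends; the default value
   p of insubd is only taken otherwise. *)
Definition composable (p q : qpath) : bool := (val p).1 == word_head (val q).

Definition pcat (p q : qpath) : qpath :=
  insubd p ((val q).1, (val p).2 ++ (val q).2).

Lemma is_path_cat v w s r : is_path v s -> is_path w r ->
  v = word_head (w, r) -> is_path w (s ++ r).
Proof.
elim: s v => [//|a s IH] v /= /andP[/eqP -> vs] wr e.
rewrite (IH v) // andbT.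
by case: s {IH vs} => [|b s] //=; rewrite -e.
Qed.

Lemma val_pcat p q : composable p q ->
  val (pcat p q) = ((val q).1, (val p).2 ++ (val q).2).
Proof.
move=> /eqP c; rewrite /pcat insubdK // -topredE /=.
apply: (@is_path_cat (val p).1); [exact: (valP p) | exact: (valP q) |].
exact: c.
Qed.

Lemma word_head_pcat p q : composable p q ->
  word_head (val (pcat p q)) = word_head (val p).
Proof.
move=> c; rewrite val_pcat //; move/eqP: c.
by rewrite /word_head; case: (val p) => v [|a s] //= ->.
Qed.

End Paths.

HB.lock Definition linext (F : fieldType) (K : choiceType) (M : lmodType F)
  (h : K -> M) (x : {malg F[K]}) : M := \sum_(k <- msupp x) x@_k *: h k.

Section LinExt.
Variables (F : fieldType) (K : choiceType) (M : lmodType F) (h : K -> M).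

Lemma linextEw (d : {fset K}) (x : {malg F[K]}) : (msupp x `<=` d)%fset ->
  linext h x = \sum_(k <- d) x@_k *: h k.
Proof.
move=> le; rewrite linext.unlock (big_fset_incl _ le) //= => k _ knx.
by rewrite mcoeff_outdom // scale0r.
Qed.

Lemma linext_is_linear : linear (linext h).
Proof.
move=> c x y; pose d := (msupp x `|` msupp y)%fset.
rewrite !(@linextEw d) ?fsubsetUl ?fsubsetUr //.
  rewrite scaler_sumr -big_split /=; apply: eq_bigr => k _.
  by rewrite mcoeffD mcoeffZ scalerDl scalerA.
apply: (fsubset_trans (msuppD_le _ _)); apply: fsetSU; exact: msuppZ_le.
Qed.

HB.instance Definition _ :=
  GRing.isLinear.Build F {malg F[K]} M _ (linext h) linext_is_linear.

Lemma linextU k : linext h << k >> = h k.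
Proof.
by rewrite (@linextEw [fset k]%fset) ?msuppU_le // big_seq_fset1 mcoeffUU scale1r.
Qed.

End LinExt.

Lemma malg_ext (F : fieldType) (K : choiceType) (M : lmodType F)
    (f g : {malg F[K]} -> M) : linear f -> linear g ->
  (forall k, f << k >> = g << k >>) -> f =1 g.
Proof.
move=> lf lg fg x.
have scf c k : f << c *g k >> = g << c *g k >>.
  have -> : << c *g k >> = c *: << k >> + 0 :> {malg F[K]}.
    apply/malgP => k'; rewrite addr0 mcoeffZ !mcoeffU.
    by case: eqP => _; rewrite ?mulr1n ?mulr0n ?mulr1 ?mulr0.
  have f0 : f 0 = 0.
    by have := lf (-1) 0 0; rewrite scaleN1r oppr0 addr0 scaleN1r addNr.
  have g0 : g 0 = 0.
    by have := lg (-1) 0 0; rewrite scaleN1r oppr0 addr0 scaleN1r addNr.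
  by rewrite lf lg fg f0 g0.
have fD u v : f (u + v) = f u + f v by rewrite -[u]scale1r lf !scale1r.
have gD u v : g (u + v) = g u + g v by rewrite -[u]scale1r lg !scale1r.
have f0 : f 0 = 0.
  by have := lf (-1) 0 0; rewrite scaleN1r oppr0 addr0 scaleN1r addNr.
have g0 : g 0 = 0.
  by have := lg (-1) 0 0; rewrite scaleN1r oppr0 addr0 scaleN1r addNr.
rewrite [x]monalgE; elim/big_rec: _ => [|k y _ IH]; first by rewrite f0 g0.
by rewrite fD gD scf IH.
Qed.

Definition pathalg (F : fieldType) (Q : quiver) := {malg F[qpath Q]}.

HB.instance Definition _ F Q := GRing.Lmodule.on (pathalg F Q).

(* Locked: conversion on monalg's singletons is very slow. *)
HB.lock Definition pelt (F : fieldType) (Q : quiver) (p : qpath Q) :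
  pathalg F Q := << p >>.

Lemma pathalg_ext (F : fieldType) (Q : quiver) (M : lmodType F)
    (f g : pathalg F Q -> M) : linear f -> linear g ->
  (forall p, f (pelt F p) = g (pelt F p)) -> f =1 g.
Proof.
by move=> lf lg fg; apply: malg_ext => // p; move: (fg p); rewrite pelt.unlock.
Qed.

Lemma linext_pelt (F : fieldType) (Q : quiver) (M : lmodType F)
  (h : qpath Q -> M) p : linext h (pelt F p) = h p.
Proof. by rewrite pelt.unlock linextU. Qed.

Section PathAlgebra.
Variables (F : fieldType) (Q : quiver).
Local Notation CQ := (pathalg F Q).
Local Notation pelt := (pelt F).
Implicit Types (p q r : qpath Q) (x y z : CQ).


Definition velt (v : vert Q) : CQ := pelt (vpath v).
Definition aelt (a : arr Q) : CQ := pelt (apath a).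

Definition pmul p q : CQ := if composable p q then pelt (pcat p q) else 0.
Definition pathalg_mul x y : CQ := linext (fun p => linext (pmul p) y) x.
Definition pathalg_one : CQ := \sum_v velt v.

Local Notation "x *q y" := (pathalg_mul x y) (at level 40).

Lemma pathalg_mulU p q : pelt p *q pelt q = pmul p q.
Proof. by rewrite /pathalg_mul !linext_pelt. Qed.

Lemma pathalg_mul_linl y : linear (pathalg_mul^~ y).
Proof. exact: linext_is_linear. Qed.

Lemma pathalg_mul_linr x : linear (pathalg_mul x).
Proof.
move=> c y z.
rewrite /pathalg_mul !(linextEw _ (fsubset_refl _)) scaler_sumr -big_split /=.
apply: eq_bigr => p _.
by rewrite linearP scalerDr !scalerA mulrC.
Qed.

Lemma pathalg_mul0l y : 0 *q y = 0.
Proof. by rewrite /pathalg_mul linear0. Qed.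

Lemma pathalg_mul0r x : x *q 0 = 0.
Proof.
have := pathalg_mul_linr x (-1) 0 0.
by rewrite scaleN1r oppr0 addr0 scaleN1r addNr.
Qed.

Lemma pathalg_mulA : associative pathalg_mul.
Proof.
have comp (f g : CQ -> CQ) : linear f -> linear g -> linear (fun x => f (g x)).
  by move=> lf lg c u v; rewrite lg lf.
pose lr := pathalg_mul_linr; pose ll := pathalg_mul_linl.
move=> x y z.
apply: (pathalg_ext (f := fun x => x *q (y *q z)) (g := fun x => (x *q y) *q z)
         (ll _) (comp _ _ (ll z) (ll y))) => p.
apply: (pathalg_ext (f := fun y => pelt p *q (y *q z))
         (g := fun y => (pelt p *q y) *q z)
         (comp _ _ (lr _) (ll z)) (comp _ _ (ll z) (lr _))) => q.
apply: (pathalg_ext (f := fun z => pelt p *q (pelt q *q z))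
         (g := fun z => (pelt p *q pelt q) *q z)
         (comp _ _ (lr _) (lr _)) (lr _)) => r.
rewrite !pathalg_mulU /pmul.
case: (boolP (composable p q)) => pq; case: (boolP (composable q r)) => qr;
  rewrite ?pathalg_mul0l ?pathalg_mul0r // !pathalg_mulU /pmul.
- have pqr : composable (pcat p q) r by rewrite /composable val_pcat.
  have p_qr : composable p (pcat q r) by rewrite /composable word_head_pcat.
  rewrite pqr p_qr; congr pelt; apply: val_inj.
  by rewrite !val_pcat //= catA.
- by rewrite /composable val_pcat //= -/(composable q r) (negPf qr).
- by rewrite /composable word_head_pcat // -/(composable p q) (negPf pq).
Qed.

Lemma pathalg_mul1l : left_id pathalg_one pathalg_mul.
Proof.
apply: pathalg_ext => [c u v|c u v|p]; rewrite ?pathalg_mul_linr //.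
have addl y : {morph pathalg_mul^~ y : u v / u + v}.
  by move=> u v; rewrite -[u]scale1r pathalg_mul_linl !scale1r.
rewrite /pathalg_one (big_morph _ (addl _) (pathalg_mul0l _)).
rewrite (bigD1 (word_head (val p))) //= big1 ?addr0 => [|v vp].
  rewrite pathalg_mulU /pmul.
  have c : composable (vpath (word_head (val p))) p by rewrite /composable.
  by rewrite c; congr pelt; apply: val_inj; rewrite val_pcat //=; case: (val p).
by rewrite pathalg_mulU /pmul /composable /= (negPf vp).
Qed.

Lemma pathalg_mul1r : right_id pathalg_one pathalg_mul.
Proof.
apply: pathalg_ext => [c u v|c u v|p]; rewrite ?pathalg_mul_linl //.
have addr y : {morph pathalg_mul y : u v / u + v}.
  by move=> u v; rewrite -[u]scale1r pathalg_mul_linr !scale1r.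
rewrite /pathalg_one (big_morph _ (addr _) (pathalg_mul0r _)).
rewrite (bigD1 (val p).1) //= big1 ?addr0 => [|v vp].
  rewrite pathalg_mulU /pmul.
  have c : composable p (vpath (val p).1) by rewrite /composable.
  rewrite c; congr pelt; apply: val_inj; rewrite val_pcat //= cats0.
  by case: (val p).
by rewrite pathalg_mulU /pmul /composable /word_head /= eq_sym (negPf vp).
Qed.

Lemma pathalg_mulDl : left_distributive pathalg_mul +%R.
Proof. by move=> x y z; rewrite -[x]scale1r pathalg_mul_linl !scale1r. Qed.

Lemma pathalg_mulDr : right_distributive pathalg_mul +%R.
Proof. by move=> x y z; rewrite -[y]scale1r pathalg_mul_linr !scale1r. Qed.

HB.instance Definition _ := GRing.Zmodule_isPzRing.Build CQ
  pathalg_mulA pathalg_mul1l pathalg_mul1r pathalg_mulDl pathalg_mulDr.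

Lemma pathalg_scaleAl (c : F) x y : c *: (x * y) = (c *: x) * y.
Proof.
by rewrite -[c *: x]addr0 [RHS]pathalg_mul_linl pathalg_mul0l addr0.
Qed.

Lemma pathalg_scaleAr (c : F) x y : c *: (x * y) = x * (c *: y).
Proof.
by rewrite -[c *: y]addr0 [RHS]pathalg_mul_linr pathalg_mul0r addr0.
Qed.

End PathAlgebra.

Section Representations.
Variables (F : fieldType) (Q : quiver) (d : vert Q -> nat).

Definition vspace_sum := forall v : vert Q, 'cV[F]_(d v).
HB.instance Definition _ := gen_eqMixin vspace_sum.
HB.instance Definition _ := gen_choiceMixin vspace_sum.

Definition vadd (x y : vspace_sum) : vspace_sum := fun v => x v + y v.
Definition vzero : vspace_sum := fun v => 0.
Definition vopp (x : vspace_sum) : vspace_sum := fun v => - x v.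
Definition vscale (c : F) (x : vspace_sum) : vspace_sum := fun v => c *: x v.

Fact vaddA : associative vadd.
Proof. by move=> x y z; apply: functional_extensionality_dep => v; exact: addrA. Qed.
Fact vaddC : commutative vadd.
Proof. by move=> x y; apply: functional_extensionality_dep => v; exact: addrC. Qed.
Fact vadd0 : left_id vzero vadd.
Proof. by move=> x; apply: functional_extensionality_dep => v; exact: add0r. Qed.
Fact vaddN : left_inverse vzero vopp vadd.
Proof. by move=> x; apply: functional_extensionality_dep => v; exact: addNr. Qed.
HB.instance Definition _ :=
  GRing.isZmodule.Build vspace_sum vaddA vaddC vadd0 vaddN.

Fact vscaleA a b x : vscale a (vscale b x) = vscale (a * b) x.
Proof. by apply: functional_extensionality_dep => v; exact: scalerA. Qed.
Fact vscale1 : left_id 1 vscale.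
Proof. by move=> x; apply: functional_extensionality_dep => v; exact: scale1r. Qed.
Fact vscaleDr : right_distributive vscale +%R.
Proof. by move=> a x y; apply: functional_extensionality_dep => v; exact: scalerDr. Qed.
Fact vscaleDl x : {morph vscale^~ x : a b / a + b}.
Proof. by move=> a b; apply: functional_extensionality_dep => v; exact: scalerDl. Qed.
HB.instance Definition _ := GRing.Zmodule_isLmodule.Build F vspace_sum
  vscaleA vscale1 vscaleDr vscaleDl.

Lemma vspaceP (x y : vspace_sum) : (forall v, x v = y v) -> x = y.
Proof. by move=> xy; exact: functional_extensionality_dep. Qed.

Lemma vsumE (I : Type) (r : seq I) (P : pred I) (f : I -> vspace_sum) v :
  (\sum_(i <- r | P i) f i) v = \sum_(i <- r | P i) f i v.
Proof. exact: (big_morph (fun x : vspace_sum => x v)). Qed.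

Definition vinj (v : vert Q) (y : 'cV[F]_(d v)) : vspace_sum :=
  dfwith (fun w => 0 : 'cV[F]_(d w)) y.

Lemma vinj_in v y : vinj y v = y.
Proof. exact: dfwith_in. Qed.

Lemma vinj_out v w (y : 'cV[F]_(d v)) : v != w -> vinj y w = 0.
Proof. exact: dfwith_out. Qed.

Lemma vinj_linear v : linear (@vinj v).
Proof.
move=> c x y; apply: vspaceP => w.
have [<-|vw] := eqVneq v w; first by rewrite vinj_in -[RHS]/(c *: _ + _) !vinj_in.
by rewrite vinj_out // -[RHS]/(c *: _ + _) !vinj_out // scaler0 addr0.
Qed.

Lemma vinj0 v : vinj (0 : 'cV[F]_(d v)) = 0.
Proof.
have := @vinj_linear v (-1) 0 0.
by rewrite scaleN1r oppr0 addr0 scaleN1r addNr.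
Qed.

Lemma vinj_sum (x : vspace_sum) : x = \sum_v vinj (x v).
Proof.
apply: vspaceP => w; rewrite vsumE (bigD1 w) //= vinj_in big1 ?addr0 // => v vw.
by rewrite vinj_out.
Qed.

Definition rep := forall a : arr Q, 'M[F]_(d (qhead a), d (qtail a)).

Variable W : rep.

Definition vert_act (v : vert Q) (x : vspace_sum) : vspace_sum := vinj (x v).

Definition arr_act (a : arr Q) (x : vspace_sum) : vspace_sum :=
  vinj (W a *m x (qtail a)).

Fixpoint word_act (v : vert Q) (s : seq (arr Q)) (x : vspace_sum) : vspace_sum :=
  if s is a :: s' then arr_act a (word_act v s' x) else vert_act v x.

Definition path_act (x : vspace_sum) (p : qpath Q) : vspace_sum :=
  word_act (val p).1 (val p).2 x.

Lemma vert_act_linear v : linear (vert_act v).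
Proof. by move=> c x y; rewrite /vert_act -vinj_linear. Qed.

Lemma arr_act_linear a : linear (arr_act a).
Proof.
by move=> c x y; rewrite /arr_act -vinj_linear mulmxDr -scalemxAr.
Qed.

Lemma word_act_linear v s : linear (word_act v s).
Proof.
move=> c x y; elim: s => [|a s IH] /=; first exact: vert_act_linear.
by rewrite IH arr_act_linear.
Qed.

Lemma arr_act0 a : arr_act a 0 = 0.
Proof. by rewrite /arr_act -[X in _ *m X]/(0 : 'cV_ _) mulmx0 vinj0. Qed.

Lemma word_act_comp v s w r x :
  word_act v s (word_act w r x) =
  if v == word_head (w, r) then word_act w (s ++ r) x else 0.
Proof.
elim: s => [|a s IH] /=; last by rewrite IH; case: ifP => _ //; rewrite arr_act0.
case: r => [|b r] /=; rewrite /vert_act /arr_act /word_head /=.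
  by have [->|vw] := eqVneq v w; rewrite ?vinj_in // vinj_out ?vinj0 // eq_sym.
by have [->|vw] := eqVneq v (qhead b); rewrite ?vinj_in // vinj_out ?vinj0 // eq_sym.
Qed.

Lemma path_act_comp p q x :
  path_act (path_act x q) p = linext (path_act x) (pmul F p q).
Proof.
rewrite /path_act word_act_comp /pmul /composable -surjective_pairing.
case: ifP => c; last by rewrite linear0.
by rewrite linext_pelt val_pcat.
Qed.

(* The direct sum of the spaces F^(d v), as a left module over the path algebra
   via W. *)
Definition repmod of rep := vspace_sum.
HB.instance Definition _ := GRing.Zmodule.copy (repmod W) vspace_sum.

Definition repmod_scale (x : pathalg F Q) (u : repmod W) : repmod W :=
  linext (path_act u) x.

Lemma linext_path_act_linear x : linear (fun u => linext (path_act u) x).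
Proof.
move=> c u w; rewrite !(linextEw _ (fsubset_refl _)) scaler_sumr -big_split /=.
apply: eq_bigr => p _.
by rewrite /path_act word_act_linear scalerDr !scalerA mulrC.
Qed.

Fact repmod_scaleA x y u :
  repmod_scale x (repmod_scale y u) = repmod_scale (x * y) u.
Proof.
rewrite /repmod_scale.
have comp (M N P : lmodType F) (f : N -> P) (g : M -> N) :
    linear f -> linear g -> linear (fun x => f (g x)).
  by move=> lf lg c v w; rewrite lg lf.
have lin (z : vspace_sum) : linear (linext (path_act z)) by exact: linext_is_linear.
apply: (pathalg_ext (f := fun x => linext (path_act (linext (path_act u) y)) x)
  (g := fun x : pathalg F Q => linext (path_act u) (pathalg_mul x y))) => [||p].
- exact: lin.
- by apply: comp; [exact: lin | exact: pathalg_mul_linl].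
rewrite linext_pelt.
apply: (pathalg_ext (f := fun y => path_act (linext (path_act u) y) p)
  (g := fun y : pathalg F Q => linext (path_act u) (pathalg_mul (pelt F p) y)))
  => [||q].
- by apply: comp; [exact: word_act_linear | exact: lin].
- by apply: comp; [exact: lin | exact: pathalg_mul_linr].
by rewrite linext_pelt path_act_comp pathalg_mulU.
Qed.

Fact repmod_scale1 : left_id 1 repmod_scale.
Proof.
move=> u; rewrite /repmod_scale -[1]/(pathalg_one F Q) /pathalg_one linear_sum /=.
rewrite [RHS]vinj_sum; apply: eq_bigr => v _.
by rewrite linext_pelt.
Qed.

Fact repmod_scaleDr : right_distributive repmod_scale +%R.
Proof.
move=> x u w; rewrite /repmod_scale.
have := linext_path_act_linear x 1 u w; rewrite !scale1r; exact.
Qed.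

Fact repmod_scaleDl u : {morph repmod_scale^~ u : x y / x + y}.
Proof. by move=> x y; rewrite /repmod_scale linearD. Qed.

HB.instance Definition _ := GRing.Zmodule_isLmodule.Build (pathalg F Q) (repmod W)
  repmod_scaleA repmod_scale1 repmod_scaleDr repmod_scaleDl.

Lemma repmod_scaleZDl (c : F) (x y : pathalg F Q) (u : repmod W) :
  (c *: x + y) *: u =
  (c *: (x *: u : vspace_sum) + (y *: u : vspace_sum) : vspace_sum).
Proof. exact: linext_is_linear. Qed.

Lemma velt_act v (x : repmod W) : velt F v *: x = vert_act v x.
Proof. by rewrite -[LHS]/(linext _ _) linext_pelt. Qed.

Lemma aelt_act a (x : repmod W) : aelt F a *: x = arr_act a x.
Proof.
rewrite -[LHS]/(linext _ _) linext_pelt /path_act /= /arr_act /vert_act.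
by rewrite vinj_in.
Qed.

Lemma scalar_act (c : F) (x : repmod W) :
  (c *: (1 : pathalg F Q)) *: x = (c *: (x : vspace_sum) : vspace_sum).
Proof.
rewrite -[LHS]/(linext _ _) linearZ /=.
exact: (congr1 (vscale c) (repmod_scale1 x)).
Qed.

End Representations.

Record smquiver := SMQuiver {
  squiver :> quiver;
  phi0 : vert squiver -> vert squiver;
  phi1 : arr squiver -> arr squiver;
  eps : vert squiver -> int;
  sgn : arr squiver -> int;
  phi0K : involutive phi0;
  phi1K : involutive phi1;
  eps_sign : forall v, eps v = 1 \/ eps v = -1;
  sgn_sign : forall a, sgn a = 1 \/ sgn a = -1;
  head_phi1 : forall a, qhead (phi1 a) = phi0 (qtail a);
  phi1_loop : forall a, qhead a = qhead (phi1 a) -> a = phi1 a;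
  eps_phi0 : forall v, eps v * eps (phi0 v) = 1;
  sgn_phi1 : forall a, sgn a * sgn (phi1 a) = 1
}.

Lemma tail_phi1 (Q : smquiver) (a : arr Q) : qtail (phi1 a) = phi0 (qhead a).
Proof. by rewrite -[a in RHS]phi1K head_phi1 phi0K. Qed.

Section Star.
Variables (F : fieldType) (Q : smquiver).
Local Notation CQ := (pathalg F Q).

(* The anti-automorphism * of the path algebra:
   (a_1 ... a_k)^* = a_k^* ... a_1^*. *)
Definition astar (a : arr Q) : CQ :=
  (sgn a * eps (qhead a))%:~R *: aelt F (phi1 a).

Fixpoint word_star (v : vert Q) (s : seq (arr Q)) : CQ :=
  if s is a :: s' then word_star v s' * astar a else velt F (phi0 v).

Definition path_star (p : qpath Q) : CQ := word_star (val p).1 (val p).2.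

Definition pathalg_star (x : CQ) : CQ := linext path_star x.

Lemma star_velt v : pathalg_star (velt F v) = velt F (phi0 v).
Proof. by rewrite /pathalg_star linext_pelt. Qed.

Lemma star_aelt a : pathalg_star (aelt F a) = astar a.
Proof.
rewrite /pathalg_star linext_pelt /path_star /= /astar -pathalg_scaleAr.
congr (_ *: _); rewrite -[LHS]/(pathalg_mul _ _) pathalg_mulU /pmul.
have c : composable (vpath (phi0 (qtail a))) (apath (phi1 a)).
  by rewrite /composable /word_head /= head_phi1.
by rewrite c; congr pelt; apply: val_inj; rewrite val_pcat.
Qed.

Definition eps_elt : CQ := \sum_v (eps v)%:~R *: velt F v.

(* Scalars of F act on a module over the path algebra through c *: 1. *)
Record eps_mixed (M : lmodType CQ) (B : M -> M -> F) : Prop := EpsMixed {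
  mixed_findim : exists (n : nat) (e : 'I_n -> M), forall u : M,
    exists c : 'I_n -> F, u = \sum_i (c i *: (1 : CQ)) *: e i;
  mixed_linl : forall c u u' w,
    B ((c *: (1 : CQ)) *: u + u') w = c * B u w + B u' w;
  mixed_linr : forall c u w w',
    B u ((c *: (1 : CQ)) *: w + w') = c * B u w + B u w';
  mixed_nondegl : forall u, (forall w, B u w = 0) -> u = 0;
  mixed_nondegr : forall w, (forall u, B u w = 0) -> w = 0;
  mixed_sym : forall u w, B u w = B w (eps_elt *: u);
  mixed_adj : forall x u w, B (x *: u) w = B u (pathalg_star x *: w)
}.

End Star.

(* The equality of sizes vdim_phi0 is part of the equation relating gam v and
   gam (phi0 v); castmx transports along it. *)
Record smsetting (F : fieldType) (Q : smquiver) := SMSetting {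
  vdim : vert Q -> nat;
  vdim_phi0 : forall v, vdim (phi0 v) = vdim v;
  gam : forall v, 'M[F]_(vdim v);
  gam_unit : forall v, gam v \in unitmx;
  gam_sym : forall v,
    gam v = (eps v)%:~R *: castmx (vdim_phi0 v, vdim_phi0 v) (gam (phi0 v))^T
}.

Section Setting.
Variables (F : fieldType) (Q : smquiver) (G : smsetting F Q).
Local Notation d := (vdim G).
Local Notation gam := (gam G).
Local Notation dphi := (vdim_phi0 G).
Local Notation rep := (rep F d).

Definition Sgam := forall v : vert Q, 'M[F]_(d v).

Definition sstar (s : Sgam) : Sgam := fun v =>
  castmx (dphi v, dphi v)
    (invmx (gam (phi0 v)) *m (s (phi0 v))^T *m gam (phi0 v)).

Definition mstar (m : rep) : rep := fun a =>
  (sgn a * eps (qtail a))%:~R *: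
  castmx (dphi (qhead a), dphi (qtail a))
    (invmx (gam (phi0 (qhead a))) *m
     castmx (congr1 d (tail_phi1 a), congr1 d (head_phi1 a)) (m (phi1 a))^T *m
     gam (phi0 (qtail a))).

Record DGL := MkDGL {
  dgl_val :> forall v : vert Q, 'M[F]_(d v);
  dglP : forall v, dgl_val v *m sstar dgl_val v = 1%:M
}.

Record DRep := MkDRep {
  drep_val :> forall a : arr Q, 'M[F]_(d (qhead a), d (qtail a));
  drepP : forall a, mstar drep_val a = drep_val a
}.

Definition gform (x y : vspace_sum F d) : F :=
  \sum_v ((x v)^T *m gam v *m castmx (dphi v, erefl) (y (phi0 v))) 0 0.

Lemma castmx_mulmx m n p m' n' p' (A : 'M[F]_(m, n)) (B : 'M[F]_(n, p))
    (em : m = m') (en : n = n') (ep : p = p') :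
  castmx (em, ep) (A *m B) = castmx (em, en) A *m castmx (en, ep) B.
Proof. by case: _ / em; case: _ / en; case: _ / ep; rewrite !castmx_id. Qed.

Lemma castmx_inv n n' (A : 'M[F]_n) (e : n = n') :
  castmx (e, e) (invmx A) = invmx (castmx (e, e) A).
Proof. by case: _ / e; rewrite !castmx_id. Qed.

Lemma castmx_scale m n m' n' (e : (m = m') * (n = n')) c (A : 'M[F]_(m, n)) :
  castmx e (c *: A) = c *: castmx e A.
Proof. by case: e => em en; case: _ / em; case: _ / en; rewrite !castmx_id. Qed.

Lemma castmx_add m n m' n' (e : (m = m') * (n = n')) (A B : 'M[F]_(m, n)) :
  castmx e (A + B) = castmx e A + castmx e B.
Proof. by case: e => em en; case: _ / em; case: _ / en; rewrite !castmx_id. Qed.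

Lemma castmx0 m n m' n' (e : (m = m') * (n = n')) :
  castmx e (0 : 'M[F]_(m, n)) = 0.
Proof. by case: e => em en; case: _ / em; case: _ / en; rewrite !castmx_id. Qed.

Lemma castmx_irr m n m' n' (e e' : (m = m') * (n = n')) (A : 'M[F]_(m, n)) :
  castmx e A = castmx e' A.
Proof.
case: e e' => [em en] [em' en'].
by rewrite (eq_irrelevance em em') (eq_irrelevance en en').
Qed.

Lemma castmx_fam (X : forall v, 'M[F]_(d v)) v w (e : v = w)
    (e' : (d v = d w) * (d v = d w)) : castmx e' (X v) = X w.
Proof. by case: _ / e e' => e'; rewrite (castmx_irr e' (erefl, erefl)) castmx_id. Qed.

Lemma castmx_vec (x : vspace_sum F d) v w (e : v = w) (e' : (d v = d w) * (1 = 1)%N) :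
  castmx e' (x v) = x w.
Proof. by case: _ / e e' => e'; rewrite (castmx_irr e' (erefl, erefl)) castmx_id. Qed.

Lemma epsM (v : vert Q) : (eps v)%:~R * (eps v)%:~R = 1 :> F.
Proof. by rewrite -intrM; case: (eps_sign v) => ->. Qed.

(* gam (phi0 v), transported to the size vdim v. *)
Definition gamc v : 'M[F]_(d v) := castmx (dphi v, dphi v) (gam (phi0 v)).

Lemma gamcE v : gamc v = (eps v)%:~R *: (gam v)^T.
Proof.
rewrite [gam v in RHS]gam_sym linearZ /= scalerA epsM scale1r trmx_cast trmxK.
exact: castmx_irr.
Qed.

Lemma gamc_unit v : gamc v \in unitmx.
Proof.
rewrite gamcE unitmxZ ?unitmx_tr ?gam_unit //.
by apply/unitrP; exists (eps v)%:~R; rewrite epsM.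
Qed.

Lemma sstarE s v : sstar s v =
  invmx (gamc v) *m (castmx (dphi v, dphi v) (s (phi0 v)))^T *m gamc v.
Proof.
rewrite /sstar !(castmx_mulmx _ _ (dphi v) (dphi v) (dphi v)) castmx_inv trmx_cast.
by congr (_ *m _ *m _); exact: castmx_irr.
Qed.

Lemma gamc_phi v : castmx (dphi v, dphi v) (gamc (phi0 v)) = gam v.
Proof. by rewrite castmx_comp (castmx_fam gam (phi0K v)). Qed.

Lemma sstar_phi s v : castmx (dphi v, dphi v) (sstar s (phi0 v)) =
  invmx (gam v) *m (s v)^T *m gam v.
Proof.
rewrite sstarE !(castmx_mulmx _ _ (dphi v) (dphi v) (dphi v)) castmx_inv gamc_phi.
congr (_ *m _ *m _).
rewrite trmx_cast castmx_comp.
rewrite -(castmx_fam s (phi0K v) (congr1 d (phi0K v), congr1 d (phi0K v))).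
rewrite trmx_cast; exact: castmx_irr.
Qed.

Lemma sstarK s v : sstar (sstar s) v = s v.
Proof.
rewrite sstarE sstar_phi !trmx_mul trmxK trmx_inv.
have e : (gam v)^T = (eps v)%:~R *: gamc v.
  by rewrite gamcE scalerA epsM scale1r.
have u0 : ((eps v)%:~R : F) \is a GRing.unit.
  by apply/unitrP; exists (eps v)%:~R; rewrite epsM.
rewrite e invmxZ ?unitmxZ ?gamc_unit //.
do 3 rewrite -?scalemxAl -?scalemxAr.
rewrite scalerA divrr // scale1r !mulmxA mulVmx ?gamc_unit // mul1mx.
by rewrite -mulmxA mulVmx ?gamc_unit // mulmx1.
Qed.

(* m (phi1 a), transported to the sizes vdim (qtail a) and vdim (qhead a). *)
Definition mphi (m : rep) (a : arr Q) : 'M[F]_(d (qtail a), d (qhead a)) :=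
  castmx (etrans (congr1 d (head_phi1 a)) (dphi (qtail a)),
          etrans (congr1 d (tail_phi1 a)) (dphi (qhead a))) (m (phi1 a)).

Lemma mstarE m a : mstar m a = (sgn a * eps (qtail a))%:~R *:
  (invmx (gamc (qhead a)) *m (mphi m a)^T *m gamc (qtail a)).
Proof.
rewrite /mstar (castmx_mulmx _ _ (dphi (qhead a)) (dphi (qtail a)) (dphi (qtail a))).
rewrite (castmx_mulmx _ _ (dphi (qhead a)) (dphi (qhead a)) (dphi (qtail a))).
rewrite castmx_inv castmx_comp /mphi trmx_cast.
by congr (_ *: (_ *m _ *m _)); exact: castmx_irr.
Qed.

Lemma mphi_act (s k : Sgam) (m : rep) a :
  mphi (fun b => s (qhead b) *m m b *m k (qtail b)) a =
  castmx (dphi (qtail a), dphi (qtail a)) (s (phi0 (qtail a))) *m mphi m a *m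
  castmx (dphi (qhead a), dphi (qhead a)) (k (phi0 (qhead a))).
Proof.
set et := etrans (congr1 d (head_phi1 a)) (dphi (qtail a)).
set eh := etrans (congr1 d (tail_phi1 a)) (dphi (qhead a)).
rewrite /mphi (castmx_mulmx _ _ et eh eh) (castmx_mulmx _ _ et et eh).
congr (_ *m _ *m _).
  pose e := congr1 d (head_phi1 a).
  rewrite -(castmx_fam s (head_phi1 a) (e, e)) castmx_comp; exact: castmx_irr.
pose e := congr1 d (tail_phi1 a).
rewrite -(castmx_fam k (tail_phi1 a) (e, e)) castmx_comp; exact: castmx_irr.
Qed.

Lemma mstar_act (s k : Sgam) (m : rep) a :
  mstar (fun b => s (qhead b) *m m b *m k (qtail b)) a =
  sstar k (qhead a) *m mstar m a *m sstar s (qtail a).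
Proof.
rewrite !mstarE mphi_act !sstarE !trmx_mul -scalemxAr -scalemxAl.
congr (_ *: _); rewrite !mulmxA.
by rewrite !(mulmxK (gamc_unit _)).
Qed.

Fact dact_subproof (g : DGL) (W : DRep) a :
  mstar (fun b => g (qhead b) *m W b *m sstar g (qtail b)) a =
  g (qhead a) *m W a *m sstar g (qtail a).
Proof. by rewrite mstar_act sstarK drepP. Qed.

(* The action of g on W: g W g^*, where g^* = g^-1. *)
Definition dact (g : DGL) (W : DRep) : DRep := MkDRep (dact_subproof g W).

Lemma form_vinjl v (z : 'cV_(d v)) y :
  gform (vinj z) y = (z^T *m gam v *m castmx (dphi v, erefl) (y (phi0 v))) 0 0.
Proof.
rewrite /gform (bigD1 v) //= vinj_in big1 ?addr0 // => w wv.
by rewrite vinj_out 1?eq_sym // trmx0 !mul0mx mxE.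
Qed.

Lemma form_vinjr v (z : 'cV_(d (phi0 v))) x :
  gform x (vinj z) = ((x v)^T *m gam v *m castmx (dphi v, erefl) z) 0 0.
Proof.
rewrite /gform (bigD1 v) //= vinj_in big1 ?addr0 // => w wv.
rewrite vinj_out; first by rewrite castmx0 mulmx0 mxE.
by rewrite (can_eq (@phi0K Q)) eq_sym.
Qed.

Lemma form_alt x y : gform x y =
  \sum_v ((castmx (dphi v, erefl) (x (phi0 v)))^T *m gamc v *m y v) 0 0.
Proof.
rewrite /gform (reindex_inj (inv_inj (@phi0K Q))) /=; apply: eq_bigr => v _.
rewrite /gamc -[y v](castmx_vec y (phi0K v) (congr1 d (phi0K v), erefl)).
have gen n1 n2 n3 (e1 : n1 = n3) (e2 : n2 = n3) (e3 : n2 = n1)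
    (X : 'cV[F]_n1) (g : 'M[F]_n1) (Y : 'cV[F]_n2) :
  X^T *m g *m castmx (e3, erefl) Y =
  (castmx (e1, erefl) X)^T *m castmx (e1, e1) g *m castmx (e2, erefl) Y.
  case: n3 / e2 e1 => e1; case: n1 / e3 e1 X g => e1 X g.
  by rewrite (eq_axiomK e1) !castmx_id.
by rewrite (gen _ _ _ (dphi v) (congr1 d (phi0K v)) (dphi (phi0 v))).
Qed.

Lemma mx00_eq0 m n (A : 'M[F]_(m, n)) :
  (forall x y, (x^T *m A *m y : 'M[F]_1) 0 0 = 0) -> A = 0.
Proof.
move=> A0; apply/matrixP => i j; rewrite mxE.
have := A0 (delta_mx i 0) (delta_mx j 0).
by rewrite trmx_delta -rowE -colE !mxE.
Qed.

Lemma castmx_vsum v (z : 'cV[F]_(d v)) :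
  castmx (dphi v, erefl)
    (vinj (castmx (esym (dphi v), erefl) z) (phi0 v)) = z.
Proof. by rewrite vinj_in castmxKV. Qed.

Lemma vinj_cast v w (e : v = w) (e' : (d v = d w) * (1 = 1)%N) (z : 'cV[F]_(d v)) :
  vinj (castmx e' z) = vinj z.
Proof.
by case: _ / e e' => e'; rewrite (castmx_irr e' (erefl, erefl)) castmx_id.
Qed.

Section Mixed.
Variable W : rep.
Local Notation M := (repmod W).

Lemma eps_act (x : M) v : (eps_elt F Q *: x : M) v = (eps v)%:~R *: x v.
Proof.
rewrite /eps_elt scaler_suml.
have E w : ((eps w)%:~R *: velt F w) *: x = (eps w)%:~R *: vinj (x w) :> vspace_sum F d.
  rewrite -[LHS]/(linext _ _) linearZ /=.
  exact: (congr1 (vscale _) (velt_act w x)).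
rewrite (eq_bigr _ (fun w _ => E w)) vsumE (bigD1 v) //= big1 ?addr0 => [|w wv].
  by rewrite -[LHS]/(_ *: vinj (x v) v) vinj_in.
by rewrite -[LHS]/(_ *: vinj (x w) v) vinj_out // scaler0.
Qed.

Lemma form_linl c (x x' y : vspace_sum F d) :
  gform (c *: x + x') y = c * gform x y + gform x' y.
Proof.
rewrite /gform mulr_sumr -big_split /=; apply: eq_bigr => v _.
rewrite -[(c *: x + x') v]/(c *: x v + x' v) linearP /= !mulmxDl.
by rewrite -!scalemxAl !mxE.
Qed.

Lemma form_linr c (x y y' : vspace_sum F d) :
  gform x (c *: y + y') = c * gform x y + gform x y'.
Proof.
rewrite /gform mulr_sumr -big_split /=; apply: eq_bigr => v _.
rewrite -[(c *: y + y') _]/(c *: y _ + y' _) castmx_add castmx_scale !mulmxDr.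
by rewrite -!scalemxAr !mxE.
Qed.

Definition mixed_arr (a : arr Q) : Prop :=
  (W a)^T *m gam (qhead a) =
  (sgn a * eps (qhead a))%:~R *: (gam (qtail a) *m mphi W a).

Lemma mixed_arrP a : mixed_arr a <-> mstar W a = W a.
Proof.
rewrite mstarE /mixed_arr.
have gT v : (gam v)^T = (eps v)%:~R *: gamc v.
  by rewrite gamcE scalerA epsM scale1r.
have inj : (W a)^T *m gam (qhead a) =
    (sgn a * eps (qhead a))%:~R *: (gam (qtail a) *m mphi W a) <->
  gamc (qhead a) *m W a =
    (sgn a * eps (qtail a))%:~R *: ((mphi W a)^T *m gamc (qtail a)).
  split=> [/(congr1 trmx)|e].
    rewrite trmx_mul trmxK linearZ /= trmx_mul !gT -scalemxAl -scalemxAr.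
    move/(congr1 (fun X => (eps (qhead a))%:~R *: X)).
    rewrite !scalerA epsM scale1r => ->; congr (_ *: _).
    by rewrite !intrM (mulrC (sgn a)%:~R) !mulrA epsM mul1r.
  apply: (can_inj (@trmxK F _ _)); rewrite trmx_mul trmxK linearZ /= trmx_mul !gT -scalemxAl.
  rewrite e -scalemxAr !scalerA; congr (_ *: _).
  by rewrite !intrM mulrCA mulrA.
rewrite inj; split=> [e|<-].
  by rewrite -mulmxA scalemxAr -e mulKmx ?gamc_unit.
by rewrite -scalemxAr !mulmxA mulmxV ?gamc_unit // mul1mx.
Qed.

Lemma form_arr_actl a x y :
  gform (arr_act W a x) y = ((x (qtail a))^T *m ((W a)^T *m gam (qhead a)) *m
    castmx (dphi (qhead a), erefl) (y (phi0 (qhead a)))) 0 0.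
Proof. by rewrite form_vinjl trmx_mul !mulmxA. Qed.

Lemma form_arr_actr a x y :
  gform x (arr_act W (phi1 a) y) =
  ((x (qtail a))^T *m (gam (qtail a) *m mphi W a) *m
    castmx (dphi (qhead a), erefl) (y (phi0 (qhead a)))) 0 0.
Proof.
rewrite /arr_act -(vinj_cast (head_phi1 a) (congr1 d (head_phi1 a), erefl)).
rewrite form_vinjr castmx_comp.
rewrite -(castmx_vec y (tail_phi1 a) (congr1 d (tail_phi1 a), erefl)) castmx_comp.
set et := etrans (congr1 d (head_phi1 a)) (dphi (qtail a)).
set eh := etrans (congr1 d (tail_phi1 a)) (dphi (qhead a)).
by rewrite (castmx_mulmx _ _ _ eh) !mulmxA.
Qed.

Lemma form_astar a (x y : M) :
  gform x (astar F a *: y) = (sgn a * eps (qhead a))%:~R *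
    gform x (arr_act W (phi1 a) y).
Proof.
have -> : astar F a *: y = (sgn a * eps (qhead a))%:~R *:
    (arr_act W (phi1 a) y) :> vspace_sum F d.
  rewrite -[LHS]/(linext _ _) linearZ /=.
  exact: (congr1 (vscale _) (aelt_act (phi1 a) y)).
have f0 : gform x 0 = 0.
  by have := form_linr (-1) x 0 0; rewrite scaleN1r oppr0 addr0 mulN1r addNr.
by have := form_linr (sgn a * eps (qhead a))%:~R x (arr_act W (phi1 a) y) 0;
   rewrite !addr0 f0 addr0.
Qed.

(* On the underlying space with this form, being epsilon-mixed amounts to
   W being a point of DRep. *)
Lemma DRep_mixed :
  (forall a, mstar W a = W a) <-> eps_mixed (gform : M -> M -> F).
Proof.
split=> [mW|[_ _ _ _ _ _ adj] a]; last first.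
  apply/mixed_arrP; rewrite /mixed_arr; apply/eqP; rewrite -subr_eq0; apply/eqP.
  apply: mx00_eq0 => x y.
  pose X := vinj x; pose Y := vinj (castmx (esym (dphi (qhead a)), erefl) y).
  have := adj (aelt F a) X Y; rewrite aelt_act form_arr_actl.
  rewrite star_aelt form_astar form_arr_actr /X /Y vinj_in castmx_vsum => e.
  by rewrite mulmxBr mulmxBl -scalemxAr -scalemxAl mxE [X in _ + X]mxE
    [X in _ - X]mxE e subrr.
split.
- pose T := {v : vert Q & 'I_(d v)}.
  exists #|{: T}|, (fun i => let t : T := enum_val i in
    vinj (delta_mx (tagged t) 0 : 'cV[F]_(d (tag t)))) => u.
  exists (fun i => let t : T := enum_val i in u (tag t) (tagged t) 0).
  transitivity (\sum_v \sum_j u v j 0 *: vinj (delta_mx j 0 : 'cV[F]_(d v))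
    : vspace_sum F d).
    rewrite [LHS]vinj_sum; apply: eq_bigr => v _; apply: vspaceP => w.
    rewrite vsumE; have [<-|vw] := eqVneq v w; last first.
      rewrite vinj_out // big1 // => j _.
      by rewrite -[LHS]/(_ *: vinj _ w) vinj_out // scaler0.
    rewrite vinj_in [LHS]matrix_sum_delta; apply: eq_bigr => j _.
    by rewrite big_ord1 -[RHS]/(_ *: vinj _ v) vinj_in.
  rewrite sig_big_dep /= (reindex_onto (enum_val : 'I_#|{: T}| -> T) enum_rank) /=.
    by apply: eq_big => [i|i _]; rewrite ?enum_valK ?eqxx ?scalar_act.
  by move=> t _; rewrite enum_rankK.
- by move=> c u u' w; rewrite scalar_act form_linl.
- by move=> c u w w'; rewrite scalar_act form_linr.
- move=> u u0; apply: vspaceP => v.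
  have: (u v)^T *m gam v = 0.
    apply: mx00_eq0 => x y.
    have := u0 (vinj (castmx (esym (dphi v), erefl) y)).
    rewrite form_vinjr castmxKV => e.
    rewrite (mx11_scalar x^T) mul_scalar_mx -scalemxAl mxE.
    by rewrite [X in _ * X]e mulr0.
  move=> /(congr1 (mulmx^~ (invmx (gam v)))).
  by rewrite mulmxK ?gam_unit // mul0mx => /(congr1 trmx); rewrite trmxK trmx0.
- move=> w w0; apply: vspaceP => v; rewrite -[v]phi0K.
  move: (phi0 v) => {}v.
  have: gam v *m castmx (dphi v, erefl) (w (phi0 v)) = 0.
    apply: mx00_eq0 => x y.
    have := w0 (vinj x); rewrite form_vinjl => e.
    rewrite (mx11_scalar y) mul_mx_scalar mulmxA mxE.
    by rewrite [X in _ * X]e mulr0.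
  move=> /(congr1 (mulmx (invmx (gam v)))).
  rewrite mulKmx ?gam_unit // mulmx0.
  move=> /(congr1 (castmx (esym (dphi v), erefl))).
  by rewrite castmx0 castmx_comp (castmx_irr _ (erefl, erefl)) castmx_id.
- move=> u w; rewrite [RHS]form_alt; apply: eq_bigr => v _.
  rewrite gamcE eps_act; do 2 rewrite -?scalemxAl -?scalemxAr.
  rewrite scalerA epsM scale1r.
  set A := (_ *m gam v *m _); transitivity (A^T 0 0); first by rewrite [RHS]mxE.
  by rewrite /A !trmx_mul trmxK mulmxA.
- have adj_arr a (x y : M) : gform (arr_act W a x) y = gform x (astar F a *: y).
    rewrite form_arr_actl form_astar form_arr_actr.
    have /mixed_arrP -> := mW a.
    by rewrite -scalemxAr -scalemxAl mxE.
  move=> x u w; move: x.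
  apply: (pathalg_ext (M := F^o)) => [c x y|c x y|p].
  + by rewrite repmod_scaleZDl form_linl.
  + by rewrite /pathalg_star linearP repmod_scaleZDl form_linr.
  rewrite /pathalg_star linext_pelt -[pelt F p *: u]/(linext _ _) linext_pelt.
  rewrite /path_act /path_star; move: (val p) => [v s] /=.
  elim: s w => [|a s IH] w /=.
    by rewrite velt_act form_vinjl /vert_act form_vinjr.
  by rewrite adj_arr IH scalerA.
Qed.

End Mixed.

Import mpoly.

Definition coord := {a : arr Q & ('I_(d (qhead a)) * 'I_(d (qtail a)))%type}.

Definition coordv (W : DRep) (i : coord) : F :=
  W (tag i) (tagged i).1 (tagged i).2.

(* C[DRep], as functions on the linear space DRep: the restrictions of the
   polynomials in the matrix entries. *)
Definition regular (f : DRep -> F) : Prop :=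
  exists p : mpoly #|{: coord}| F,
    forall W, f W = meval (fun i => coordv W (enum_val i)) p.

Definition invariant (f : DRep -> F) : Prop :=
  forall (g : DGL) (W : DRep), f (dact g W) = f W.

Definition reg_inv : {pred DRep -> F^o} := fun f => `[< regular f /\ invariant f >].

Lemma reg_inv_subring : subring_closed reg_inv.
Proof.
split.
- by apply/asboolP; split=> //; exists (mpolyC _ (1 : F)) => W; rewrite mevalC.
- move=> f g /asboolP[[p fp] fi] /asboolP[[q gq] gi]; apply/asboolP; split.
    by exists (p - q) => W; rewrite mevalB -fp -gq.
  by move=> h W; rewrite -[LHS]/(f _ - g _) fi gi.
- move=> f g /asboolP[[p fp] fi] /asboolP[[q gq] gi]; apply/asboolP; split.
    by exists (p * q) => W; rewrite mevalM -fp -gq.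
  by move=> h W; rewrite -[LHS]/(f _ * g _) fi gi.
Qed.

Lemma reg_inv_scaler : GRing.scaler_closed reg_inv.
Proof.
move=> c f /asboolP[[p fp] fi]; apply/asboolP; split.
  by exists (c *: p) => W; rewrite mevalZ -fp.
by move=> h W; rewrite -[LHS]/(c * f _) fi.
Qed.

HB.instance Definition _ :=
  GRing.isSubringClosed.Build (DRep -> F^o) reg_inv reg_inv_subring.
HB.instance Definition _ :=
  GRing.isScaleClosed.Build F (DRep -> F^o) reg_inv reg_inv_scaler.

Record inv_ring := InvRing { inv_fun :> DRep -> F^o; inv_funP : inv_fun \in reg_inv }.

HB.instance Definition _ := [isSub for inv_fun].
HB.instance Definition _ := [Choice of inv_ring by <:].
HB.instance Definition _ := GRing.SubChoice_isSubComPzRing.Build _ _ inv_ring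
  (GRing.subringClosedP reg_inv).
HB.instance Definition _ := [SubZmodule_isSubLmodule of inv_ring by <:].

Fact zero_subproof a : mstar (fun b => 0) a = 0.
Proof. by rewrite mstarE /mphi castmx0 trmx0 mulmx0 mul0mx scaler0. Qed.

Fact inv_ring_oner_neq0 : (1 : inv_ring) != 0.
Proof.
apply/eqP => /(congr1 (fun f : inv_ring => f (MkDRep zero_subproof))) /eqP.
by rewrite -[X in X == _]/(1 : F) -[X in _ == X]/(0 : F) oner_eq0.
Qed.
HB.instance Definition _ := GRing.PzSemiRing_isNonZero.Build inv_ring inv_ring_oner_neq0.

Fact inv_ring_scaleAl (c : F) (f g : inv_ring) : c *: (f * g) = (c *: f) * g.
Proof. by apply: val_inj; apply: funext => W; exact: mulrA. Qed.
HB.instance Definition _ := GRing.Lmodule_isLalgebra.Build F inv_ring inv_ring_scaleAl.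
HB.instance Definition _ := GRing.Lalgebra_isComAlgebra.Build F inv_ring.

(* The points of the affine variety with coordinate ring C[DRep]^DGL: the
   algebra homomorphisms to the ground field. *)
Definition Diss := {lrmorphism inv_ring -> F | *%R}.

Definition eval_at (W : DRep) (f : inv_ring) : F := f W.

Fact eval_at_zmod W : zmod_morphism (eval_at W).
Proof. by []. Qed.
Fact eval_at_monoid W : monoid_morphism (eval_at W).
Proof. by []. Qed.
Fact eval_at_scalable W : scalable_for *%R (eval_at W).
Proof. by []. Qed.
HB.instance Definition _ W :=
  GRing.isZmodMorphism.Build inv_ring F (eval_at W) (eval_at_zmod W).
HB.instance Definition _ W :=
  GRing.isMonoidMorphism.Build inv_ring F (eval_at W) (eval_at_monoid W).
HB.instance Definition _ W :=
  GRing.isScalable.Build F inv_ring F *%R (eval_at W) (eval_at_scalable W).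

Definition quot_map (W : DRep) : Diss := eval_at W.

Definition drep_module (W : DRep) : lmodType (pathalg F Q) :=
  repmod (drep_val W).

Definition ss_mixed (W : DRep) : Prop :=
  semisimple (drep_module W) /\
  @eps_mixed F Q (drep_module W) gform.

Definition DRep_isomorphic (W W' : DRep) : Prop :=
  mod_isomorphic (drep_module W) (drep_module W').

End Setting.

(* Main.v *)
(** Proof idea.  Separation: traces of paths are invariant functions, and two semisimple modules
    with the same traces are isomorphic.  Conversely, if f is a module isomorphism between two
    points of DRep, then h = f^* f is self-adjoint and commutes with the arrows, so that
    f h^(-1/2), where the square root is a polynomial in h, is an isometry: isomorphic points lie
    in the same orbit of DGL.

    Surjectivity: after a change of basis making the form unitary, DGL is closed under conjugate
    transposition, so in each space of tensors the invariants and the span of the g c - c are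
    orthogonal complements.  Hence the kernel of a character of the ring of invariants generates
    a proper ideal of C[DRep], and the Nullstellensatz gives a point of the fibre.  Among the points
    of the fibre and the *-stable families of orthogonal idempotents commuting with them, take one
    with the largest number of nonzero idempotents.  If the image of one of them were not simple, it
    could be cut by the projection f onto a submodule that is either nondegenerate or isotropic, in
    the latter case after degenerating the point along the one-parameter subgroup
    t f + t^-1 f^* + (1 - f - f^* ).  So the images are simple and the point is semisimple. *)
From HB Require Import structures.
Require Import Defs.
From mathcomp Require Import all_boot all_order all_algebra.
From mathcomp Require mpoly.
From mathcomp Require Import boolp classical_sets functions.
From mathcomp Require Import reals complex mxtens ring.
Set Implicit Arguments.
Unset Strict Implicit.
Unset Printing Implicit Defensive.
Import Order.TTheory GRing.Theory Num.Theory.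
Local Open Scope ring_scope.

(** * The Nullstellensatz over an uncountable field *)

Section MpolyInduction.
Import mpoly.

(** The obstacle in surjectivity is that the group acts linearly on tensors, whereas the ring
    consists of functions on [DRep]: many tensors define the same function, and a tensor that
    defines an invariant function need not be fixed. The orthogonal splitting of tensors must
    therefore be made compatible with the passage to functions. This takes a second orthogonal
    complement, that of the tensors vanishing on [DRep], and gives that a function that is both
    invariant and a sum of differences is zero. In separation, equal traces are exploited through
    one homomorphism at a time: its kernel and its cokernel again have equal traces, and in
    characteristic 0 the trace of an idempotent sees its rank. So the rank of a homomorphism can be
    raised until it is invertible. The idempotents are permuted by the involution so that the
    diagonal part of a point of [DRep] stays in [DRep]. Their ranks add up to the dimension, so a
    family with the most nonzero members exists; it replaces an induction over smaller settings. *)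

Lemma mpoly_ind_gen (F : comNzRingType) N (P : mpoly N F -> Prop) :
  (forall c, P c%:MP) -> (forall i, P 'X_i) ->
  (forall p q, P p -> P q -> P (p + q)) -> (forall p q, P p -> P q -> P (p * q)) ->
  forall p, P p.
Proof.
move=> PC PX PD PM p.
have P0 : P 0 by rewrite -mpolyC0.
have P1 : P 1 by rewrite -mpolyC1.
rewrite [p]mpolyE; elim/big_rec: _ => // t q _ Pq; apply: (PD) => //.
rewrite -mul_mpolyC; apply: (PM) => //; rewrite mpolyXE_id.
elim/big_rec: _ => // i r _ Pr; apply: (PM) => //.
by elim: (t i) => [|k IH]; rewrite ?expr0 // exprS; apply: (PM).
Qed.

End MpolyInduction.

Section Nullstellensatz.
Import mpoly.
Variables (F : closedFieldType) (N : nat).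
Hypothesis uncountableF : forall u : nat -> F, exists x, forall n, u n <> x.

Local Notation MP := (mpoly N F).

Record proper_ideal (I : MP -> Prop) : Prop := ProperIdeal {
  idealD : forall p q, I p -> I q -> I (p + q);
  idealM : forall p q, I q -> I (p * q);
  ideal_proper : ~ I 1 }.

Lemma ideal_sum I (J : Type) (r : seq J) (P : pred J) (f : J -> MP) :
  proper_ideal I -> I 0 -> (forall j, I (f j)) -> I (\sum_(j <- r | P j) f j).
Proof.
by move=> pI I0 If; elim/big_rec: _ => // j x _ Ix; apply: idealD.
Qed.

(** If all sublevel sets of [k] were finite, every fibre would be contained in a finite list, and
    [x] could be recovered from [k x] and its position in the list of its fibre. Pairs of naturals
    would then enumerate [F]. *)
Lemma infinite_fiber (k : F -> nat) :
  exists m, forall D, exists2 s : seq F, uniq s /\ size s = D & forall c, c \in s -> (k c <= m)%N.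
Proof.
apply: contrapT => /forallNP H.
have H' m : exists D, forall s : seq F, uniq s -> (forall c, c \in s -> (k c <= m)%N) ->
    (size s < D)%N.
  have /existsNP[D HD] := H m; exists D => s us sm; rewrite ltnNge; apply/negP => Ds.
  apply: HD; exists (take D s); first by rewrite take_uniq // size_takel.
  by move=> c /mem_take; exact: sm.
have fib m : exists s : seq F, forall c, k c = m -> c \in s.
  have [D HD] := H' m.
  pose P n := `[< exists s : seq F, [/\ uniq s, size s = n & forall c, c \in s -> (k c <= m)%N] >].
  have P0 : exists n, P n by exists 0%N; apply/asboolP; exists [::].
  have PD n : P n -> (n <= D)%N.
    by move=> /asboolP[s [us <- sm]]; apply: ltnW; exact: HD.
  case: (ex_maxnP P0 PD) => n /asboolP[s [us sn sm]] nmax.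
  exists s => c kc; apply/negP => /negP cs.
  have: P n.+1.
    apply/asboolP; exists (c :: s); split=> /=; rewrite ?cs ?sn //.
    by move=> c'; rewrite inE => /orP[/eqP->|/sm//]; rewrite kc.
  by move=> /nmax; rewrite ltnn.
have [S HS] := choice fib.
have [x Hx] := uncountableF (fun n => if unpickle n is Some p then nth 0 (S p.1) p.2 else 0).
apply: (Hx (pickle (k x, index x (S (k x))))).
by rewrite pickleK /= nth_index ?HS.
Qed.

(** [msize p <= m] means degree below [m], so the [g j] lie in the span of [D] monomials. *)
Lemma bounded_dependent (m : nat) (D := #|{: 'X_{1..N < m}}|) (g : 'I_D.+1 -> MP) :
  (forall j, (msize (g j) <= m)%N) ->
  exists2 l : 'I_D.+1 -> F, \sum_j l j *: g j = 0 & exists j, l j != 0.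
Proof.
move=> gm.
pose M : 'M[F]_(D.+1, D) := \matrix_(j, i) (g j)@_(enum_val i : 'X_{1..N < m}).
have: kermx M != 0.
  rewrite -mxrank_eq0 mxrank_ker -lt0n subn_gt0.
  by apply: leq_ltn_trans (rank_leq_col M) _.
move=> /rowV0Pn[v /sub_kermxP vM v0].
exists (fun j => v 0 j); last first.
  apply/existsP; apply: contraNT v0; rewrite negb_exists => /forallP v0.
  by apply/eqP/rowP => j; rewrite mxE; apply/eqP; rewrite -[_ == _]negbK v0.
apply/mpolyP => t; rewrite mcoeff0 linear_sum /=.
have [mt|mt] := ltnP (mdeg t) m; last first.
  apply: big1 => j _; rewrite mcoeffZ memN_msupp_eq0 ?mulr0 //.
  apply: contraTN mt => /msize_mdeg_lt; rewrite -ltnNge => tg.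
  exact: leq_trans tg (gm j).
have /(congr1 (fun A : 'rV_D => A 0 (enum_rank (BMultinom mt)))) := vM.
rewrite !mxE; apply: etrans; apply: eq_bigr => j _.
by rewrite mcoeffZ mxE enum_rankK.
Qed.

Definition add_lin (I : MP -> Prop) (i : 'I_N) (c : F) (p : MP) : Prop :=
  exists2 q, I q & exists r, p = q + r * ('X_i - c%:MP).

(** Otherwise every ['X_i - c] has an inverse [g c] modulo [I]. Infinitely many of these inverses
    have bounded size, hence some satisfy a linear relation. Clearing denominators puts a nonzero
    polynomial in ['X_i] into [I]; its linear factors are invertible modulo [I], so 1 would lie in
    [I]. *)
Lemma add_lin_proper I i : proper_ideal I -> I 0 ->
  exists c, proper_ideal (add_lin I i c).
Proof.
move=> pI I0.
have addP c : ~ add_lin I i c 1 -> proper_ideal (add_lin I i c).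
  move=> n1; split=> //.
  - move=> p q [p1 Ip [p2 ->]] [q1 Iq [q2 ->]].
    exists (p1 + q1); first exact: idealD.
    by exists (p2 + q2); rewrite mulrDl addrACA.
  - move=> p q [q1 Iq [q2 ->]]; exists (p * q1); first exact: idealM.
    by exists (p * q2); rewrite mulrDr mulrA.
apply: contrapT => /forallNP H.
have {}H c : exists r, I (1 - r * ('X_i - c%:MP)).
  have [q Iq [r e]] : add_lin I i c 1.
    by apply: contrapT => /addP; apply: H.
  by exists r; rewrite e addrK.
have [g Hg] := choice H.
have [m Hm] := infinite_fiber (fun c => msize (g c)).
set D := #|{: 'X_{1..N < m}}|.
have [s [us ss] sm] := Hm D.+1.
pose c (j : 'I_D.+1) := s`_j.
have cs j : c j \in s by rewrite mem_nth // ss.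
have cinj j l : c j = c l -> j = l.
  by move=> /eqP; rewrite nth_uniq ?ss // => /eqP/val_inj.
have [j|l lg [j0 lj0]] := bounded_dependent (g := fun j => g (c j)) (m := m).
  exact: sm.
(* The sum of the fractions [l j / ('X - c j)], with denominators cleared; at [c j0] only the term
   of [j0] survives. *)
pose P : {poly F} := \sum_j l j *: \prod_(k < D.+1 | k != j) ('X - (c k)%:P).
have P0 : P != 0.
  apply/eqP => /(congr1 (fun p : {poly F} => p.[c j0])); rewrite horner0 horner_sum.
  rewrite (bigD1 j0) //= [X in _ + X]big1 => [|j jj0]; last first.
    by rewrite hornerZ horner_prod (bigD1 j0) 1?eq_sym //= hornerXsubC subrr mul0r mulr0.
  rewrite addr0 hornerZ => /eqP; rewrite mulf_eq0 (negPf lj0) horner_prod /=.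
  move=> /prodf_eq0[k kj0]; rewrite hornerXsubC subr_eq0 => /eqP/cinj e.
  by rewrite e eqxx in kj0.

have hlin r : horner_alg ('X_i : MP) ('X - r%:P) = 'X_i - r%:MP.
  by rewrite rmorphB /= horner_algX horner_algC alg_mpolyC.
have trans p q : I (p - q) -> I q -> I p.
  by move=> Ipq Iq; rewrite -[p](subrK q); apply: idealD.
(* Modulo [I], the product over [k != j] is [g (c j)] times the full product, so that [P] becomes
   the relation [lg] times the full product. *)
have IP : I (horner_alg ('X_i : MP) P).
  have e : \sum_j l j *: (g (c j) * \prod_k ('X_i - (c k)%:MP)) = 0.
    rewrite (eq_bigr (fun j => l j *: g (c j) * \prod_k ('X_i - (c k)%:MP))).
      by rewrite -mulr_suml lg mul0r.
    by move=> j _; rewrite scalerAl.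
  rewrite -[horner_alg ('X_i : MP) P]subr0 -e /P rmorph_sum /= -sumrB; apply: ideal_sum => // j.
  rewrite linearZ /= mulr_algl -scalerBr -mul_mpolyC; apply: (idealM pI).
  rewrite rmorph_prod /= (eq_bigr _ (fun k _ => hlin (c k))).
  rewrite [X in _ - _ * X](bigD1 j) //= mulrA -[X in X - _]mul1r -mulrBl mulrC.
  exact: (idealM pI).
have hfin (r : seq F) : I (horner_alg ('X_i : MP) (\prod_(z <- r) ('X - z%:P))) -> I 1.
  elim: r => [|z r IH]; first by rewrite big_nil rmorph1.
  rewrite big_cons rmorphM /= hlin => Iz; apply: IH.
  apply: (trans _ (g z * (('X_i - z%:MP) * horner_alg ('X_i : MP) (\prod_(j <- r) ('X - j%:P))))).
    rewrite mulrA -[X in X - _]mul1r -mulrBl mulrC; exact: (idealM pI).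
  exact: (idealM pI).
have [r Pr] := closed_field_poly_normal P.
apply: (ideal_proper pI); apply: (hfin r).
have lP : lead_coef P != 0 by rewrite lead_coef_eq0.
have -> : \prod_(z <- r) ('X - z%:P) = (lead_coef P)^-1 *: P.
  by rewrite {2}Pr scalerA mulVf // scale1r.
rewrite linearZ /= mulr_algl -mul_mpolyC; exact: (idealM pI).
Qed.

(** A polynomial ['X_i - m i] is adjoined for one variable after the other, the ideal staying
    proper. Once all are present, every [p] is congruent to its value at [m], and a nonzero value
    would be a unit of the ideal. *)
Lemma nullstellensatz I : proper_ideal I ->
  exists m : 'I_N -> F, forall p, I p -> meval m p = 0.
Proof.
move=> pI0.
(* The empty predicate satisfies [proper_ideal] and is treated apart; a nonempty one contains 0. *)
have [noI|/existsNP[p0 /contrapT Ip0]] := pselect (forall p, ~ I p).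
  by exists (fun _ => 0) => p /noI.
have I0 : I 0 by rewrite -(mul0r p0); apply: idealM.
suff [J [m [pJ IJ Jm]]] : exists (J : MP -> Prop) (m : 'I_N -> F),
    [/\ proper_ideal J, forall p, I p -> J p & forall i, J ('X_i - (m i)%:MP)].
  have J0 : J 0 by apply: IJ.
  have Jev p : J (p - (meval m p)%:MP).
    elim/mpoly_ind_gen: p => [c|i|p q Jp Jq|p q Jp Jq].
    - by rewrite mevalC subrr.
    - by rewrite mevalXU.
    - by rewrite mevalD mpolyCD opprD addrACA; apply: (idealD pJ).
    rewrite mevalM mpolyCM.
    have -> : p * q - p.@[m]%:MP * q.@[m]%:MP =
        p * (q - q.@[m]%:MP) + q.@[m]%:MP * (p - p.@[m]%:MP).
      by rewrite !mulrBr [q.@[m]%:MP * p]mulrC [X in _ + (_ - X)]mulrC addrA subrK.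
    by apply: (idealD pJ); apply: (idealM pJ).
  exists m => p Ip; apply/eqP; apply: contrapT => /negP pm.
  apply: (ideal_proper pJ).
  have -> : 1 = ((p.@[m])^-1)%:MP * p + (- ((p.@[m])^-1)%:MP) * (p - (p.@[m])%:MP).
    by rewrite mulNr -mulrBr subKr -mpolyCM mulVf // mpolyC1.
  by apply: (idealD pJ); apply: (idealM pJ) => //; apply: IJ.
have step k : exists (J : MP -> Prop) (m : 'I_N -> F),
    [/\ proper_ideal J, forall p, I p -> J p &
       forall i : 'I_N, (i < k)%N -> J ('X_i - (m i)%:MP)].
  elim: k => [|k [J [m [pJ IJ Jm]]]]; first by exists I, (fun _ => 0).
  have [kN|kN] := ltnP k N; last first.
    by exists J, m; split=> // i ik; apply: Jm; apply: leq_trans kN.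
  have J0 : J 0 by apply: IJ.
  pose i0 := Ordinal kN.
  have [c pJ'] := add_lin_proper i0 pJ J0.
  have JJ' p : J p -> add_lin J i0 c p.
    by move=> Jp; exists p => //; exists 0; rewrite mul0r addr0.
  exists (add_lin J i0 c), (fun i => if i == i0 then c else m i); split=> //.
    by move=> p /IJ/JJ'.
  move=> i; rewrite ltnS leq_eqVlt; have [->|ni] := eqVneq i i0 => [_|].
    by exists 0 => //; exists 1; rewrite add0r mul1r.
  case/orP => [/eqP e|ik]; last by apply: JJ'; apply: Jm.
  by case/negP: ni; apply/eqP/val_inj.
have [J [m [pJ IJ Jm]]] := step N.
by exists J, m; split=> // i; apply: Jm.
Qed.

End Nullstellensatz.

(** * Uncountability of the complex numbers, by nested intervals *)

Section Uncountable.
Local Open Scope classical_set_scope.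
Variables (R : realType) (u : nat -> R).

(** The closed right half contains the midpoint, which may be [x]; this is why it is halved once
    more when [x <= m]. *)
Definition avoid (x : R) (p : R * R) : R * R :=
  let m := (p.1 + p.2) / 2 in
  if x <= m then ((m + p.2) / 2, p.2) else (p.1, m).

Fixpoint nest n : R * R := if n is n'.+1 then avoid (u n') (nest n') else (0, 1).

Lemma avoidP x p : p.1 < p.2 ->
  [/\ p.1 <= (avoid x p).1, (avoid x p).1 < (avoid x p).2, (avoid x p).2 <= p.2 &
      ~~ ((avoid x p).1 <= x <= (avoid x p).2)].
Proof.
case: p => a b /= ab; rewrite /avoid /=.
have am : a < (a + b) / 2 by rewrite midf_lt.
have mb : (a + b) / 2 < b by rewrite midf_lt.
have m2 : (a + b) / 2 < ((a + b) / 2 + b) / 2 by rewrite midf_lt.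
have m3 : ((a + b) / 2 + b) / 2 < b by rewrite midf_lt.
have [xm|mx] := leP x ((a + b) / 2) => /=.
  split=> //; first by apply: ltW; exact: lt_trans m2.
  by rewrite negb_and -ltNge (le_lt_trans xm).
by split=> //; [exact: ltW | rewrite negb_and -!ltNge mx orbT].
Qed.

Lemma nest_lt n : (nest n).1 < (nest n).2.
Proof. by elim: n => [|n IH] /=; [exact: ltr01 | case: (avoidP (u n) IH)]. Qed.

Lemma nest_mono n m : (n <= m)%N -> (nest n).1 <= (nest m).1 /\ (nest m).2 <= (nest n).2.
Proof.
elim: m => [|m IH]; first by rewrite leqn0 => /eqP->.
rewrite leq_eqVlt => /orP[/eqP->//|/IH[h1 h2]] /=.
have [h3 _ h4 _] := avoidP (u m) (nest_lt m).
by split; [exact: le_trans h3 | exact: le_trans h2].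
Qed.

Lemma uncountable_real : exists x, forall n, u n <> x.
Proof.
pose A := range (fun n => (nest n).1).
have hub n : ubound A (nest n).2.
  move=> _ [m _ <-]; have [h1 _] := nest_mono (leq_maxl m n).
  have [_ h2] := nest_mono (leq_maxr m n).
  by apply: le_trans h1 (le_trans _ h2); apply: ltW; exact: nest_lt.
have A0 : A !=set0 by exists (nest 0).1, 0%N.
exists (sup A) => n e.
have [_ _ _] := avoidP (u n) (nest_lt n); case/negP; rewrite e; apply/andP; split.
  by apply: ub_le_sup; [exists (nest 0).2; exact: hub | exists n.+1; rewrite //= -e].
by apply: ge_sup => //; rewrite -e; exact: (hub n.+1).
Qed.

End Uncountable.

Lemma uncountable_complex (R : realType) (u : nat -> R[i]) : exists x, forall n, u n <> x.
Proof.
have [x Hx] := uncountable_real (fun n => complex.Re (u n)).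
by exists (x%:C)%C => n e; apply: (Hx n); rewrite e.
Qed.

(** * Reynolds operators for groups closed under adjunction *)

(** Subspaces given by a predicate, such as spans over an infinite group, become row spaces: a
    matrix of maximal rank with row space inside [P] exhausts [P]. *)
Lemma subspace_mx (F : fieldType) n (P : 'rV[F]_n -> Prop) :
  P 0 -> (forall a u v, P u -> P v -> P (a *: u + v)) ->
  exists U : 'M[F]_n, forall u, P u <-> (u <= U)%MS.
Proof.
move=> P0 Plin.
pose p r := `[< exists U : 'M[F]_n, \rank U = r /\ forall u, (u <= U)%MS -> P u >].
have exp : exists r, p r.
  by exists 0%N; apply/asboolP; exists 0; rewrite mxrank0; split=> // u /submx0null->.
have pn r : p r -> (r <= n)%N by move=> /asboolP[U [<- _]]; exact: rank_leq_row.
case: (ex_maxnP exp pn) => r /asboolP[U [rU UP]] rmax.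
exists U => u; split; last exact: UP.
move=> Pu; apply: contraT => uU.
have: p (\rank (U + u)%MS).
  apply/asboolP; exists (U + u)%MS; split=> // v /sub_addsmxP[[a b] /= ->].
  rewrite addrC [b]mx11_scalar mul_scalar_mx; apply: Plin => //.
  by apply: UP; exact: submxMl.
move=> /rmax; rewrite -rU leqNgt => /negP[]; apply: rank_ltmx.
by rewrite ltmxE addsmxSl addsmx_sub submx_refl.
Qed.

Section Reynolds.
Variable C : numClosedFieldType.
Local Open Scope sesquilinear_scope.

Lemma selfdot0 n (d : 'rV[C]_n) : d *m d ^t* = 0 -> d = 0.
Proof.
move/(congr1 (fun M : 'M_1 => M 0 0)); rewrite -dotmxE mxE => /eqP.
by rewrite dnorm_eq0 => /eqP.
Qed.

(** Dimension of a tensor power, in the form in which [tensmx] computes it, so that types agree by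
    conversion. *)
Fixpoint tdim m k : nat := if k is k'.+1 then (m * tdim m k')%N else 1%N.

Fixpoint tvec m (x : 'cV[C]_m) k : 'cV[C]_(tdim m k) :=
  if k is k'.+1 then tensmx x (tvec x k') else 1%:M.

Fixpoint tpow m (A : 'M[C]_m) k : 'M[C]_(tdim m k) :=
  if k is k'.+1 then tensmx A (tpow A k') else 1%:M.

Lemma tpow_tvec m (A : 'M[C]_m) x k : tpow A k *m tvec x k = tvec (A *m x) k.
Proof. by elim: k => [|k IH] /=; rewrite ?mul1mx // -IH; exact: (tensmx_mul A (tpow A k) x (tvec x k)). Qed.

Lemma tpow_adj m (A : 'M[C]_m) k : tpow (A ^t*) k = (tpow A k) ^t*.
Proof.
by elim: k => [|k IH] /=; rewrite ?trmx1 ?map_mx1 // IH trmx_tens map_mxT.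
Qed.

Variables (X G : Type) (act : G -> X -> X) (m : nat) (x : X -> 'cV[C]_m) (A : G -> 'M[C]_m).
Hypothesis x_act : forall g w, x (act g w) = A g *m x w.
Hypothesis A_adj : forall g, exists g', A g' = (A g) ^t*.
Variable i0 : 'I_m.
Hypothesis x_const : forall w, x w i0 0 = 1.

(** Polynomial functions on [X] are linear forms on tensor powers. The form [c] is not determined by
    the function: [x] need not span the tensors. *)
Definition tfun k (c : 'rV[C]_(tdim m k)) (w : X) : C := (c *m tvec (x w) k) 0 0.

Definition poly_deg k (f : X -> C) : Prop := exists c, forall w, f w = @tfun k c w.

Definition poly_fun (f : X -> C) : Prop := exists k, poly_deg k f.

Definition act_invariant (f : X -> C) : Prop := forall g w, f (act g w) = f w.

Lemma tfun_act k c g w : @tfun k c (act g w) = tfun (c *m tpow (A g) k) w.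
Proof. by rewrite /tfun x_act -tpow_tvec mulmxA. Qed.

Lemma tfun_lin k a c d w : @tfun k (a *: c + d) w = a * tfun c w + tfun d w.
Proof. by rewrite /tfun mulmxDl -scalemxAl !mxE. Qed.

Lemma tfun0 k w : @tfun k 0 w = 0.
Proof. by rewrite /tfun mul0mx mxE. Qed.

Lemma tfunB k c d w : @tfun k (c - d) w = tfun c w - tfun d w.
Proof. by rewrite addrC -scaleN1r tfun_lin mulN1r addrC. Qed.

Lemma poly_deg0 f : poly_deg 0 f <-> exists a, forall w, f w = a.
Proof.
split=> [[c fc]|[a fa]].
  by exists (c 0 0) => w; rewrite fc /tfun /= mulmx1.
by exists a%:M => w; rewrite fa /tfun /= mulmx1 mxE mulr1n.
Qed.

(** Splitting off the first tensor factor: the recursion behind the inductions on the degree. *)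
Lemma poly_degS k f : poly_deg k.+1 f <->
  exists2 fs : 'I_m -> X -> C, forall i, poly_deg k (fs i) &
    forall w, f w = \sum_i x w i 0 * fs i w.
Proof.
have E (c : 'rV_(tdim m k.+1)) w : tfun c w =
    \sum_i x w i 0 * tfun (\row_j c 0 (mxtens_index (i, j))) w.
  transitivity (\sum_i \sum_j c 0 (mxtens_index (i, j)) * (x w i 0 * tvec (x w) k j 0)).
    rewrite pair_bigA /tfun mxE (reindex (@mxtens_index m (tdim m k))) /=; last first.
      by exists (@mxtens_unindex _ _) => i _; rewrite ?mxtens_indexK ?mxtens_unindexK.
    apply: eq_bigr => -[i j] _; rewrite !mxE mxtens_indexK /=.
    by rewrite !ord1.
  apply: eq_bigr => i _; rewrite /tfun mxE mulr_sumr; apply: eq_bigr => j _.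
  by rewrite mxE mulrCA.
split=> [[c fc]|[fs /choice[c fsc] ff]].
  exists (fun i => tfun (\row_j c 0 (mxtens_index (i, j)))) => [i|w].
    by eexists.
  by rewrite fc E.
exists (\row_ij c (mxtens_unindex ij).1 0 (mxtens_unindex ij).2) => w.
rewrite ff E; apply: eq_bigr => i _; rewrite fsc; congr (_ * tfun _ _).
by apply/rowP => j; rewrite !mxE mxtens_indexK.
Qed.

(** Multiplication by the coordinate [i0], constantly 1, raises the degree without changing the
    function. *)
Lemma poly_deg_up k l f : (k <= l)%N -> poly_deg k f -> poly_deg l f.
Proof.
move=> /subnK <-; elim: (l - k)%N => // {}l IH /IH fk.
apply/poly_degS; exists (fun i w => if i == i0 then f w else 0).
  move=> i; case: eqP => // _.
  by exists 0 => w; rewrite tfun0.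
by move=> w; rewrite (bigD1 i0) //= eqxx x_const mul1r big1 ?addr0 // => i /negPf->; rewrite mulr0.
Qed.

Lemma poly_deg_lin k a f g : poly_deg k f -> poly_deg k g ->
  poly_deg k (fun w => a * f w + g w).
Proof.
by move=> [c fc] [d gd]; exists (a *: c + d) => w; rewrite tfun_lin fc gd.
Qed.

Lemma poly_fun_lin a f g : poly_fun f -> poly_fun g -> poly_fun (fun w => a * f w + g w).
Proof.
move=> [k fk] [l gl]; exists (maxn k l); apply: poly_deg_lin.
  exact: poly_deg_up (leq_maxl _ _) fk.
exact: poly_deg_up (leq_maxr _ _) gl.
Qed.

Lemma poly_fun_const a : poly_fun (fun=> a).
Proof. by exists 0%N; apply/poly_deg0; exists a. Qed.

Lemma poly_funD f g : poly_fun f -> poly_fun g -> poly_fun (fun w => f w + g w).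
Proof. by move=> /(poly_fun_lin 1)h /h[k [c E]]; exists k, c => w; rewrite -E mul1r. Qed.

Lemma poly_fun_coord i : poly_fun (fun w => x w i 0).
Proof.
exists 1%N; apply/poly_degS; exists (fun j _ => (j == i)%:R).
  by move=> j; apply/poly_deg0; eexists.
move=> w; rewrite (bigD1 i) //= eqxx mulr1 big1 ?addr0 // => j /negPf->.
by rewrite mulr0.
Qed.

Lemma poly_degM k l f g : poly_deg k f -> poly_deg l g -> poly_deg (k + l) (fun w => f w * g w).
Proof.
elim: k f => [|k IH] f.
  move=> /poly_deg0[a fa] [c gc]; exists (a *: c) => w.
  by rewrite -[a *: c]addr0 tfun_lin tfun0 addr0 fa gc.
move=> /poly_degS[fs fsk ff] gl; apply/poly_degS.
exists (fun i w => fs i w * g w) => [i|w]; first exact: IH.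
by rewrite ff mulr_suml; apply: eq_bigr => i _; rewrite mulrA.
Qed.

Lemma poly_funM f g : poly_fun f -> poly_fun g -> poly_fun (fun w => f w * g w).
Proof. by move=> [k fk] [l gl]; exists (k + l)%N; apply: poly_degM. Qed.

Lemma poly_fun_sum (I : Type) (r : seq I) (f : I -> X -> C) :
  (forall i, poly_fun (f i)) -> poly_fun (fun w => \sum_(i <- r) f i w).
Proof.
move=> pf; elim: r => [|i r IH].
  by have [k [c E]] := poly_fun_const 0; exists k, c => w; rewrite big_nil -E.
have [k [c E]] := poly_funD (pf i) IH.
by exists k, c => w; rewrite big_cons -E.
Qed.

Local Notation "B ^!" :=
  (orthomx Num.conj (mx_of_hermitian (hermitian1mx _)) B) : matrix_set_scope.

(** * Fixed tensors and differences in one degree *)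

Section Degree.
Variable k : nat.
Local Notation T := 'rV[C]_(tdim m k).

(** A linear span: scalars are absorbed by the vectors [p.2]. *)
Definition coinv_span (c : T) : Prop := exists s : seq (G * T),
  c = \sum_(p <- s) (p.2 *m tpow (A p.1) k - p.2).

Lemma coinv_gen g d : coinv_span (d *m tpow (A g) k - d).
Proof. by exists [:: (g, d)]; rewrite big_seq1. Qed.

Lemma coinv_mx : exists D : 'M[C]_(tdim m k), forall c : T, coinv_span c <-> (c <= D)%MS.
Proof.
apply: subspace_mx => [|a u v [s ->] [t ->]]; first by exists [::]; rewrite big_nil.
exists ([seq (p.1, a *: p.2) | p <- s] ++ t); rewrite big_cat big_map /=; congr (_ + _).
by rewrite scaler_sumr; apply: eq_bigr => p _; rewrite scalerBr -scalemxAl.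
Qed.

Lemma tpow_adjP g : exists g', (tpow (A g) k) ^t* = tpow (A g') k.
Proof. by have [g' e] := A_adj g; exists g'; rewrite e tpow_adj. Qed.

Lemma dot_tpow (c d : T) B : (c *m B) *m d ^t* = c *m (d *m B ^t*) ^t*.
Proof. by rewrite trmx_mul map_mxM trmxCK mulmxA. Qed.

(* Here the closure of the acting matrices under conjugate transposition is used. *)
Lemma coinv_fixed_orth (c d : T) : coinv_span c -> (forall g, d *m tpow (A g) k = d) ->
  c *m d ^t* = 0.
Proof.
move=> [s ->] fd; rewrite mulmx_suml big1 // => -[g e] _ /=.
rewrite mulmxBl dot_tpow; have [g' ->] := tpow_adjP g.
by rewrite fd subrr.
Qed.

(** A vector [d] orthogonal to the differences is fixed: for [e = d g - d], the square norm of [e]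
    is the product of [d] with [e g' - e], where [g'] acts by the adjoint of [g], and [e g' - e] is
    a difference. *)
Lemma fixed_coinv_split (c : T) : exists c0 c1, [/\ c = c0 + c1,
  forall g, c0 *m tpow (A g) k = c0 & coinv_span c1].
Proof.
have [D HD] := coinv_mx.
have : (c <= D + D^!)%MS.
  by rewrite addsmx_ortho submx1.
move=> /sub_addsmxP[[a b] /= ->].
exists (b *m D^!%MS), (a *m D).
split; [by rewrite addrC| | by apply/HD; rewrite submxMl].
set d := b *m _ => g.
have dD : (d <= D^!)%MS by exact: submxMl.
have [g' e'] := tpow_adjP g.
have : (d *m tpow (A g) k - d) *m (d *m tpow (A g) k - d) ^t* = 0.
  rewrite mulmxBl dot_tpow e'.
  have -> (e : T) : d *m (e *m tpow (A g') k) ^t* - d *m e ^t* = d *m (e *m tpow (A g') k - e) ^t*.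
    by rewrite raddfB /= map_mxB mulmxBr.
  apply/orthomx1P; apply: submx_trans dD _.
  rewrite submx_ortho; apply/HD; exact: coinv_gen.
by move/selfdot0/eqP; rewrite subr_eq0 => /eqP.
Qed.

(** Let [N] consist of the tensors that vanish as functions. The component [d] of [c] orthogonal to
    [N] defines the same function as [c]. By invariance [d g - d] lies in [N], and also in its
    orthogonal, which is stable because [N] is stable under adjoints; so [d] is fixed. Then [c] is
    orthogonal to [d], as is [n], hence so is [d] itself. *)
Lemma coinv_inv_deg0 (c : T) : coinv_span c -> act_invariant (tfun c) -> forall w, tfun c w = 0.
Proof.
move=> cc ic.
have [N HN] : exists N : 'M[C]_(tdim m k), forall c : T, (forall w, tfun c w = 0) <-> (c <= N)%MS.
  apply: subspace_mx => [w|a u v Pu Pv w]; first exact: tfun0.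
  by rewrite tfun_lin Pu Pv mulr0 addr0.
have : (c <= N + N^!)%MS.
  by rewrite addsmx_ortho submx1.
move=> /sub_addsmxP[[a b] /=]; set n := a *m N; set d := b *m _ => e.
have nN : (n <= N)%MS by exact: submxMl.
have dN : (d <= N^!)%MS by exact: submxMl.
have fn : forall w, tfun n w = 0 by apply/HN.
have cd w : tfun c w = tfun d w.
  by rewrite e -[n]scale1r tfun_lin fn mulr0 add0r.
have NA g : (N *m tpow (A g) k <= N)%MS.
  apply/row_subP => i; apply/HN => w; rewrite row_mul -tfun_act.
  by move: (act g w); apply/HN; exact: row_sub.
have fd g : d *m tpow (A g) k = d.
  apply/eqP; rewrite -subr_eq0 -submx0; set u := _ - d.
  rewrite -(orthomx_ortho_disj N) sub_capmx; apply/andP; split.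
    by apply/HN => w; rewrite tfunB -tfun_act -!cd ic subrr.
  apply: addmx_sub; last by rewrite eqmx_opp.
  have [g' e'] := tpow_adjP g.
  have /submxP[Y eY] := NA g'.
  apply/orthomx1P; have := orthomx1P dN.
  move/(congr1 (fun M => M *m Y ^t*)); rewrite mul0mx => <-.
  by rewrite -[RHS]mulmxA -map_mxM -trmx_mul -eY -e' trmx_mul map_mxM trmxCK mulmxA.
have cd0 : c *m d ^t* = 0 by exact: coinv_fixed_orth.
have nd0 : n *m d ^t* = 0.
  by apply/orthomx1P; apply: submx_trans nN _; rewrite orthomx_sym.
have : d = 0.
  by apply: selfdot0; rewrite -cd0 e mulmxDl nd0 add0r.
by move=> d0 w; rewrite cd d0 tfun0.
Qed.

End Degree.

(** Membership is [List.In] because [G] and [X -> C] are bare types. *)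
Definition coinv (f : X -> C) : Prop := exists2 s : seq (G * (X -> C)),
  (forall p, List.In p s -> poly_fun p.2) &
  forall w, f w = \sum_(p <- s) (p.2 (act p.1 w) - p.2 w).

Lemma reynolds_split f : poly_fun f ->
  exists f0 f1, [/\ forall w, f w = f0 w + f1 w, poly_fun f0, act_invariant f0 & coinv f1].
Proof.
move=> [k [c fc]]; have [c0 [c1 [e0 c0f [s c1s]]]] := fixed_coinv_split c.
exists (tfun c0), (tfun c1); split.
- by move=> w; rewrite fc e0 -[c0]scale1r tfun_lin scale1r mul1r.
- by exists k, c0.
- by move=> g w; rewrite tfun_act c0f.
exists [seq (p.1, tfun p.2) | p <- s].
  by elim: s {c1s} => [|p s IH] //= q [<-|/IH//]; exists k, p.2.
move=> w; rewrite big_map c1s {c1s} /=; elim: s => [|p s IH].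
  by rewrite !big_nil tfun0.
by rewrite !big_cons -[X in X + _]scale1r tfun_lin mul1r IH tfunB tfun_act.
Qed.

(** The functions in the differences have various degrees; raised to a common one, they fall under
    [coinv_inv_deg0]. *)
Lemma coinv_inv0 f : coinv f -> act_invariant f -> forall w, f w = 0.
Proof.
move=> [s ps fs] fi.
have [k [t ts]] : exists k (t : seq (G * 'rV[C]_(tdim m k))), forall w,
    f w = \sum_(p <- t) (tfun p.2 (act p.1 w) - tfun p.2 w).
  suff [k [t ts]] : exists k (t : seq (G * 'rV[C]_(tdim m k))), forall w,
      \sum_(p <- s) (p.2 (act p.1 w) - p.2 w) =
      \sum_(p <- t) (tfun p.2 (act p.1 w) - tfun p.2 w).
    by exists k, t => w; rewrite fs ts.
  elim: s ps {fs} => [|[g q] s IH] ps.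
    by exists 0%N, [::] => w; rewrite !big_nil.
  have [p ins|k [t ts]] := IH; first by apply: ps; right.
  have [l [c qc]] : poly_fun q by apply: (ps (g, q)); left.
  have up : forall p : G * 'rV[C]_(tdim m k), exists d : 'rV[C]_(tdim m (maxn k l)),
      forall w, tfun p.2 w = tfun d w.
    by move=> p; apply: (poly_deg_up (leq_maxl k l)); exists p.2.
  have [u us] := choice up.
  have [d qd] : poly_deg (maxn k l) q by apply: (poly_deg_up (leq_maxr k l)); exists c.
  exists (maxn k l), ((g, d) :: [seq (p.1, u p) | p <- t]) => w.
  rewrite !big_cons big_map ts /= !qd; congr (_ + _).
  by apply: eq_bigr => p _; rewrite !us.
pose c := \sum_(p <- t) (p.2 *m tpow (A p.1) k - p.2).
have fc w : f w = tfun c w.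
  rewrite ts /c; elim: t {ts c} => [|p t IH]; first by rewrite !big_nil tfun0.
  by rewrite !big_cons -[X in _ = tfun (X + _) _]scale1r tfun_lin mul1r IH tfunB tfun_act.
move=> w; rewrite fc; apply: coinv_inv_deg0; first by exists t.
by move=> g w'; rewrite -!fc.
Qed.

(* Since 1 - sum f_i q_i0 is both invariant and a sum of differences g r - r, it vanishes. *)
Lemma reynolds_unit (I : Type) (r : seq I) (f q : I -> X -> C) :
  (forall i, poly_fun (f i)) -> (forall i, act_invariant (f i)) -> (forall i, poly_fun (q i)) ->
  (forall w, \sum_(i <- r) f i w * q i w = 1) ->
  exists q0 : I -> X -> C, [/\ forall i, poly_fun (q0 i), forall i, act_invariant (q0 i) &
    forall w, \sum_(i <- r) f i w * q0 i w = 1].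
Proof.
move=> pf invf pq e1.
have /choice[q0 /choice[q1 H]] : forall i, exists f0 f1,
    [/\ forall w, q i w = f0 w + f1 w, poly_fun f0, act_invariant f0 & coinv f1].
  by move=> i; exact: reynolds_split.
exists q0; split=> [i|i|w]; [by case: (H i) | by case: (H i) |].
apply/eqP; rewrite -subr_eq0 -oppr_eq0 opprB; apply/eqP.
pose h w := 1 - \sum_(i <- r) f i w * q0 i w.
have hE w' : h w' = \sum_(i <- r) f i w' * q1 i w'.
  rewrite /h -(e1 w') -sumrB; apply: eq_bigr => i _.
  by have [-> _ _ _] := H i; rewrite -mulrBr addrAC subrr add0r.
apply: (@coinv_inv0 h); last first.
  move=> g w'; rewrite /h; congr (1 - _); apply: eq_bigr => i _.
  by have [_ _ -> _] := H i; rewrite invf.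
have coinvM i : coinv (fun w => f i w * q1 i w).
  have [_ _ _ [s ps qs]] := H i.
  exists [seq (p.1, fun w => f i w * p.2 w) | p <- s].
    elim: s ps {qs} => [|p s IH] //= ps a [<-|/IH H']; last first.
      by apply: H' => b bs; apply: ps; right.
    by apply: poly_funM => //; apply: ps; left.
  move=> w'; rewrite qs big_map mulr_sumr; apply: eq_bigr => p _ /=.
  by rewrite invf mulrBr.
have /choice[s Hs] : forall i, exists s : seq (G * (X -> C)),
    (forall p, List.In p s -> poly_fun p.2) /\
    forall w, f i w * q1 i w = \sum_(p <- s) (p.2 (act p.1 w) - p.2 w).
  by move=> i; have [s h1 h2] := coinvM i; exists s.
exists (flatten [seq s i | i <- r]).
  elim: (r) => [|i r' IH] //= p; rewrite List.in_app_iff => -[|/IH//].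
  by have [h1 _] := Hs i; exact: h1.
move=> w'; rewrite hE big_flatten big_map; apply: eq_bigr => i _.
by have [_ ->] := Hs i.
Qed.

End Reynolds.

(** * Isometry groups in a basis where the form is unitary *)

Section Unitarize.
Variable C : numClosedFieldType.
Local Open Scope sesquilinear_scope.

(** The exponent 4 is explained by the use of [c = r(M)] for [M = Z^* Z]: the form [c^T Z c] will be
    [Z c^2], whose Gram matrix is [c^4 M]. Real coefficients make [c] self-adjoint. The
    interpolation is Newton's: [q] vanishes on [s], so adding [c *: q] adjusts the value at [x]
    alone. *)
Lemma real_fourth_root_interpolation (s : seq C) : (forall x, x \in s -> 0 < x) ->
  exists2 r : {poly C}, map_poly Num.conj r = r & forall x, x \in s -> r.[x] ^+ 4 * x = 1.
Proof.
elim: s => [|x s IH] pos; first by exists 0; rewrite ?rmorph0.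
have [y ys|r rr rs] := IH; first by apply: pos; rewrite inE ys orbT.
have [xs|xs] := boolP (x \in s).
  by exists r => // y; rewrite inE => /orP[/eqP->|]; exact: rs.
have x0 : 0 < x by apply: pos; rewrite mem_head.
pose q : {poly C} := \prod_(y <- s) ('X - y%:P).
have qr : map_poly Num.conj q = q.
  rewrite /q rmorph_prod /= big_seq [RHS]big_seq; apply: eq_bigr => y ys.
  rewrite rmorphB /= map_polyX map_polyC /= geC0_conj //.
  by apply/ltW/pos; rewrite inE ys orbT.
have qx : q.[x] != 0 by rewrite -[_ == 0]/(root q x) root_prod_XsubC.
have cev (p : {poly C}) : map_poly Num.conj p = p -> Num.conj p.[x] = p.[x].
  by move=> pr; rewrite -horner_map /= pr geC0_conj // ltW.
pose t := sqrtC (sqrtC x^-1).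
have t4 : t ^+ 4 * x = 1.
  by rewrite (exprM t 2 2) !sqrtCK mulVf // gt_eqF.
have tr : Num.conj t = t.
  by apply: geC0_conj; rewrite !sqrtC_ge0 invr_ge0 ltW.
pose c := (t - r.[x]) / q.[x].
exists (r + c *: q).
  rewrite rmorphD /= map_polyZ rr qr /=; congr (_ + _ *: _).
  by rewrite /c rmorphM fmorphV /= rmorphB /= tr !cev.
move=> y; rewrite inE => /orP[/eqP->|ys].
  by rewrite hornerD hornerZ /c divfK // addrC subrK.
have /eqP qy : q.[y] == 0 by rewrite -[_ == 0]/(root q y) root_prod_XsubC.
by rewrite hornerD hornerZ qy mulr0 addr0 rs.
Qed.

Variable n : nat.
Implicit Types X Y Z : 'M[C]_n.+1.

Lemma fourth_root_gram (Z : 'M[C]_n.+1) : Z \in unitmx ->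
  exists2 r : {poly C}, map_poly Num.conj r = r &
    horner_mx (Z ^t* *m Z) r ^+ 4 * (Z ^t* *m Z) = 1.
Proof.
move=> Zu; set M := Z ^t* *m Z.
have Mh : M ^t* = M by rewrite /M trmx_mul map_mxM trmxCK.
have /orthomx_spectralP : M \is normalmx by apply/normalmxP; rewrite Mh.
set P := spectralmx M; set D := spectral_diag M => eM.
have Pu : P \is unitarymx by exact: spectral_unitarymx.
have PU : P \in unitmx by exact: spectral_unit.
(* [D] is the Gram matrix of [Z *m P ^t*], so its entries are the square norms of nonzero
   columns. *)
have eD : diag_mx D = (Z *m P ^t*) ^t* *m (Z *m P ^t*).
  rewrite trmx_mul map_mxM trmxCK mulmxA -(mulmxA P) -/M eM.
  by rewrite invmx_unitary // !mulmxA (unitarymxP Pu) mul1mx -mulmxA (unitarymxP Pu) mulmx1.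
have Dpos i : 0 < D 0 i.
  have -> : D 0 i = diag_mx D i i by rewrite mxE eqxx mulr1n.
  rewrite eD.
  have Qu : Z *m P ^t* \in unitmx by rewrite unitmx_mul Zu -invmx_unitary ?unitmx_inv.
  move: (Z *m _) Qu => Q Qu; rewrite mxE.
  have : col i Q != 0.
    apply: contraTneq Qu => Q0; rewrite unitmxE unitfE negbK.
    rewrite (expand_det_col Q i) big1 // => j _.
    by move/matrixP/(_ j 0): Q0; rewrite !mxE => ->; rewrite mul0r.
  move=> /cV0Pn[j]; rewrite mxE => Qji.
  rewrite (bigD1 j) //= ltr_wpDr //.
    by apply: sumr_ge0 => k _; rewrite !mxE mulrC mul_conjC_ge0.
  by rewrite !mxE mulrC mul_conjC_gt0.
have [r rr rD] := real_fourth_root_interpolation (s := [seq D 0 i | i : 'I_n.+1])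
  (fun x xD => let: ex_intro2 i _ e := mapP xD in eq_ind_r (fun x => 0 < x) (Dpos i) e).
exists r => //.
have conjP (p : {poly C}) : horner_mx M p = invmx P *m horner_mx (diag_mx D) p *m P.
  rewrite {1}eM; elim/poly_ind: p => [|p c IH]; first by rewrite !rmorph0 mulmx0 mul0mx.
  rewrite !rmorphD !rmorphM /= !horner_mx_X !horner_mx_C IH mulmxDr mulmxDl.
  congr (_ + _); last by rewrite mul_mx_scalar -scalemxAl mulVmx // scalemx1.
  rewrite -[LHS]/(_ *m _) !mulmxA; congr (_ *m _); rewrite -!mulmxA; congr (_ *m _).
  by congr (_ *m _); rewrite !mulmxA mulmxV // mul1mx.
have -> : horner_mx M r ^+ 4 * M = horner_mx M (r ^+ 4 * 'X).
  by rewrite rmorphM rmorphXn /= horner_mx_X.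
rewrite conjP horner_mx_diag.
suff -> : map_mx (horner (r ^+ 4 * 'X)) D = const_mx 1.
  by rewrite diag_const_mx mulmx1 mulVmx.
apply/rowP => i; rewrite !mxE !hornerE; apply: rD.
by apply/mapP; exists i; rewrite ?mem_enum.
Qed.

Lemma conjmx_horner (M : 'M[C]_n.+1) (r : {poly C}) : map_poly Num.conj r = r ->
  (horner_mx M r) ^t* = horner_mx (M ^t*) r.
Proof.
move=> rr; rewrite -[in RHS]rr; elim/poly_ind: r {rr} => [|p c IH].
  by rewrite !rmorph0 trmx0 map_mx0.
rewrite !rmorphD !rmorphM /= map_polyX map_polyC !horner_mx_X !horner_mx_C -IH.
rewrite linearD /= map_mxD -[_ * M]/(_ *m M) trmx_mul map_mxM tr_scalar_mx map_scalar_mx.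
by congr (_ + _); rewrite IH; apply: comm_mx_horner.
Qed.

Lemma trmx_horner (M : 'M[C]_n.+1) (r : {poly C}) : (horner_mx M r)^T = horner_mx M^T r.
Proof.
elim/poly_ind: r => [|p c IH]; first by rewrite !rmorph0 trmx0.
rewrite !rmorphD !rmorphM /= !horner_mx_X !horner_mx_C linearD /= tr_scalar_mx; congr (_ + _).
by rewrite -[_ * M]/(_ *m M) trmx_mul IH; apply: comm_mx_horner.
Qed.

Lemma horner_mx_intertwine (M N Z : 'M[C]_n.+1) (r : {poly C}) : N *m Z = Z *m M ->
  horner_mx N r *m Z = Z *m horner_mx M r.
Proof.
move=> e; elim/poly_ind: r => [|p c IH]; first by rewrite !rmorph0 mul0mx mulmx0.
rewrite !rmorphD !rmorphM /= !horner_mx_X !horner_mx_C mulmxDl mulmxDr; congr (_ + _).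
  by rewrite -!mulmxE -mulmxA e mulmxA IH mulmxA.
by rewrite mul_scalar_mx mul_mx_scalar.
Qed.

(* With [M = Z^* Z], the change of basis [r(M)^-1], [r] interpolating [x^(-1/4)] on the
   spectrum of [M], turns the form [Z] into a unitary one, by polar decomposition. *)
Lemma selfadjoint_isometries (Z eps : 'M[C]_n.+1) : Z \in unitmx -> Z^T = Z *m eps ->
  eps *m eps = 1%:M -> eps^T = eps -> eps ^t* = eps ->
  exists2 b : 'M[C]_n.+1, b \in unitmx &
    forall X, X^T *m Z *m X = Z -> X *m eps = eps *m X ->
    exists Y, [/\ Y^T *m Z *m Y = Z, b *m Y *m invmx b = (b *m X *m invmx b) ^t* &
      forall E, E ^t* = E -> E *m (Z ^t* *m Z) = Z ^t* *m Z *m E -> X *m E = E *m X -> Y *m E = E *m Y].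
Proof.
move=> Zu Ze ee eT eH; have [r rr r4] := fourth_root_gram Zu.
set M := Z ^t* *m Z in r4 *; set c := horner_mx M r in r4.
have Mh : M ^t* = M by rewrite /M trmx_mul map_mxM trmxCK.
have ch : c ^t* = c by rewrite conjmx_horner // Mh.
have cu : c \in unitmx.
  have : c *m (c ^+ 3 *m M) = 1%:M.
    by rewrite mulmxA -[X in _ = X]r4 exprS.
  by case/mulmx1_unit.
have eZ : eps *m Z = Z *m eps.
  have : (Z^T)^T = (Z *m eps)^T by rewrite Ze.
  rewrite trmxK trmx_mul eT Ze => e.
  by rewrite {2}e -!mulmxA ee mulmx1.
have eZc : eps *m Z ^t* = Z ^t* *m eps.
  by rewrite -{1}eH -map_mxM -trmx_mul -eZ trmx_mul map_mxM eH.
have eM : eps *m M = M *m eps by rewrite /M mulmxA eZc -!mulmxA eZ.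
have ec : eps *m c = c *m eps by exact: comm_mx_horner.
have cZ : map_mx Num.conj Z = Z ^t* *m eps.
  by rewrite Ze map_mxM -{1}eT eH -mulmxA ee mulmx1.
(* [Z] intertwines [M] with [M^T], hence [c] with [c^T]: [c] is self-adjoint for the form [Z]
   too. *)
have MT : M^T = Z *m Z ^t*.
  rewrite /M trmx_mul map_trmx trmxK cZ.
  transitivity (Z *m eps *m (Z ^t* *m eps)); first by rewrite -Ze.
  rewrite !mulmxA -(mulmxA Z) eZc.
  by rewrite -!mulmxA ee mulmx1.
have cTZ : c^T *m Z = Z *m c.
  by rewrite trmx_horner MT; apply: horner_mx_intertwine; rewrite mulmxA.
pose Z' := c^T *m Z *m c.
have Z'u : (Z' ^t*) *m Z' = 1%:M.
  have cM : c *m M = M *m c by rewrite /c; apply: comm_horner_mx.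
  transitivity (c *m c *m (M *m (c *m c))).
    by rewrite /Z' cTZ !trmx_mul !map_mxM ch /M !mulmxA.
  have -> : M *m (c *m c) = c *m c *m M by rewrite mulmxA -cM -(mulmxA c M) -cM mulmxA.
  by rewrite -[RHS]r4 !exprS expr0 mulr1 -!mulmxE !mulmxA.
have Z'eps : Z'^T = Z' *m eps.
  rewrite /Z' !trmx_mul trmxK Ze !mulmxA -!mulmxA ec.
  by rewrite !mulmxA.
have invu (X : 'M[C]_n.+1) : X *m c = c *m X -> X *m invmx c = invmx c *m X.
  by move=> e; rewrite -[X in LHS](mulKmx cu) -e -!mulmxA mulmxV // mulmx1.
exists (invmx c); first by rewrite unitmx_inv.
move=> X XZ Xe; rewrite invmxK.
set X' := invmx c *m X *m c.
have X'Z : X'^T *m Z' *m X' = Z'.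
  rewrite /X' /Z' !trmx_mul -!mulmxA (mulmxA c (invmx c)) mulmxV // mul1mx.
  rewrite (mulmxA (invmx c)^T) -trmx_mul mulmxV // trmx1 mul1mx.
  by rewrite (mulmxA X^T) (mulmxA _ X) XZ.
pose Y' := X' ^t*.
have Y'T : Y'^T = map_mx Num.conj X' by rewrite /Y' map_trmx trmxK.
have X'e : X' *m eps = eps *m X'.
  rewrite /X' -!mulmxA -ec (mulmxA X) Xe !mulmxA; congr (_ *m _ *m _).
  by rewrite invu.
(* As [Z'] is unitary, inverting the isometry equation of [X'] gives [h1]. Its complex conjugate is
   the equation of [Y'] for the form [Z'^T = Z' eps], and [eps] commutes with [Y'], so it
   cancels. *)
have Y'Z : Y'^T *m Z' *m Y' = Z'.
  have h1 : X' *m Z' ^t* *m X'^T = Z' ^t*.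
    have : (Z' ^t* *m X'^T *m Z') *m X' = 1%:M by rewrite -2!(mulmxA (Z' ^t*)) X'Z.
    move/mulmx1C => h; have /mulmx1C h' := Z'u.
    by rewrite -[RHS]mul1mx -h -[RHS]mulmxA -(mulmxA _ Z') h' mulmx1 mulmxA.
  have : map_mx Num.conj X' *m Z'^T *m Y' = Z'^T.
    have /(congr1 (map_mx Num.conj)) := h1.
    by rewrite !map_mxM -map_mx_comp (map_mx_id (@conjCK _)).
  rewrite Z'eps -Y'T -!mulmxA.
  have -> : eps *m Y' = Y' *m eps.
    by rewrite /Y' -eH -!map_mxM -!trmx_mul X'e.
  rewrite !mulmxA => /(congr1 (fun A => A *m eps)).
  by rewrite -!mulmxA ee !mulmx1 !mulmxA.
exists (c *m Y' *m invmx c); split.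
- transitivity ((invmx c)^T *m (Y'^T *m Z' *m Y') *m invmx c).
    by rewrite /Z' !trmx_mul !mulmxA.
  rewrite Y'Z /Z' !mulmxA -trmx_mul mulmxV // trmx1 mul1mx.
  by rewrite -mulmxA mulmxV // mulmx1.
- by rewrite !mulmxA mulVmx // mul1mx -mulmxA mulVmx // mulmx1.
move=> E Eh EM XE.
have Ec : E *m c = c *m E by exact: comm_mx_horner.
have X'E : X' *m E = E *m X'.
  by rewrite /X' -!mulmxA -Ec (mulmxA X) XE !mulmxA invu.
have Y'E : Y' *m E = E *m Y'.
  by rewrite /Y' -Eh -!map_mxM -!trmx_mul X'E.
rewrite -(mulmxA _ (invmx c) E) -(invu _ Ec).
transitivity (c *m (Y' *m E) *m invmx c); first by rewrite !mulmxA.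
by rewrite Y'E !mulmxA -Ec.
Qed.
End Unitarize.

(** * Modules with equal traces *)

Section StableSubspaces.
Variable F : fieldType.

Definition stable_under n (A : 'M[F]_n -> Prop) (U : 'M[F]_n) : Prop :=
  forall X, A X -> (U *m X <= U)%MS.

Definition supplement n (U V : 'M[F]_n) : Prop :=
  (U + V :=: 1%:M)%MS /\ (U :&: V = 0)%MS.

Definition completely_reducible n (A : 'M[F]_n -> Prop) : Prop :=
  forall U, stable_under A U -> exists2 V, stable_under A V & supplement U V.

Lemma supplement_sym n (U V : 'M[F]_n) : supplement U V -> supplement V U.
Proof. by move=> [h1 h2]; split; [rewrite addsmxC | rewrite capmxC]. Qed.

Lemma supplement_proj n (U V : 'M[F]_n) : supplement U V ->
  proj_mx U V + proj_mx V U = 1%:M.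
Proof.
by move=> [h1 h2]; rewrite -[RHS](@add_proj_mx _ _ _ U V) ?h1 ?submx1 // !mul1mx.
Qed.

Lemma proj_comm n (U V X : 'M[F]_n) : supplement U V ->
  (U *m X <= U)%MS -> (V *m X <= V)%MS -> X *m proj_mx U V = proj_mx U V *m X.
Proof.
move=> sUV UX VX; have [h1 h2] := sUV.
rewrite -{1}[X]mul1mx -(supplement_proj sUV) !mulmxDl.
rewrite (proj_mx_id h2); last first.
  by apply: submx_trans UX; apply: submxMr; rewrite -[proj_mx _ _]mul1mx proj_mx_sub.
rewrite (proj_mx_0 h2) ?addr0 //.
by apply: submx_trans VX; apply: submxMr; rewrite -[proj_mx _ _]mul1mx proj_mx_sub.
Qed.

Lemma proj_sub n (U V : 'M[F]_n) : (proj_mx U V <= U)%MS.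
Proof. by rewrite -[proj_mx _ _]mul1mx proj_mx_sub. Qed.

Lemma mxtrace_idem n (e : 'M[F]_n) : e *m e = e -> \tr e = (\rank e)%:R.
Proof.
move=> ee; rewrite -{1}(mulmx_base e) mxtrace_mulC.
suff -> : row_base e *m col_base e = 1%:M by rewrite mxtrace1.
have /row_freeP[B hB] := row_base_free e.
have : exists B, B *m col_base e = 1%:M.
  by have /row_fullP := col_base_full e.
move=> [B' hB'].
have : (col_base e *m row_base e) *m (col_base e *m row_base e) = col_base e *m row_base e.
  by rewrite !mulmx_base.
move: (col_base e) (row_base e) B hB B' hB' {ee} => c r B rB B' Bc.
move/(congr1 (fun M => B' *m M *m B)); rewrite !mulmxA Bc mul1mx.
by rewrite -!mulmxA rB mulmx1.
Qed.

End StableSubspaces.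

(** * Idempotents among the polynomials in a matrix *)

Section IdempotentPolynomial.
Variable F : fieldType.

(** The projection onto the generalized eigenspace of 1, by Bezout between the part of the
    characteristic polynomial at 1 and the rest. The factor ['X] makes the same polynomial in a
    paired matrix [X] vanish wherever [X] does. *)
Lemma idempotent_poly n (Y : 'M[F]_n.+1) : exists q : {poly F},
  (q * 'X).[1] = 1 /\ horner_mx Y (q * 'X) *m horner_mx Y (q * 'X) = horner_mx Y (q * 'X).
Proof.
have c0 : char_poly Y != 0 by rewrite monic_neq0 // char_poly_monic.
have [m [q qr cE]] := multiplicity_XsubC (char_poly Y) 1.
rewrite c0 /= in qr.
(* The exponent is [m.+1] so that [a] vanishes at 1 even if 1 is not an eigenvalue; this gives the
   value 1 at 1. *)
pose a : {poly F} := ('X - 1%:P) ^+ m.+1.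
have cop : coprimep a (q * 'X).
  rewrite coprimep_expl // coprimep_sym coprimep_XsubC rootM negb_or qr /=.
  by rewrite rootX oner_eq0.
have /Bezout_eq1_coprimepP[[u v] /= uv] := cop.
exists (v * q); have p1 : v * q * 'X = 1 - u * a by rewrite -mulrA -uv addrC addKr.
split.
  by rewrite p1 hornerD hornerN hornerM /a horner_exp hornerXsubC subrr expr0n mulr0 oppr0 hornerC addr0.
have cY : horner_mx Y (char_poly Y) = 0 by exact: Cayley_Hamilton.
apply/eqP; rewrite -subr_eq0 mulmxE -rmorphM -rmorphB /=.
have -> : v * q * 'X * (v * q * 'X) - v * q * 'X = - (v * 'X * u * ('X - 1%:P)) * char_poly Y.
  transitivity (v * q * 'X * (v * q * 'X - 1)); first by ring.
  by rewrite [X in _ * (X - 1)]p1 cE /a exprS; ring.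
by rewrite rmorphM /= cY mulr0.
Qed.

End IdempotentPolynomial.

(** * Isomorphism of completely reducible modules with equal traces *)

Section SameTrace.
Variable F : numFieldType.

(* P relates the two matrices by which an element of an algebra acts, from the right, on the rows
   of F^n and of F^n'. *)
Record matrix_algebra n n' (P : 'M[F]_n -> 'M[F]_n' -> Prop) : Prop := MatrixAlgebra {
  malg1 : P 1%:M 1%:M;
  malgL : forall a X Y X' Y', P X Y -> P X' Y' -> P (a *: X + X') (a *: Y + Y');
  malgM : forall X Y X' Y', P X Y -> P X' Y' -> P (X *m X') (Y *m Y') }.

Definition left_alg n n' (P : 'M[F]_n -> 'M[F]_n' -> Prop) : 'M[F]_n -> Prop :=
  fun X => exists Y, P X Y.
Definition right_alg n n' (P : 'M[F]_n -> 'M[F]_n' -> Prop) : 'M[F]_n' -> Prop :=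
  fun Y => exists X, P X Y.

Lemma malg0 n n' (P : 'M[F]_n -> 'M[F]_n' -> Prop) : matrix_algebra P -> P 0 0.
Proof.
move=> mP; have := malgL mP (-1) (malg1 mP) (malg1 mP).
by rewrite !scaleN1r !addNr.
Qed.

Lemma malg_horner n (P : 'M[F]_n.+1 -> 'M[F]_n.+1 -> Prop) X Y p : matrix_algebra P ->
  P X Y -> P (horner_mx X p) (horner_mx Y p).
Proof.
move=> mP PXY; elim/poly_ind: p => [|p c IH].
  by rewrite !rmorph0; exact: malg0.
rewrite !rmorphD !rmorphM /= !horner_mx_X !horner_mx_C addrC [_ + c%:M]addrC.
rewrite -![c%:M]scalemx1; apply: malgL => //; first exact: malg1.
exact: malgM.
Qed.

Section Hom.
Variables (n n' : nat) (P : 'M[F]_n -> 'M[F]_n' -> Prop).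
Hypothesis mP : matrix_algebra P.
Hypothesis red1 : completely_reducible (left_alg P).

(* If ann(K) <= ann(S), choosing j minimal such that the annihilator of the first j rows of K
   kills s yields a well defined module map from a submodule of K to S. *)
Lemma nonzero_hom (K : 'M[F]_n) (s : 'rV[F]_n') : stable_under (left_alg P) K ->
  s != 0 -> (forall X Y, P X Y -> K *m X = 0 -> s *m Y = 0) ->
  exists h : 'M[F]_(n, n'), [/\ forall X Y, P X Y -> X *m h = h *m Y,
    exists2 v : 'rV_n, (v <= K)%MS & v *m h != 0 &
    forall v : 'rV_n, exists X Y, P X Y /\ v *m h = s *m Y].
Proof.
move=> sK s0 KS.
pose L j X Y := P X Y /\ forall i : 'I_n, (i < j)%N -> row i K *m X = 0.
pose p j := `[< forall X Y, L j X Y -> s *m Y = 0 >].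
have exp : exists j, p j.
  exists n; apply/asboolP => X Y [PXY h]; apply: (KS X Y) => //.
  by apply/row_matrixP => i; rewrite row_mul h // row0.
case: (ex_minnP exp) => -[|j] /asboolP pj jmin.
  by case/eqP: s0; rewrite -[s]mulmx1; apply: (pj 1%:M); split=> //; exact: malg1.
have npj : ~ p j by move=> /jmin; rewrite ltnn.
have [jn|nj] := ltnP j n; last first.
  by case: npj; apply/asboolP => X Y [PXY h]; apply: (pj X); split=> // i _; apply: h; apply: leq_trans nj.
pose k := row (Ordinal jn) K.
have wd X Y : L j X Y -> k *m X = 0 -> s *m Y = 0.
  move=> [PXY h] kX; apply: (pj X); split=> // i.
  by rewrite ltnS leq_eqVlt => /orP[/eqP ij|/h//]; rewrite -kX; congr (row _ _ *m _); apply: val_inj.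
have LL a X Y X' Y' : L j X Y -> L j X' Y' -> L j (a *: X + X') (a *: Y + Y').
  move=> [h1 h2] [h3 h4]; split; first exact: malgL.
  by move=> i ij; rewrite mulmxDr -scalemxAr h2 // h4 // scaler0 addr0.
have LM X Y X' Y' : L j X Y -> P X' Y' -> L j (X *m X') (Y *m Y').
  move=> [h1 h2] h3; split; first exact: malgM.
  by move=> i ij; rewrite mulmxA h2 // mul0mx.
(* [U] is the graph of [k X -> s Y] for pairs killing the rows before [j]; by [wd] it is the graph
   of a map. This map is extended by zero along a stable supplement [V] of its domain. *)
have [U HU] : exists U : 'M[F]_(n + n'), forall u,
    (exists X Y, L j X Y /\ u = row_mx (k *m X) (s *m Y)) <-> (u <= U)%MS.
  apply: subspace_mx.
    exists 0, 0; rewrite !mulmx0 row_mx0; split=> //; split; first exact: malg0.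
    by move=> i _; rewrite mulmx0.
  move=> a u v [X [Y [LX ->]]] [X' [Y' [LX' ->]]].
  exists (a *: X + X'), (a *: Y + Y'); split; first exact: LL.
  by rewrite !mulmxDr -!scalemxAr scale_row_mx add_row_mx.
pose Ul := lsubmx U; pose Ur := rsubmx U.
have UlP (v : 'rV_n) : (v <= Ul)%MS <-> exists X Y, L j X Y /\ v = k *m X.
  split=> [/submxP[a ->]|[X [Y [LX ->]]]].
    have /HU[X [Y [LX]]] : (a *m U <= U)%MS by exact: submxMl.
    move/(congr1 lsubmx); rewrite row_mxKl -mulmx_lsub => e.
    by exists X, Y.
  have : (row_mx (k *m X) (s *m Y) <= U)%MS by apply/HU; exists X, Y.
  by move=> /submxP[a /(congr1 lsubmx)]; rewrite row_mxKl -mulmx_lsub => ->; exact: submxMl.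
have sUl : stable_under (left_alg P) <<Ul>>%MS.
  move=> X' [Y' PX']; rewrite (eqmxMr _ (genmxE _)) genmxE; apply/row_subP => i.
  rewrite row_mul; have /UlP[X [Y [LX ->]]] : (row i Ul <= Ul)%MS by exact: row_sub.
  by apply/UlP; exists (X *m X'), (Y *m Y'); split; [exact: LM | rewrite mulmxA].
have [V sV sup] := red1 sUl.
have [h hE] : exists h, forall v : 'rV_n, v *m h = v *m proj_mx <<Ul>>%MS V *m pinvmx Ul *m Ur.
  by exists (proj_mx <<Ul>>%MS V *m pinvmx Ul *m Ur) => v; rewrite !mulmxA.
have hk X Y : L j X Y -> k *m X *m h = s *m Y.
  move=> LX; have kU : (k *m X <= Ul)%MS by apply/UlP; exists X, Y.
  rewrite hE (proj_mx_id sup.2) ?genmxE //.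
  set a := _ *m pinvmx Ul.
  have /HU[X' [Y' [LX' e]]] : (a *m U <= U)%MS by exact: submxMl.
  have e1 : k *m X = k *m X'.
    by have := congr1 lsubmx e; rewrite row_mxKl -mulmx_lsub /a mulmxKpV.
  have -> : a *m Ur = s *m Y'.
    by have := congr1 rsubmx e; rewrite row_mxKr -mulmx_rsub.
  apply/eqP; rewrite -subr_eq0 -mulmxBr; apply/eqP.
  apply: (wd (X' - X)); last by rewrite mulmxBr e1 subrr.
  by have := LL (-1) _ _ _ _ LX LX'; rewrite !scaleN1r ![- _ + _]addrC.
have hV (v : 'rV_n) : (v <= V)%MS -> v *m h = 0.
  by move=> vV; rewrite hE (proj_mx_0 sup.2) // !mul0mx.
have dec (v : 'rV_n) : exists X Y w, [/\ L j X Y, (w <= V)%MS & v = k *m X + w].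
  have : (v <= <<Ul>>%MS + V)%MS by rewrite sup.1 submx1.
  move=> /sub_addsmxP[[a b] /= ->].
  have /UlP[X [Y [LX e]]] : (a *m <<Ul>>%MS <= Ul)%MS by apply: submx_trans (submxMl _ _) _; rewrite genmxE.
  by exists X, Y, (b *m V); rewrite e submxMl.
exists h; split.
- move=> X' Y' PX'; apply/row_matrixP => i; rewrite !rowE !mulmxA.
  have [X [Y [w [LX wV ->]]]] := dec (delta_mx 0 i).
  have wX' : (w *m X' <= V)%MS.
    by apply: submx_trans (sV X' _); [exact: submxMr | exists Y'].
  rewrite !mulmxDl (hV _ wV) (hV _ wX') mul0mx !addr0 (hk _ _ LX) -(mulmxA k).
  by rewrite (hk _ _ (LM _ _ _ _ LX PX')) mulmxA.
- have : ~ forall X Y, L j X Y -> s *m Y = 0 by move=> H; apply: npj; apply/asboolP.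
  move=> /existsNP[X /existsNP[Y /not_implyP[LX /eqP sY]]].
  exists (k *m X); last by rewrite (hk _ _ LX).
  case: (LX) => PX _; apply: submx_trans (sK X _); last by exists Y.
  by apply: submxMr; exact: row_sub.
move=> v; have [X [Y [w [LX wV ->]]]] := dec v.
exists X, Y; split; first by case: LX.
by rewrite mulmxDl (hk _ _ LX) (hV _ wV) addr0.
Qed.

End Hom.
Lemma horner_mx_eigen n (Y : 'M[F]_n.+1) (s : 'rV_n.+1) (p : {poly F}) a :
  s *m Y = a *: s -> s *m horner_mx Y p = p.[a] *: s.
Proof.
move=> sY; elim/poly_ind: p => [|p c IH]; first by rewrite rmorph0 mulmx0 horner0 scale0r.
rewrite rmorphD rmorphM /= horner_mx_X horner_mx_C mulmxDr -mulmxE mulmxA IH.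
by rewrite -scalemxAl sY mul_mx_scalar scalerA -scalerDl !hornerE.
Qed.

Section Square.
Variables (n : nat) (P : 'M[F]_n.+1 -> 'M[F]_n.+1 -> Prop).
Hypothesis mP : matrix_algebra P.
Hypothesis red1 : completely_reducible (left_alg P).
Hypothesis red2 : completely_reducible (right_alg P).
Hypothesis trP : forall X Y, P X Y -> \tr X = \tr Y.

(** [f] maps [D] isomorphically onto its image, with inverse induced by [g], so the traces on these
    parts agree. Subtracting them from the total traces leaves the kernel and the cokernel. *)
Lemma ker_coker_trace (f K D C X Y : 'M[F]_n.+1) : K = kermx f -> supplement K D ->
  supplement f C -> X *m f = f *m Y -> (D *m X <= D)%MS -> (C *m Y <= C)%MS -> \tr X = \tr Y ->
  \tr (proj_mx K D *m X) = \tr (proj_mx C f *m Y).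
Proof.
move=> eK sKD sfC XY DX CY tXY.
pose pD := proj_mx D K; pose pI := proj_mx f C.
have Kf : K *m f = 0 by rewrite eK mulmx_ker.
have pKf : proj_mx K D *m f = 0.
  by apply/eqP; rewrite -submx0 -Kf; apply: submxMr; exact: proj_sub.
have pDf : pD *m f = f.
  by rewrite -[RHS]mul1mx -(supplement_proj sKD) mulmxDl pKf add0r.
have eg : exists g, f *m g = pD /\ g *m f = pI.
  exists (pI *m (pinvmx f *m pD)); split.
    rewrite (mulmxA f pI) /pI (proj_mx_id sfC.2) // (mulmxA f (pinvmx f)).
    have : ((1%:M - f *m pinvmx f) <= K)%MS.
      by rewrite eK; apply/sub_kermxP; rewrite mulmxBl mul1mx mulmxKpV // subrr.
    move=> /(proj_mx_0 (supplement_sym sKD).2) /eqP.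
    by rewrite mulmxBl mul1mx subr_eq0 => /eqP <-.
  by rewrite -(mulmxA pI) -(mulmxA (pinvmx f)) pDf (mulmxA pI) mulmxKpV // proj_sub.
have [g [fg gf]] := eg.
have t1 : \tr (pD *m X) = \tr (pI *m Y).
  by rewrite -fg -gf -mulmxA mxtrace_mulC -mulmxA XY mulmxA.
have e1 : \tr X = \tr (proj_mx K D *m X) + \tr (pD *m X).
  by rewrite -mxtraceD -mulmxDl supplement_proj // mul1mx.
have e2 : \tr Y = \tr (proj_mx C f *m Y) + \tr (pI *m Y).
  by rewrite -mxtraceD -mulmxDl supplement_proj ?mul1mx //; exact: supplement_sym.
by apply: (addIr (\tr (pI *m Y))); rewrite -e2 -t1 -e1.
Qed.

Lemma minimal_stable (A : 'M[F]_n.+1 -> Prop) (C : 'M[F]_n.+1) : stable_under A C -> C != 0 ->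
  exists S : 'M[F]_n.+1, [/\ stable_under A S, S != 0, (S <= C)%MS &
    forall T : 'M[F]_n.+1, stable_under A T -> T != 0 -> (T <= S)%MS -> (S <= T)%MS].
Proof.
move=> sC C0.
pose p r := `[< exists S : 'M[F]_n.+1, [/\ stable_under A S, S != 0, (S <= C)%MS & \rank S = r] >].
have exp : exists r, p r by exists (\rank C); apply/asboolP; exists C; split=> //; exact: submx_refl.
case: (ex_minnP exp) => r /asboolP[S [sS S0 SC rS]] rmin.
exists S; split=> // T sT T0 TS.
have: (r <= \rank T)%N.
  by apply: rmin; apply/asboolP; exists T; split=> //; apply: submx_trans TS SC.
by rewrite -rS (geq_leqif (mxrank_leqif_sup TS)).
Qed.

(** Take [s] in a simple part [S] of a supplement [C] of the image. If the annihilator of the kernel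
    [K] kills [s], there is a nonzero map from [K] to [S], and adding it to [f] shrinks the kernel.
    Otherwise some pair has [K X = 0] and [s Y = s], and an idempotent polynomial in it has trace 0
    on [K] but not on [C], against [ker_coker_trace]. *)
Lemma increase_rank (f : 'M[F]_n.+1) : (forall X Y, P X Y -> X *m f = f *m Y) ->
  (\rank f < n.+1)%N ->
  exists2 f' : 'M[F]_n.+1, forall X Y, P X Y -> X *m f' = f' *m Y & (\rank f < \rank f')%N.
Proof.
move=> fP rf; pose K := kermx f.
have sK : stable_under (left_alg P) K.
  by move=> X [Y PXY]; apply/sub_kermxP; rewrite -mulmxA (fP _ _ PXY) mulmxA mulmx_ker mul0mx.
have [D sD sKD] := red1 sK.
have sf : stable_under (right_alg P) f.
  by move=> Y [X PXY]; rewrite -(fP _ _ PXY) submxMl.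
have [C sC sfC] := red2 sf.
have C0 : C != 0.
  apply: contraTneq rf => C0; have : \rank (f + C)%MS = n.+1 by rewrite sfC.1 mxrank1.
  by rewrite C0 addsmx0 => ->; rewrite ltnn.
have [S [sS S0 SC Smin]] := minimal_stable sC C0.
have /rowV0Pn[s sS' s0] := S0.
have [KS|] := pselect (forall X Y, P X Y -> K *m X = 0 -> s *m Y = 0).
  have [h [hP [v vK vh] hS]] := nonzero_hom mP red1 sK s0 KS.
  have pKc X : left_alg P X -> X *m proj_mx K D = proj_mx K D *m X.
    by move=> AX; apply: proj_comm => //; [exact: sK | exact: sD].
  exists (f + proj_mx K D *m h).
    move=> X Y PXY; rewrite mulmxDr mulmxDl (fP _ _ PXY) mulmxA pKc; last by exists Y.
    by rewrite -!mulmxA (hP _ _ PXY).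
  set f' := f + _.
  have : (kermx f' < K)%MS.
    (* The image of [f] and that of the added map, contained in [C], are independent, so both terms
       vanish on the kernel of [f']. *)
    have kerK (u : 'rV_n.+1) : (u <= kermx f')%MS -> (u <= K)%MS /\ u *m h = 0.
      move=> /sub_kermxP; rewrite mulmxDr mulmxA => e.
      have hC : (u *m proj_mx K D *m h <= C)%MS.
        have [X [Y [PXY ->]]] := hS (u *m proj_mx K D).
        apply: submx_trans (sC Y _); last by exists X.
        by apply: submxMr; apply: submx_trans SC.
      have uf0 : u *m f = 0.
        apply/eqP; rewrite -submx0 -sfC.2 sub_capmx submxMl /=.
        by rewrite -[u *m f](addrK (u *m proj_mx K D *m h)) e sub0r eqmx_opp.
      have uK : (u <= K)%MS by apply/sub_kermxP.
      by split=> //; move: e; rewrite uf0 add0r (proj_mx_id sKD.2 uK).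
    rewrite ltmxE; apply/andP; split.
      by apply/row_subP => i; apply: (kerK _ _).1; exact: row_sub.
    apply/negP => Kf'; have [_ vh0] := kerK v (submx_trans vK Kf').
    by rewrite vh0 eqxx in vh.
  by move/rank_ltmx; rewrite !mxrank_ker ltn_sub2lE // rank_leq_row.
move=> /existsNP[X0 /existsNP[Y0 /not_implyP[P0 /not_implyP[KX0 sY0]]]].
exfalso.
(* [U] is [s] times the annihilator of [K], a nonzero submodule of the minimal [S]; so it contains
   [s]. *)
have [U HU] : exists U : 'M[F]_n.+1, forall u,
    (exists X Y, [/\ P X Y, K *m X = 0 & u = s *m Y]) <-> (u <= U)%MS.
  apply: subspace_mx.
    by exists 0, 0; rewrite !mulmx0; split=> //; exact: malg0.
  move=> a u v [X [Y [PX KX ->]]] [X' [Y' [PX' KX' ->]]].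
  exists (a *: X + X'), (a *: Y + Y'); split; first exact: malgL.
    by rewrite mulmxDr -scalemxAr KX KX' scaler0 addr0.
  by rewrite mulmxDr -scalemxAr.
have sU : stable_under (right_alg P) U.
  move=> Y' [X' PX']; apply/row_subP => i; rewrite row_mul.
  have /HU[X [Y [PX KX ->]]] : (row i U <= U)%MS by exact: row_sub.
  apply/HU; exists (X *m X'), (Y *m Y'); rewrite mulmxA KX mul0mx mulmxA; split=> //.
  exact: malgM.
have U0 : U != 0.
  apply/negP => /eqP U0; apply: sY0; apply/eqP; rewrite -submx0 -U0; apply/HU.
  by exists X0, Y0.
have US : (U <= S)%MS.
  apply/row_subP => i.
  have /HU[X [Y [PX KX ->]]] : (row i U <= U)%MS by exact: row_sub.
  by apply: submx_trans (sS Y _); [exact: submxMr | exists X].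
have /HU[X [Y [PXY KX sY]]] := submx_trans sS' (Smin U sU U0 US).
have [q [q1 qI]] := idempotent_poly Y.
pose e := horner_mx Y (q * 'X).
have Pe := malg_horner (q * 'X) mP PXY.
have se : s *m e = s by rewrite (@horner_mx_eigen _ _ _ _ 1) ?q1 ?scale1r.
have := ker_coker_trace (erefl K) sKD sfC (fP _ _ Pe) (sD _ (ex_intro _ _ Pe))
  (sC _ (ex_intro _ _ Pe)) (trP Pe).
have -> : proj_mx K D *m horner_mx X (q * 'X) = 0.
  rewrite mulrC rmorphM /= horner_mx_X -mulmxE mulmxA.
  have -> : proj_mx K D *m X = 0; last by rewrite mul0mx.
  by apply/eqP; rewrite -submx0 -KX; apply: submxMr; exact: proj_sub.
rewrite mxtrace0 -/e.
have ce : e *m proj_mx C f = proj_mx C f *m e.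
  apply: proj_comm; first exact: supplement_sym.
    by apply: sC; eexists; exact: Pe.
  by apply: sf; eexists; exact: Pe.
have sp : s *m proj_mx C f = s.
  by rewrite (proj_mx_id (supplement_sym sfC).2) //; apply: submx_trans sS' SC.
(* The idempotent induced on [C] fixes [s], so its rank, which is its trace, cannot be 0. *)
rewrite mxtrace_idem; last first.
  rewrite mulmxA -(mulmxA _ e) ce mulmxA -(mulmxA _ e) qI.
  by rewrite proj_mx_proj //; have [] := supplement_sym sfC.
move/esym/eqP; rewrite pnatr_eq0 mxrank_eq0 => /eqP e0.
by case/eqP: s0; rewrite -se -sp -mulmxA e0 mulmx0.
Qed.

End Square.

Lemma same_trace_iso n n' (P : 'M[F]_n -> 'M[F]_n' -> Prop) : matrix_algebra P ->
  completely_reducible (left_alg P) -> completely_reducible (right_alg P) ->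
  (forall X Y, P X Y -> \tr X = \tr Y) ->
  exists (f : 'M[F]_(n, n')) (g : 'M[F]_(n', n)), [/\ f *m g = 1%:M, g *m f = 1%:M &
    forall X Y, P X Y -> X *m f = f *m Y].
Proof.
move=> mP red1 red2 trP.
have nn' : n = n'.
  by have /eqP := trP _ _ (malg1 mP); rewrite !mxtrace1 eqr_nat => /eqP.
case: _ / nn' P mP red1 red2 trP => P mP red1 red2 trP.
case: n P mP red1 red2 trP => [|n] P mP red1 red2 trP.
  by exists 0, 0; split=> *; rewrite ?flatmx0 ?thinmx0.
suff [f fP fu] : exists2 f : 'M[F]_n.+1, forall X Y, P X Y -> X *m f = f *m Y & f \in unitmx.
  by exists f, (invmx f); rewrite mulmxV ?mulVmx.
pose p r := `[< exists2 f : 'M[F]_n.+1, forall X Y, P X Y -> X *m f = f *m Y & \rank f = r >].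
have exp : exists r, p r.
  by exists 0%N; apply/asboolP; exists 0; rewrite ?mxrank0 // => X Y _; rewrite mulmx0 mul0mx.
have pn r : p r -> (r <= n.+1)%N by move=> /asboolP[f _ <-]; exact: rank_leq_row.
case: (ex_maxnP exp pn) => r /asboolP[f fP rf] rmax.
exists f => //; rewrite -row_full_unit -col_leq_rank leqNgt; apply/negP => lt.
have [f' f'P] := increase_rank mP red1 red2 trP fP lt.
rewrite ltnNge rf => /negP[]; apply: rmax.
by apply/asboolP; exists f'.
Qed.

End SameTrace.

(** * Coordinates and graded endomorphisms *)

Section Coordinates.
Variables (F : fieldType) (Q : quiver) (d : vert Q -> nat).
Local Notation V := (vspace_sum F d).

(** One index set for all summands: operators on [V] become square matrices, to which trace, rank
    and spectral theory apply. *)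
Definition index := {v : vert Q & 'I_(d v)}.
Definition dimV := #|{: index}|.
Definition ix (v : vert Q) (i : 'I_(d v)) : 'I_dimV := enum_rank (Tagged (fun v => 'I_(d v)) i).

Definition coords (x : V) : 'cV[F]_dimV :=
  \col_i x (tag (enum_val i)) (tagged (enum_val i)) 0.
Definition uncoords (y : 'cV[F]_dimV) : V := fun v => \col_i y (ix i) 0.

Lemma vaddE (x y : V) v : (x + y) v = x v + y v. Proof. by []. Qed.
Lemma vscaleE c (x : V) v : (c *: x) v = c *: x v. Proof. by []. Qed.

Lemma ix_val (i : 'I_dimV) : ix (tagged (enum_val i)) = i.
Proof. by rewrite /ix /Tagged -[RHS]enum_valK; congr enum_rank; case: (enum_val i). Qed.

Lemma coordsE (x : V) v (i : 'I_(d v)) : coords x (ix i) 0 = x v i 0.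
Proof. by rewrite mxE /ix enum_rankK. Qed.

Lemma coordsK : cancel coords uncoords.
Proof.
by move=> x; apply: Defs.vspaceP => v; apply/colP => i; rewrite mxE coordsE.
Qed.

Lemma uncoordsK : cancel uncoords coords.
Proof. by move=> y; apply/colP => i; rewrite !mxE ix_val. Qed.

Lemma coords_linear : linear coords.
Proof. by move=> c x y; apply/colP => i; rewrite !mxE. Qed.
HB.instance Definition _ := GRing.isLinear.Build F V 'cV[F]_dimV _ coords coords_linear.

Lemma uncoords_linear : linear uncoords.
Proof.
move=> c x y; apply: Defs.vspaceP => v; apply/colP => i.
by rewrite vaddE vscaleE !mxE.
Qed.
HB.instance Definition _ := GRing.isLinear.Build F 'cV[F]_dimV V _ uncoords uncoords_linear.

Definition opmx (L : V -> V) : 'M[F]_dimV := \matrix_(i, j) coords (L (uncoords (delta_mx j 0))) i 0.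

Lemma opmxE L : linear L -> forall x, opmx L *m coords x = coords (L x).
Proof.
move=> linL x; rewrite -{2}[x]coordsK [coords x in RHS]matrix_sum_delta.
pose g y := coords (L (uncoords y)).
have ling : linear g by move=> c y z; rewrite /g linearP linL linearP.
pose gl := GRing.isLinear.Build F _ _ _ g ling.
pose h : {linear 'cV[F]_dimV -> 'cV[F]_dimV} := HB.pack g gl.
rewrite -[RHS]/(h _) linear_sum; apply/colP => i.
rewrite mxE summxE; apply: eq_bigr => j _; rewrite big_ord1 linearZ !mxE mulrC.
by congr (_ * _); rewrite /= /g mxE.
Qed.

Lemma mx_ext n (A B : 'M[F]_(n, dimV)) : (forall x, A *m coords x = B *m coords x) -> A = B.
Proof.
move=> AB; apply/matrixP => i j.
have := AB (uncoords (delta_mx j 0)); rewrite uncoordsK -!colE.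
by move/matrixP/(_ i 0); rewrite !mxE.
Qed.

Lemma linear_vinj n (L : V -> 'cV[F]_n) : linear L ->
  exists s : forall v, 'M[F]_(n, d v), forall x, L x = \sum_v s v *m x v.
Proof.
move=> linL; exists (fun v => \matrix_(i, j) L (vinj (delta_mx j 0)) i 0) => x.
pose gl := GRing.isLinear.Build F _ _ _ L linL.
pose h : {linear V -> 'cV[F]_n} := HB.pack L gl.
rewrite {1}(vinj_sum x) -[LHS]/(h _) linear_sum; apply: eq_bigr => v _.
rewrite {1}[x v]matrix_sum_delta.
have -> : vinj (\sum_i \sum_j x v i j *: delta_mx i j) =
   \sum_i x v i 0 *: vinj (delta_mx i 0) :> V.
  under eq_bigr do rewrite big_ord1.
  elim/big_ind2: _ => [|y1 y2 z1 z2 <- <-|i _]; first exact: vinj0.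
    by rewrite -[y2]scale1r vinj_linear !scale1r.
  by rewrite -[_ *: delta_mx _ _]addr0 vinj_linear vinj0 addr0.
rewrite -[LHS]/(h _) linear_sum; apply/colP => i.
rewrite mxE summxE; apply: eq_bigr => j _; by rewrite linearZ !mxE mulrC.
Qed.

End Coordinates.

(** * The ring of graded endomorphisms with its involution *)

Section GradedEndomorphisms.
Variables (F : fieldType) (Q : smquiver) (G : smsetting F Q).
Local Notation d := (vdim G).
Local Notation V := (vspace_sum F d).
Local Notation S := (Sgam G).

HB.instance Definition _ := gen_eqMixin S.
HB.instance Definition _ := gen_choiceMixin S.

Lemma SgamP (s t : S) : (forall v, s v = t v) -> s = t.
Proof. by move=> st; exact: functional_extensionality_dep. Qed.

Definition sadd (s t : S) : S := fun v => s v + t v.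
Definition sopp (s : S) : S := fun v => - s v.
Definition szero : S := fun v => 0.
Definition smul (s t : S) : S := fun v => s v *m t v.
Definition sone : S := fun v => 1%:M.
Definition sscale (c : F) (s : S) : S := fun v => c *: s v.

Fact saddA : associative sadd. Proof. by move=> *; apply: SgamP => v; exact: addrA. Qed.
Fact saddC : commutative sadd. Proof. by move=> *; apply: SgamP => v; exact: addrC. Qed.
Fact sadd0 : left_id szero sadd. Proof. by move=> *; apply: SgamP => v; exact: add0r. Qed.
Fact saddN : left_inverse szero sopp sadd. Proof. by move=> *; apply: SgamP => v; exact: addNr. Qed.
HB.instance Definition _ := GRing.isZmodule.Build S saddA saddC sadd0 saddN.

Fact smulA : associative smul. Proof. by move=> *; apply: SgamP => v; exact: mulmxA. Qed.
Fact smul1l : left_id sone smul. Proof. by move=> *; apply: SgamP => v; exact: mul1mx. Qed.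
Fact smul1r : right_id sone smul. Proof. by move=> *; apply: SgamP => v; exact: mulmx1. Qed.
Fact smulDl : left_distributive smul +%R. Proof. by move=> *; apply: SgamP => v; exact: mulmxDl. Qed.
Fact smulDr : right_distributive smul +%R. Proof. by move=> *; apply: SgamP => v; exact: mulmxDr. Qed.
HB.instance Definition _ := GRing.Zmodule_isPzRing.Build S smulA smul1l smul1r smulDl smulDr.

Fact sscaleA a b s : sscale a (sscale b s) = sscale (a * b) s.
Proof. by apply: SgamP => v; exact: scalerA. Qed.
Fact sscale1 : left_id 1 sscale. Proof. by move=> s; apply: SgamP => v; exact: scale1r. Qed.
Fact sscaleDr : right_distributive sscale +%R. Proof. by move=> *; apply: SgamP => v; exact: scalerDr. Qed.
Fact sscaleDl s : {morph sscale^~ s : a b / a + b}. Proof. by move=> *; apply: SgamP => v; exact: scalerDl. Qed.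
HB.instance Definition _ := GRing.Zmodule_isLmodule.Build F S sscaleA sscale1 sscaleDr sscaleDl.
Fact sscaleAl c (s t : S) : c *: (s * t) = (c *: s) * t.
Proof. by apply: SgamP => v; exact: scalemxAl. Qed.
Fact sscaleAr c (s t : S) : c *: (s * t) = s * (c *: t).
Proof. by apply: SgamP => v; exact: scalemxAr. Qed.

Lemma sgamD (s t : S) v : (s + t) v = s v + t v. Proof. by []. Qed.
Lemma sgamM (s t : S) v : (s * t) v = s v *m t v. Proof. by []. Qed.
Lemma sgam1 v : (1 : S) v = 1%:M. Proof. by []. Qed.
Lemma sgam0 v : (0 : S) v = 0. Proof. by []. Qed.
Lemma sgamN (s : S) v : (- s) v = - s v. Proof. by []. Qed.
Lemma sgamZ c (s : S) v : (c *: s) v = c *: s v. Proof. by []. Qed.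
Local Notation star := (@sstar F Q G : S -> S).

Lemma starK (s : S) : star (star s) = s.
Proof. by apply: SgamP => v; exact: sstarK. Qed.

Lemma starD (s t : S) : star (s + t) = star s + star t.
Proof.
by apply: SgamP => v; rewrite sgamD !sstarE sgamD castmx_add linearD /= mulmxDr mulmxDl.
Qed.

Lemma starZ c (s : S) : star (c *: s) = c *: star s.
Proof.
by apply: SgamP => v; rewrite sgamZ !sstarE sgamZ castmx_scale linearZ /= -scalemxAr -scalemxAl.
Qed.

Lemma starN (s : S) : star (- s) = - star s.
Proof. by rewrite -scaleN1r starZ scaleN1r. Qed.

Lemma starB (s t : S) : star (s - t) = star s - star t.
Proof. by rewrite starD starN. Qed.

Lemma starM (s t : S) : star (s * t) = star t * star s.
Proof.
apply: SgamP => v; rewrite sgamM !sstarE sgamM.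
rewrite (castmx_mulmx _ _ (vdim_phi0 G v) (vdim_phi0 G v) (vdim_phi0 G v)) trmx_mul !mulmxA.
by rewrite (mulmxK (gamc_unit _ _)).
Qed.

Lemma star1 : star 1 = 1.
Proof. by rewrite -[star 1]mulr1 -{2}[1]starK -starM mulr1 starK. Qed.

Definition sapply (s : S) (x : V) : V := fun v => s v *m x v.

Lemma sapply_linear s : linear (sapply s).
Proof.
move=> c x y; apply: Defs.vspaceP => v.
by rewrite vaddE vscaleE /sapply vaddE vscaleE mulmxDr -scalemxAr.
Qed.

Lemma sapply0 s : sapply s 0 = 0.
Proof. by apply: Defs.vspaceP => v; rewrite /sapply mulmx0. Qed.

Lemma sapplyD s : {morph sapply s : x y / x + y}.
Proof. by move=> x y; rewrite -[x]scale1r sapply_linear !scale1r. Qed.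

Lemma sapplyM s t x : sapply (s * t) x = sapply s (sapply t x).
Proof. by apply: Defs.vspaceP => v; rewrite /sapply sgamM mulmxA. Qed.

Lemma sapply1 x : sapply 1 x = x.
Proof. by apply: Defs.vspaceP => v; rewrite /sapply sgam1 mul1mx. Qed.

Lemma sapply0l x : sapply 0 x = 0.
Proof. by apply: Defs.vspaceP => v; rewrite /sapply sgam0 mul0mx. Qed.

Lemma sapplyDl s t x : sapply (s + t) x = sapply s x + sapply t x.
Proof. by apply: Defs.vspaceP => v; rewrite vaddE /sapply sgamD mulmxDl. Qed.

Lemma sapplyNl s x : sapply (- s) x = - sapply s x.
Proof. by apply: Defs.vspaceP => v; rewrite /sapply sgamN mulNmx. Qed.

Lemma sapplyZl c s x : sapply (c *: s) x = c *: sapply s x.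
Proof. by apply: Defs.vspaceP => v; rewrite vscaleE /sapply sgamZ scalemxAl. Qed.

Lemma sapply_suml (I : Type) (r : seq I) (P : pred I) (f : I -> S) x :
  sapply (\sum_(i <- r | P i) f i) x = \sum_(i <- r | P i) sapply (f i) x.
Proof. by elim/big_rec2: _ => [|i y z _ <-]; rewrite ?sapply0l ?sapplyDl. Qed.

Lemma sapply_vinj s v (y : 'cV_(d v)) : sapply s (vinj y) = vinj (s v *m y).
Proof.
apply: Defs.vspaceP => w; rewrite /sapply.
have [<-|vw] := eqVneq v w; first by rewrite !vinj_in.
by rewrite !vinj_out // mulmx0.
Qed.

Lemma sapply_inj s t : (forall x, sapply s x = sapply t x) -> s = t.
Proof.
move=> st; apply: SgamP => v; apply/matrixP => i j.
have /(congr1 (fun x : V => x v i 0)) := st (vinj (delta_mx j 0)).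
by rewrite !sapply_vinj !vinj_in -!colE !mxE.
Qed.

Lemma gform_adj s x y : gform (sapply s x) y = gform x (sapply (star s) y).
Proof.
rewrite /gform; apply: eq_bigr => v _; congr (fun_of_matrix _ _ _).
rewrite /sapply (castmx_mulmx _ _ (vdim_phi0 G v) (vdim_phi0 G v) erefl) sstar_phi.
by rewrite trmx_mul !mulmxA mulmxK ?gam_unit.
Qed.

Lemma gform_adjr s x y : gform x (sapply s y) = gform (sapply (star s) x) y.
Proof. by rewrite gform_adj starK. Qed.

Definition Dmx (s : S) : 'M[F]_(dimV d) := opmx (sapply s).

Lemma DmxE s x : Dmx s *m coords x = coords (sapply s x).
Proof. by rewrite opmxE //; exact: sapply_linear. Qed.

Lemma DmxM s t : Dmx (s * t) = Dmx s *m Dmx t.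
Proof. by apply: mx_ext => x; rewrite -mulmxA !DmxE sapplyM. Qed.

Lemma Dmx1 : Dmx 1 = 1%:M.
Proof. by apply: mx_ext => x; rewrite DmxE sapply1 mul1mx. Qed.

Lemma Dmx_inj : injective Dmx.
Proof.
move=> s t st; apply: sapply_inj => x; apply: (can_inj (@coordsK F Q d)).
by rewrite -!DmxE st.
Qed.

Definition Emx (v : vert Q) : 'M[F]_(dimV d) := opmx (@vert_act F Q d v).

Lemma EmxE v x : Emx v *m coords x = coords (vert_act v x).
Proof. by rewrite opmxE //; exact: vert_act_linear. Qed.

Lemma Emx_diag v : Emx v = diag_mx (\row_i (tag (enum_val i) == v)%:R).
Proof.
apply: mx_ext => x; rewrite EmxE mul_diag_mx; apply/colP => i; rewrite !mxE /vert_act.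
have [<-|nv] := eqVneq (tag (enum_val i)) v; first by rewrite vinj_in mul1r.
by rewrite vinj_out 1?eq_sym // mxE mul0r.
Qed.

Lemma Dmx_comm s v : Dmx s *m Emx v = Emx v *m Dmx s.
Proof.
apply: mx_ext => x; rewrite -!mulmxA DmxE !EmxE DmxE /vert_act sapply_vinj //.
Qed.

(** Brings back to [Sgam] what is built in the full matrix algebra: square roots, and adjoints in
    another basis. *)
Lemma comm_DmxP X : (forall v, X *m Emx v = Emx v *m X) -> exists s, X = Dmx s.
Proof.
move=> XE.
have linX v : linear (fun x : V => uncoords (X *m coords x) v : 'cV[F]_(d v)).
  by move=> c x y; rewrite linearP mulmxDr -scalemxAr linearP.
pose s v := projT1 (cid (linear_vinj (linX v))).
have sP v x : uncoords (X *m coords x) v = \sum_w s v w *m x w.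
  by rewrite /s; case: cid => t /= ->.
exists (fun v => s v v); apply: mx_ext => x; rewrite DmxE.
apply: (can_inj (@uncoordsK F Q d)); rewrite coordsK; apply: Defs.vspaceP => v.
rewrite /sapply.
have -> : uncoords (X *m coords x) v = uncoords (X *m coords (vert_act v x)) v.
  have -> : X *m coords (vert_act v x) = coords (vert_act v (uncoords (X *m coords x))).
    by rewrite -[in RHS]EmxE uncoordsK -[in LHS]EmxE mulmxA XE -mulmxA.
  by rewrite coordsK /vert_act vinj_in.
rewrite sP (bigD1 v) //= /vert_act vinj_in big1 ?addr0 // => w wv.
by rewrite vinj_out 1?eq_sym // mulmx0.
Qed.

Definition gram : 'M[F]_(dimV d) :=
  \matrix_(i, j) gform (uncoords (delta_mx i 0)) (uncoords (delta_mx j 0)).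

Lemma bilinear_mx n (B : 'cV[F]_n -> 'cV[F]_n -> F) :
  (forall c u u' w, B (c *: u + u') w = c * B u w + B u' w) ->
  (forall c u w w', B u (c *: w + w') = c * B u w + B u w') ->
  forall u w, B u w = (u^T *m (\matrix_(i, j) B (delta_mx i 0) (delta_mx j 0)) *m w) 0 0.
Proof.
move=> Bl Br u w.
have B0l w' : B 0 w' = 0.
  by have := Bl (-1) 0 0 w'; rewrite scaleN1r oppr0 addr0 mulN1r addNr.
have B0r u' : B u' 0 = 0.
  by have := Br (-1) u' 0 0; rewrite scaleN1r oppr0 addr0 mulN1r addNr.
have lsum (c : 'I_n -> F) w' : B (\sum_i c i *: delta_mx i 0) w' = \sum_i c i * B (delta_mx i 0) w'.
  by elim/big_rec2: _ => [|i y z _ <-] //; rewrite Bl.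
have rsum (c : 'I_n -> F) u' : B u' (\sum_i c i *: delta_mx i 0) = \sum_i c i * B u' (delta_mx i 0).
  by elim/big_rec2: _ => [|i y z _ <-] //; rewrite Br.
have sumE (y : 'cV[F]_n) : y = \sum_i y i 0 *: delta_mx i 0.
  by rewrite {1}[y]matrix_sum_delta; apply: eq_bigr => i _; rewrite big_ord1.
rewrite {1}(sumE u) {1}(sumE w) rsum mxE; apply: eq_bigr => j _.
rewrite lsum mulrC mxE; congr (_ * _); apply: eq_bigr => i _.
by rewrite !mxE.
Qed.

Lemma gramE x y : gform x y = ((coords x)^T *m gram *m coords y) 0 0.
Proof.
rewrite -{1}[x]coordsK -{1}[y]coordsK.
apply: (@bilinear_mx _ (fun u w => gform (uncoords u) (uncoords w))) => c u u' w.
  by rewrite linearP form_linl.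
by rewrite linearP form_linr.
Qed.

Lemma mx00_eq n (A B : 'M[F]_n) :
  (forall x y : 'cV_n, (x^T *m A *m y : 'M_1) 0 0 = (x^T *m B *m y : 'M_1) 0 0) -> A = B.
Proof.
move=> AB; apply/eqP; rewrite -subr_eq0; apply/eqP; apply: mx00_eq0 => x y.
by rewrite mulmxBr mulmxBl mxE [X in _ + X]mxE AB subrr.
Qed.

Lemma gram_ext (A B : 'M[F]_(dimV d)) :
  (forall x y : V, ((coords x)^T *m A *m coords y) 0 0 = ((coords x)^T *m B *m coords y) 0 0) -> A = B.
Proof.
move=> AB; apply: mx00_eq => x y.
by rewrite -[x](@uncoordsK F Q d) -[y](@uncoordsK F Q d).
Qed.

Lemma Dmx_star s : (Dmx s)^T *m gram = gram *m Dmx (star s).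
Proof.
apply: gram_ext => x y.
rewrite mulmxA -trmx_mul DmxE -gramE gform_adj gramE -DmxE !mulmxA //.
Qed.

(** Facts about the form alone are read off from [DRep_mixed] at this point. *)
Definition rep0 : DRep G := MkDRep (zero_subproof G).

Lemma gform_mixed (W : DRep G) : @eps_mixed F Q (repmod W) (@gform F Q G).
Proof. by apply/DRep_mixed; exact: drepP. Qed.

Lemma gform_nondegl (x : V) : (forall y, gform x y = 0) -> x = 0.
Proof. exact: (mixed_nondegl (gform_mixed rep0)). Qed.

Lemma gform_nondegr (y : V) : (forall x, gform x y = 0) -> y = 0.
Proof. exact: (mixed_nondegr (gform_mixed rep0)). Qed.

Lemma gram_unit : gram \in unitmx.
Proof.
rewrite -row_free_unit -kermx_eq0; apply/eqP/row_matrixP => i; rewrite row0.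
have /sub_kermxP k0 : (row i (kermx gram) <= kermx gram)%MS by exact: row_sub.
apply: trmx_inj; rewrite trmx0.
rewrite -[LHS](@uncoordsK F Q d); set x := uncoords _.
have -> : x = 0; last by rewrite linear0.
apply: gform_nondegl => y; rewrite gramE uncoordsK trmxK k0 mul0mx mxE //.
Qed.

Definition epsmx : 'M[F]_(dimV d) := diag_mx (\row_i (eps (tag (enum_val i)))%:~R).

Lemma gram_tr : gram^T = gram *m epsmx.
Proof.
apply: gram_ext => x y.
have -> : ((coords x)^T *m gram^T *m coords y) 0 0 = gform y x.
  have t11 (A : 'M[F]_1) : A 0 0 = A^T 0 0 by rewrite mxE.
  by rewrite gramE [RHS]t11 !trmx_mul trmxK mulmxA.
have -> : gform y x = gform x (eps_elt F Q *: (y : repmod rep0)).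
  exact: (mixed_sym (gform_mixed rep0)).
rewrite gramE -[in RHS]mulmxA -[in RHS]mulmxA -[in LHS]mulmxA.
congr ((_ *m (_ *m _) : 'M_1) 0 0); rewrite /epsmx mul_diag_mx.
by apply/colP => i; rewrite !mxE eps_act mxE.
Qed.

End GradedEndomorphisms.

(** * Degeneration to semisimple points *)

Section Degeneration.
Variables (F : numFieldType) (Q : smquiver) (G : smsetting F Q).
Local Notation d := (vdim G).
Local Notation V := (vspace_sum F d).
Local Notation S := (Sgam G).
Local Notation star := (@sstar F Q G : S -> S).
Local Notation rep := (rep F d).

Definition lract (s : S) (W : rep) (t : S) : rep := fun a => s (qhead a) *m W a *m t (qtail a).

Definition commutes (s : S) (W : rep) : Prop := forall a, s (qhead a) *m W a = W a *m s (qtail a).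

Lemma mstarD (m m' : rep) a : mstar (fun b => m b + m' b) a = mstar m a + mstar m' a.
Proof.
rewrite !mstarE /mphi castmx_add linearD /= mulmxDr mulmxDl scalerDr //.
Qed.

Lemma mstar_sum (I : Type) (r : seq I) (m : I -> rep) a :
  mstar (fun b => \sum_(i <- r) m i b) a = \sum_(i <- r) mstar (m i) a.
Proof.
elim: r => [|i r IH].
  rewrite big_nil -[RHS](zero_subproof G a).
  have -> // : (fun b => \sum_(i <- [::]) m i b) = (fun b => 0) :> rep.
  by apply: functional_extensionality_dep => b; rewrite big_nil.
rewrite big_cons -IH -mstarD.
have -> // : (fun b => \sum_(j <- i :: r) m j b) = (fun b => m i b + \sum_(j <- r) m j b) :> rep.
by apply: functional_extensionality_dep => b; rewrite big_cons.
Qed.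

Lemma mstar_lract (W : DRep G) s t a : mstar (lract s W t) a = lract (star t) W (star s) a.
Proof. by rewrite mstar_act drepP. Qed.

(** Some [e i] may be zero, so that the product of two families is indexed by all pairs. The image
    of [e i] is nondegenerate if [sigma i = i], and isotropic otherwise. *)
Record oidem (J : finType) (e : J -> S) (sigma : J -> J) : Prop := Oidem {
  oidM : forall i j, e i * e j = if i == j then e i else 0;
  oid_sum : \sum_i e i = 1;
  oid_star : forall i, star (e i) = e (sigma i);
  oid_inv : involutive sigma }.

Lemma oidem_prod (J K : finType) (e : J -> S) sigma (y : K -> S) tau :
  oidem e sigma -> oidem y tau -> (forall i k, e i * y k = y k * e i) ->
  oidem (fun p : J * K => e p.1 * y p.2) (fun p => (sigma p.1, tau p.2)).
Proof.
move=> oe oy ey; split.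
- move=> [i k] [j l] /=; rewrite mulrA -(mulrA (e i)) -ey !mulrA (oidM oe) -mulrA (oidM oy).
  by rewrite xpair_eqE; case: eqP => _; case: eqP => _; rewrite ?mulr0 ?mul0r.
- rewrite -(pair_bigA _ (fun i k => e i * y k)) /= -[RHS](oid_sum oe).
  by apply: eq_bigr => i _; rewrite -mulr_sumr (oid_sum oy) mulr1.
- by move=> [i k] /=; rewrite starM (oid_star oe) (oid_star oy) ey.
- by move=> [i k] /=; rewrite (oid_inv oe) (oid_inv oy).
Qed.

Lemma DmxD s t : Dmx (s + t : S) = Dmx s + Dmx t.
Proof. by apply: mx_ext => x; rewrite mulmxDl !DmxE sapplyDl linearD. Qed.

Lemma Dmx0 : Dmx (0 : S) = 0.
Proof. by apply: mx_ext => x; rewrite DmxE sapply0l linear0 mul0mx. Qed.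

Lemma nonzero_idem_bound (J : finType) (e : J -> S) sigma : oidem e sigma ->
  (#|[pred i | e i != 0%R]| <= dimV d)%N.
Proof.
move=> oe.
have: dimV d = (\sum_i \rank (Dmx (e i)))%N.
  apply/eqP; rewrite -(eqr_nat F) -mxtrace1 -(Dmx1 G) -(oid_sum oe).
  rewrite (big_morph _ DmxD Dmx0) raddf_sum /= natr_sum; apply/eqP; apply: eq_bigr => i _.
  by apply: mxtrace_idem; rewrite -DmxM (oidM oe) eqxx.
move=> ->; rewrite -sum1_card big_mkcond /=; apply: leq_sum => i _; case: ifP => // ei.
rewrite lt0n mxrank_eq0; apply: contraNneq ei => De.
by apply/eqP/(@Dmx_inj _ _ G); rewrite De Dmx0.
Qed.

(** Every nonzero [e i] has a nonzero product with some [y (kap i)], and [e i0] has a second one, at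
    [k2]. So the old nonzero indices and one more inject into the new ones. *)
Lemma more_nonzero (J K : finType) (e : J -> S) sigma (y : K -> S) tau i0 k0 :
  oidem e sigma -> oidem y tau -> e i0 * y k0 != 0 -> e i0 * y k0 != e i0 ->
  (#|[pred i | e i != 0%R]| < #|[pred p : J * K | (e p.1 * y p.2)%R != 0%R]|)%N.
Proof.
move=> oe oy n0 ne.
have /choice[kap Hk] : forall i, exists k, e i != 0 -> e i * y k != 0.
  move=> i; have [->|ei] := eqVneq (e i) 0; first by exists k0.
  suff /existsP[k hk] : [exists k, e i * y k != 0] by exists k.
  apply: contraNT ei; rewrite negb_exists => /forallP h.
  rewrite -[e i]mulr1 -(oid_sum oy) mulr_sumr big1 // => k _.
  by apply/eqP; rewrite -[_ == _]negbK h.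
have [k1 k1n k1e] : exists2 k, k != k0 & e i0 * y k != 0.
  suff /existsP[k /andP[h1 h2]] : [exists k, (k != k0) && (e i0 * y k != 0)] by exists k.
  apply: contraNT ne; rewrite negb_exists => /forallP h.
  rewrite -[X in _ == X]mulr1 -(oid_sum oy) mulr_sumr (bigD1 k0) //= big1 ?addr0 // => k kk.
  by apply/eqP; have := h k; rewrite kk /= negbK.
have ei0 : e i0 != 0 by apply: contraNneq n0 => ->; rewrite mul0r.
pose k2 := if kap i0 == k0 then k1 else k0.
have k2n : k2 != kap i0 by rewrite /k2; case: (eqVneq (kap i0) k0) => [->|]; rewrite // eq_sym.
have k2e : e i0 * y k2 != 0 by rewrite /k2; case: ifP.
pose A := [set i | e i != 0]; pose f i := (i, kap i).
have finj : injective f by move=> i j [].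
have -> : #|[pred i | e i != 0]| = #|f @: A|.
  by rewrite card_imset // cardsE.
have <- : #|(i0, k2) |: f @: A| = #|f @: A|.+1.
  rewrite cardsU1 (_ : (i0, k2) \notin _ = true) //.
  by apply/imsetP => -[i _ [e1 e2]]; rewrite -e1 in e2; rewrite e2 eqxx in k2n.
apply: subset_leq_card; apply/fintype.subsetP => p; rewrite !inE => /orP[/eqP->//|pA].
case/imsetP: pA => j; rewrite inE => ej ->; exact: Hk.
Qed.

Fact diagonal_subproof (W : DRep G) (K : finType) (y : K -> S) tau (oy : oidem y tau) a :
  mstar (fun b => \sum_k lract (y k) W (y k) b) a = \sum_k lract (y k) W (y k) a.
Proof.
rewrite mstar_sum (reindex_inj (inv_inj (oid_inv oy))) /=; apply: eq_bigr => k _.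
by rewrite mstar_lract !(oid_star oy) (oid_inv oy).
Qed.

Definition diagonal_part W K y tau oy : DRep G := MkDRep (@diagonal_subproof W K y tau oy).

Lemma diagonal_commutes W (K : finType) (y : K -> S) tau (oy : oidem y tau) k :
  commutes (y k) (diagonal_part W oy).
Proof.
move=> a; rewrite /= mulmx_sumr mulmx_suml; apply: eq_bigr => l _.
rewrite /lract !mulmxA -sgamM -[in RHS]mulmxA -sgamM !(oidM oy) eq_sym.
by case: eqP => [->//|_]; rewrite sgam0 !mul0mx mulmx0.
Qed.

Lemma commutesM s t W : commutes s W -> commutes t W -> commutes (s * t) W.
Proof. by move=> sW tW a; rewrite !sgamM -mulmxA tW !mulmxA sW. Qed.

Lemma commutes_diagonal (W : DRep G) (K : finType) (y : K -> S) tau (oy : oidem y tau) e :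
  commutes e W -> (forall k, e * y k = y k * e) -> commutes e (diagonal_part W oy).
Proof.
move=> eW ey a; rewrite /= mulmx_sumr mulmx_suml; apply: eq_bigr => l _.
have eyv v : e v *m y l v = y l v *m e v by rewrite -!sgamM ey.
by rewrite /lract !mulmxA eyv -[RHS]mulmxA -[in RHS]eyv -(mulmxA (y l _) (e _)) eW !mulmxA.
Qed.

Import mpoly.

Lemma polynomial_curve n (q : 'I_n -> {poly F}) (p : mpoly n F) :
  exists P : {poly F}, forall c, P.[c] = meval (fun i => (q i).[c]) p.
Proof.
elim/mpoly_ind_gen: p => [a|i|p1 p2 [P1 h1] [P2 h2]|p1 p2 [P1 h1] [P2 h2]].
- by exists a%:P => c; rewrite hornerC mevalC.
- by exists (q i) => c; rewrite mevalXU.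
- by exists (P1 + P2) => c; rewrite hornerD mevalD h1 h2.
- by exists (P1 * P2) => c; rewrite hornerM mevalM h1 h2.
Qed.

(* An invariant is constant along g(c) W = A + c B + c^2 C, c != 0, hence also at c = 0. *)
Lemma invariant_limit (phi : inv_ring G) (W W' : DRep G) (B C : rep) :
  (forall c, c != 0 -> exists g : DGL G, forall a, dact g W a = W' a + c *: B a + c ^+ 2 *: C a) ->
  phi W' = phi W.
Proof.
move=> H; have /asboolP[[p phip] phi_inv] := inv_funP phi.
pose cf (X : rep) (i : 'I_#|{: Defs.coord G}|) : F := X (tag (enum_val i)) (tagged (enum_val i)).1 (tagged (enum_val i)).2.
pose q i := (cf W' i)%:P + (cf B i) *: 'X + (cf C i) *: 'X^2.
have [P HP] := polynomial_curve q p.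
have Pc c : c != 0 -> P.[c] = phi W.
  move=> /H[g gW]; rewrite HP -(phi_inv g W) phip; apply: meval_eq => i.
  rewrite /q /coordv gW !mxE /cf !hornerD hornerC !hornerZ hornerX hornerXn.
  by congr (_ + _ + _); rewrite mulrC.
have P0 : P.[0] = phi W'.
  rewrite HP phip; apply: meval_eq => i.
  by rewrite /q /coordv /cf !hornerD hornerC !hornerZ hornerX hornerXn expr0n /= !mulr0 !addr0.
suff e : P = (phi W)%:P by rewrite -P0 e hornerC.
apply/eqP; rewrite -subr_eq0; apply/eqP.
apply: (@roots_geq_poly_eq0 _ _ [seq (k.+1)%:R | k <- iota 0 (size (P - (phi W)%:P))]).
- apply/allP => _ /mapP[i _ ->]; apply/rootP.
  by rewrite hornerD hornerN hornerC Pc ?subrr // pnatr_eq0.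
- rewrite map_inj_uniq ?iota_uniq // => i j /eqP.
  by rewrite eqr_nat eqSS => /eqP.
- by rewrite size_map size_iota.
Qed.

(** * Degeneration along an isotropic submodule *)

Section IsotropicPair.
Variables (W : DRep G) (f : S).
Hypothesis ff : f * f = f.
Hypothesis fg0 : f * star f = 0.
Hypothesis gf0 : star f * f = 0.
Hypothesis Wf : forall a, f (qhead a) *m W a *m f (qtail a) = W a *m f (qtail a).
Local Notation g := (star f).
Local Notation r := (1 - f - star f).

Lemma iso_gg : g * g = g. Proof. by rewrite -starM ff. Qed.
Lemma iso_fr : f * r = 0. Proof. by rewrite !mulrBr mulr1 ff fg0 subrr subr0. Qed.
Lemma iso_rf : r * f = 0. Proof. by rewrite !mulrBl mul1r ff gf0 subrr subr0. Qed.
Lemma iso_gr : g * r = 0. Proof. by rewrite !mulrBr mulr1 iso_gg gf0 subr0 subrr. Qed.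
Lemma iso_rg : r * g = 0. Proof. by rewrite !mulrBl mul1r iso_gg fg0 subr0 subrr. Qed.
Lemma iso_rr : r * r = r.
Proof. by rewrite {1}[r]addrAC -{1}[1 - g - f]addrAC 2!mulrBl mul1r iso_fr iso_gr !subr0. Qed.
Lemma iso_star_r : star r = r.
Proof. by rewrite !starB star1 starK addrAC. Qed.

Definition iso_idem (k : option bool) : S :=
  match k with None => r | Some true => f | Some false => g end.

Lemma iso_oidem : oidem iso_idem (omap negb).
Proof.
split.
- move=> [[]|] [[]|] /=; first [exact: ff | exact: fg0 | exact: gf0 | exact: iso_gg | exact: iso_fr
    | exact: iso_rf | exact: iso_gr | exact: iso_rg | exact: iso_rr].
- rewrite (bigD1 None) //= (bigD1 (Some true)) //= (bigD1 (Some false)) //= big1; last first.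
    by move=> [[]|].
  by rewrite addr0 -(addrA 1) -opprD subrK.
- by move=> [[]|] //=; [rewrite starK | rewrite iso_star_r].
- by move=> [[]|].
Qed.

Definition iso_torus (c : F) : S := c *: f + c^-1 *: g + r.

Lemma iso_torus_star c : star (iso_torus c) = c *: g + c^-1 *: f + r.
Proof. by rewrite /iso_torus 2!starD !starZ starK iso_star_r. Qed.

Lemma iso_torusP c : c != 0 -> forall v, iso_torus c v *m sstar (iso_torus c) v = 1%:M.
Proof.
move=> c0 v; suff : iso_torus c * star (iso_torus c) = 1 by move/(congr1 (fun s : S => s v)).
rewrite iso_torus_star; set t := c *: g + _ + _.
have ft : f * t = c^-1 *: f.
  by rewrite (mulrDr f _ r) (mulrDr f (c *: g)) -!sscaleAr fg0 ff iso_fr scaler0 add0r addr0.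
have gt : g * t = c *: g.
  by rewrite (mulrDr g _ r) (mulrDr g (c *: g)) -!sscaleAr iso_gg gf0 iso_gr scaler0 !addr0.
have rt : r * t = r.
  by rewrite (mulrDr r _ r) (mulrDr r (c *: g)) -!sscaleAr iso_rg iso_rf iso_rr !scaler0 !add0r.
rewrite /iso_torus (mulrDl _ r t) (mulrDl (c *: f) _ t) -!sscaleAl ft gt rt !scalerA mulfV // mulVf // !scale1r.
by rewrite -(addrA 1) -opprD [LHS]addrC subrK.
Qed.

Definition iso_dgl c (c0 : c != 0) : DGL G := MkDGL (iso_torusP c0).

(** The adjoint of [Wf]: the kernel of [f^*] is stable under the arrows. *)
Lemma iso_gW a : g (qhead a) *m W a = g (qhead a) *m W a *m g (qtail a).
Proof.
have e : lract f W f = lract 1 W f.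
  by apply: functional_extensionality_dep => b; rewrite /lract Wf sgam1 mul1mx.
have := mstar_lract W f f a; rewrite e mstar_lract star1 /lract sgam1 mulmx1.
by [].
Qed.

(** With respect to [f], [r], [g] in this order, [W] is block upper triangular. The torus has
    weights 1, 0, -1 there, so it fixes the diagonal blocks and multiplies those above by [c]
    (collected in [B]) or [c ^+ 2]. *)
Lemma iso_diagonal (phi : inv_ring G) : phi (diagonal_part W iso_oidem) = phi W.
Proof.
pose B : rep := fun a => lract f W r a + lract r W g a.
apply: (@invariant_limit phi W (diagonal_part W iso_oidem) B (lract f W g)) => c c0.
exists (iso_dgl c0) => a; rewrite /= -/(star _) (iso_torus_star c).
have -> : \sum_k lract (iso_idem k) W (iso_idem k) a = lract f W f a + lract g W g a + lract r W r a.
  rewrite (bigD1 None) //= (bigD1 (Some true)) //= (bigD1 (Some false)) //= big1; last first.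
    by move=> [[]|].
  by rewrite addr0 addrC.
rewrite /B /lract.
have rWf : r (qhead a) *m W a *m f (qtail a) = 0.
  by rewrite -mulmxA -Wf !mulmxA -sgamM iso_rf sgam0 !mul0mx.
have gWf : g (qhead a) *m W a *m f (qtail a) = 0.
  by rewrite -mulmxA -Wf !mulmxA -sgamM gf0 sgam0 !mul0mx.
have gWr : g (qhead a) *m W a *m r (qtail a) = 0.
  by rewrite iso_gW -mulmxA -sgamM iso_gr sgam0 mulmx0.
have Tv v : iso_torus c v = c *: f v + c^-1 *: g v + r v by [].
have Tv' v : (c *: g + c^-1 *: f + r) v = c *: g v + c^-1 *: f v + r v by [].
rewrite Tv Tv'; move: (r (qhead a)) (r (qtail a)) rWf gWr => rh rt rWf gWr.
rewrite !mulmxDl !mulmxDr -!scalemxAl -!scalemxAr.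
rewrite rWf gWf gWr !scaler0 !addr0 !scalerA mulfV // mulVf // !scale1r -expr2 scalerDr !addrA.
by rewrite [LHS](ACl (2*4*6*3*5*1)%AC).
Qed.

End IsotropicPair.

End Degeneration.

(** * Projections onto graded subspaces *)

Section GradedSubspaces.
Variables (F : numFieldType) (Q : smquiver) (G : smsetting F Q).
Local Notation d := (vdim G).
Local Notation V := (vspace_sum F d).
Local Notation S := (Sgam G).
Local Notation star := (@sstar F Q G : S -> S).

Lemma subspace_idem n (P : 'cV[F]_n -> Prop) :
  P 0 -> (forall a u v, P u -> P v -> P (a *: u + v)) ->
  exists p : 'M[F]_n, (forall y, P (p *m y)) /\ (forall y, P y -> p *m y = y).
Proof.
move=> P0 Plin; have [|a u v Pu Pv|U HU] := @subspace_mx _ _ (fun u : 'rV[F]_n => P u^T).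
- by rewrite trmx0.
- by rewrite linearP; apply: Plin.
exists (pinvmx U *m U)^T; split=> y.
  rewrite -[_ *m y]trmxK; apply/HU; rewrite trmx_mul trmxK mulmxA; exact: submxMl.
rewrite -{1}[y]trmxK => /HU yU.
by apply: trmx_inj; rewrite trmx_mul trmxK mulmxA mulmxKpV.
Qed.

Record graded (U : V -> Prop) : Prop := Graded {
  gr0 : U 0;
  grL : forall a x y, U x -> U y -> U (a *: x + y);
  grV : forall v x, U x -> U (vert_act v x) }.

Lemma gr_sum U (I : Type) (r : seq I) (f : I -> V) : graded U -> (forall i, U (f i)) ->
  U (\sum_(i <- r) f i).
Proof.
move=> gU Uf; elim/big_rec: _ => [|i x _ Ux]; first exact: gr0.
by rewrite -[f i]scale1r; apply: grL.
Qed.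

Lemma graded_idem U : graded U ->
  exists f : S, (forall x, U (sapply f x)) /\ (forall x, U x -> sapply f x = x).
Proof.
move=> gU.
have H v : exists p : 'M[F]_(d v), (forall y, U (vinj (p *m y))) /\ (forall y, U (vinj y) -> p *m y = y).
  apply: (@subspace_idem _ (fun y => U (vinj y))).
    by rewrite vinj0; exact: gr0.
  by move=> a u w Uu Uw; rewrite vinj_linear; apply: grL.
pose f : S := fun v => projT1 (cid (H v)).
have f1 v y : U (vinj (f v *m y)) by rewrite /f; case: cid => p [].
have f2 v y : U (vinj y) -> f v *m y = y by rewrite /f; case: cid => p [h1 h2] /=; exact: h2.
exists f; split=> [x|x Ux].
  by rewrite [sapply f x]vinj_sum; exact: (gr_sum _ gU (fun v => f1 v _)).
by apply: Defs.vspaceP => v; apply: f2; exact: (grV gU).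
Qed.

Lemma idem_of U (f : S) : (forall x, U (sapply f x)) -> (forall x, U x -> sapply f x = x) -> f * f = f.
Proof. by move=> h1 h2; apply: sapply_inj => x; rewrite sapplyM h2. Qed.

Lemma star_eq0 (s : S) : (forall x y, gform x (sapply s y) = 0) -> s = 0.
Proof.
move=> h; apply: sapply_inj => y; rewrite sapply0l.
by apply: gform_nondegr => x; exact: h.
Qed.

Lemma mxrank_inj_mul m n p (A : 'M[F]_(m, n)) (B : 'M[F]_(n, p)) :
  (forall y : 'cV_p, A *m (B *m y) = 0 -> B *m y = 0) -> (\rank B <= \rank (A *m B))%N.
Proof.
move=> h; rewrite -(mxrank_tr B) -(mxrank_tr (A *m B)).
have le : (kermx (A *m B)^T <= kermx B^T)%MS.
  apply/row_subP => i; apply/sub_kermxP; apply: trmx_inj.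
  rewrite trmx_mul trmxK trmx0; apply: h.
  have /sub_kermxP : (row i (kermx (A *m B)^T) <= kermx (A *m B)^T)%MS by exact: row_sub.
  by move/(congr1 trmx); rewrite trmx_mul trmxK trmx0 mulmxA.
have := mxrankS le; rewrite !mxrank_ker.
by rewrite leq_sub2lE // rank_leq_row.
Qed.

Lemma rank_star (f : S) v : \rank (star f v) = \rank (f (phi0 v)).
Proof.
rewrite sstarE mxrankMfree ?row_free_unit ?gamc_unit //.
rewrite (eqmxMfull _ _) ?row_full_unit ?unitmx_inv ?gamc_unit // mxrank_tr.
by case: _ / (vdim_phi0 G v); rewrite castmx_id.
Qed.

(* The projection onto U along its orthogonal is p = f z, where f^* f z = f^*; such a z exists by
   comparison of ranks, since f^* is injective on U. *)
Lemma nondegenerate_idem U (f : S) : graded U ->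
  (forall x, U (sapply f x)) -> (forall x, U x -> sapply f x = x) ->
  (forall x, U x -> (forall t, U t -> gform x t = 0) -> x = 0) ->
  exists p : S, [/\ forall x, U (sapply p x), forall x, U x -> sapply p x = x & star p = p].
Proof.
move=> gU f1 f2 U0.
have key x : sapply (star f) (sapply f x) = 0 -> sapply f x = 0.
  move=> h; apply: U0 => // t /f2 <-.
  by rewrite gform_adjr h /gform; apply: big1 => v _; rewrite trmx0 !mul0mx mxE.
have keyv v (y : 'cV_(d v)) : star f v *m (f v *m y) = 0 -> f v *m y = 0.
  move=> h; have := key (vinj y); rewrite !sapply_vinj h vinj0 => /(_ erefl).
  by move=> /(congr1 (fun x : V => x v)); rewrite vinj_in.
have r1 v : (\rank (f v) <= \rank (star f v *m f v))%N.
  by apply: mxrank_inj_mul => y; exact: keyv.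
(* Used at [v] and at [phi0 v], this makes the ranks of [f v] and [f (phi0 v)] equal. *)
have r2 v : (\rank (f v) <= \rank (f (phi0 v)))%N.
  by rewrite -rank_star; apply: leq_trans (r1 v) (mxrankM_maxl _ _).
have z v : exists z : 'M[F]_(d v), star f v = star f v *m f v *m z.
  have : ((star f v)^T <= (star f v *m f v)^T)%MS.
    have le : ((star f v *m f v)^T <= (star f v)^T)%MS by rewrite trmx_mul submxMl.
    rewrite -(geq_leqif (mxrank_leqif_sup le)) !mxrank_tr rank_star.
    by apply: leq_trans (r2 _) _; rewrite phi0K; exact: r1.
  by move=> /submxP[D /(congr1 trmx)]; rewrite [LHS]trmxK [RHS]trmx_mul [in RHS]trmxK => e; exists D^T.
pose zz : S := fun v => projT1 (cid (z v)).
have zP : star f * f * zz = star f.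
  by apply: SgamP => v; rewrite /zz [LHS]sgamM; case: cid => t /= ->.
pose p : S := f * zz.
have fp : star f * p = star f by rewrite mulrA.
have pf : star p * f = f by rewrite -[f in LHS]starK -starM fp starK.
have sp : star p = p.
  have e : star p * p = p by rewrite {2}/p mulrA pf.
  by rewrite -{1}e starM starK e.
have p1 x : U (sapply p x) by rewrite /p sapplyM.
exists p; split=> // x Ux; apply/eqP; rewrite -subr_eq0; apply/eqP; apply: U0.
  by rewrite -scaleN1r addrC; apply: grL.
move=> t /f2 <-; rewrite gform_adjr.
rewrite -scaleN1r sapplyD -sapplyM fp.
have -> : sapply (star f) (-1 *: x) = - sapply (star f) x.
  by rewrite -[-1 *: x]addr0 sapply_linear sapply0 addr0 scaleN1r.
rewrite subrr /gform big1 // => v _; rewrite trmx0 !mul0mx mxE //.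
Qed.

(* Replacing f by f - f f^* / 2 makes f f^* vanish without changing the image. *)
Lemma isotropic_idem U (f : S) : graded U ->
  (forall x, U (sapply f x)) -> (forall x, U x -> sapply f x = x) ->
  (forall x y, U x -> U y -> gform x y = 0) ->
  exists p : S, [/\ forall x, U (sapply p x), forall x, U x -> sapply p x = x,
    p * star p = 0, star p * p = 0 &
    forall e, star e = e -> e * f = f -> f * e = f -> p * e = p].
Proof.
move=> gU f1 f2 iso.
have ff : f * f = f by exact: idem_of f1 f2.
have gf : star f * f = 0.
  by apply: star_eq0 => x y; rewrite sapplyM -[star f]/(sstar f) -gform_adj; apply: iso.
have gg : star f * star f = star f by rewrite -starM ff.
pose p : S := f - 2^-1 *: (f * star f).
have sp : star p = star f - 2^-1 *: (f * star f) by rewrite starB starZ starM starK.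
have h2 : 2^-1 + 2^-1 = 1 :> F by rewrite [RHS]splitr div1r.
exists p; split.
- move=> x; rewrite /p sscaleAr -[X in X - _]mulr1 -mulrBr sapplyM; exact: f1.
- move=> x Ux.
  have gx : sapply (star f) x = 0 by rewrite -(f2 _ Ux) -sapplyM gf sapply0l.
  by rewrite sapplyDl sapplyNl sapplyZl sapplyM gx sapply0 scaler0 subr0 f2.
- rewrite sp /p mulrBl !mulrBr -!sscaleAl -!sscaleAr !mulrA ff -!mulrA gg.
  rewrite (mulrA (star f) f) gf mul0r mulr0 !scaler0 subr0.
  by rewrite -addrA -opprD -scalerDl h2 scale1r subrr.
- rewrite sp /p mulrBl !mulrBr -!sscaleAl -!sscaleAr !mulrA gf.
  rewrite -!mulrA gf !mulr0 (mulrA (star f) f) gf mul0r !scaler0 !subr0.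
  by rewrite mulr0 !scaler0 !subr0.
move=> e es ef fe; rewrite /p mulrBl fe -sscaleAl -mulrA.
by rewrite -[in star f * e]es -starM ef.
Qed.

End GradedSubspaces.

(** * Cutting the image of an idempotent that is not simple *)

Section Splitting.
Variables (F : numFieldType) (Q : smquiver) (G : smsetting F Q).
Local Notation d := (vdim G).
Local Notation V := (vspace_sum F d).
Local Notation S := (Sgam G).
Local Notation star := (@sstar F Q G : S -> S).

Lemma sapply_arr_act (s : S) (W : rep F d) a x : commutes s W ->
  sapply s (arr_act W a x) = arr_act W a (sapply s x).
Proof. by move=> sW; rewrite /arr_act sapply_vinj mulmxA sW -mulmxA. Qed.

Lemma sapply_scale (s : S) (W : rep F d) (c : pathalg F Q) (x : repmod W) : commutes s W ->
  sapply s (c *: x) = c *: (sapply s x : repmod W).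
Proof.
move=> sW; move: c.
apply: (@pathalg_ext F Q V (fun c => sapply s (c *: x)) (fun c => c *: (sapply s x : repmod W))).
- by move=> a c c'; rewrite repmod_scaleZDl sapply_linear.
- by move=> a c c'; rewrite repmod_scaleZDl.
move=> p; rewrite -[pelt F p *: x]/(linext _ _) -[RHS]/(linext _ _) !linext_pelt /path_act.
move: (val p) => [v w] /=; elim: w => [|a w IH] /=; first by rewrite /vert_act sapply_vinj.
by rewrite sapply_arr_act // IH.
Qed.

Lemma submod_graded (W : rep F d) (T : {pred repmod W}) : submod_closed T ->
  graded (fun x : V => (x : repmod W) \in T).
Proof.
move=> [T0 TL]; split=> //.
  by move=> a x y Tx Ty; rewrite -[a *: x](scalar_act (W := W)); apply: TL.
move=> v x Tx; rewrite -(velt_act (W := W)) -[_ *: _]addr0; exact: TL.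
Qed.

Variables (W : DRep G) (e : S).
Hypothesis eW : commutes e W.
Hypothesis ee : e * e = e.
Hypothesis e0 : e != 0.
Hypothesis estar : star e = e \/ (e * star e = 0 /\ star e * e = 0).

(** The image of [e], as [e] is idempotent. *)
Definition eigen1 : {pred drep_module W} := fun x => sapply e x == x.

Lemma eigen1P x : reflect (sapply e x = x) (x \in eigen1).
Proof. exact: eqP. Qed.

Lemma eigen1_closed : submod_closed eigen1.
Proof.
split; first by apply/eigen1P; exact: sapply0.
move=> c x y /eigen1P ex /eigen1P ey; apply/eigen1P.
by rewrite sapplyD (@sapply_scale e W c x eW) ex ey.
Qed.

(** The image of [f] is a proper nonzero submodule of that of [e]. The last clause, isotropic or
    self-adjoint, decides how [W] is cut. *)
Definition splits (f : S) : Prop :=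
  [/\ f * f = f, e * f = f, f * e = f, f != 0 & f != e] /\
  (forall a, f (qhead a) *m W a *m f (qtail a) = W a *m f (qtail a)) /\
  ((f * star f = 0 /\ star f * f = 0) \/ star f = f).

Lemma submod_idem (T : {pred drep_module W}) (f : S) : submod_closed T ->
  (forall x, (sapply f x : drep_module W) \in T) ->
  (forall x, (x : drep_module W) \in T -> sapply f x = x) ->
  forall a, f (qhead a) *m W a *m f (qtail a) = W a *m f (qtail a).
Proof.
move=> [T0 TL] f1 f2 a.
apply/matrixP => i j.
have h : (arr_act W a (sapply f (vinj (delta_mx j 0))) : drep_module W) \in T.
  by rewrite -(aelt_act (W := W)) -[_ *: _]addr0; apply: TL.
have /(congr1 (fun x : V => x (qhead a) i 0)) := f2 _ h.
rewrite /arr_act sapply_vinj sapply_vinj !vinj_in !mulmxA -!colE !mxE //.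
Qed.

Lemma splits_of (T : {pred drep_module W}) (f : S) : submod_closed T -> {subset T <= eigen1} ->
  (exists2 x, x \in T & x != 0) -> (exists2 x, x \in eigen1 & x \notin T) ->
  (forall x, (sapply f x : drep_module W) \in T) ->
  (forall x, (x : drep_module W) \in T -> sapply f x = x) ->
  f * e = f -> ((f * star f = 0 /\ star f * f = 0) \/ star f = f) -> splits f.
Proof.
move=> Tc Te [x Tx x0] [y ey Ty] f1 f2 fe fs; split; last first.
  by split=> //; exact: (submod_idem Tc).
split=> //.
- by apply: sapply_inj => z; rewrite sapplyM (f2 _ (f1 z)).
- apply: sapply_inj => z; rewrite sapplyM; apply/eigen1P/Te; exact: f1.
- apply: contraNneq x0 => f0; apply/eqP.
  by have := f2 _ Tx; rewrite f0 sapply0l.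
apply: contraNneq Ty => fe'.
by move/eigen1P: ey => <-; rewrite -fe'; exact: f1.
Qed.

(** Let [T] be a proper nonzero submodule of the image of [e]. If that image is isotropic, any
    projection [f] onto [T] with [f = e f e] will do. If [e] is self-adjoint, the radical [P] of the
    form on [T] is a submodule: when nonzero it is isotropic and is cut off, and when zero [T] is
    nondegenerate and has an orthogonal projection. *)
Lemma simple_or_splits : simple_submodule eigen1 \/ exists f, splits f.
Proof.
have [|nf] := pselect (exists f, splits f); [by right | left].
split; first exact: eigen1_closed.
  have [x xn] : exists x : V, sapply e x != 0.
    apply: contrapT => /forallNP h; case/eqP: e0; apply: sapply_inj => x.
    by rewrite sapply0l; apply: contrapT => /eqP; apply: h.
  by exists (sapply e x) => //; apply/eigen1P; rewrite -sapplyM ee.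
move=> T Tc Te; apply: contrapT => /not_orP[T0 Tne].
have {T0} hT0 : exists2 x, x \in T & x != 0.
  apply: contrapT => h; apply: T0 => x Tx; have [->|x0] := eqVneq x 0; first by rewrite inE.
  by case: h; exists x.
have {Tne} hTe : exists2 x, x \in eigen1 & x \notin T.
  apply: contrapT => h; apply: Tne => x ex; have [//|Tx] := boolP (x \in T).
  by case: h; exists x.
apply: nf.
have corner (U : {pred drep_module W}) : submod_closed U -> {subset U <= eigen1} ->
    exists f, [/\ forall x, (sapply f x : drep_module W) \in U,
      forall x, (x : drep_module W) \in U -> sapply f x = x, e * f = f & f * e = f].
  move=> Uc Ue; have gU := submod_graded Uc; have [f0 [f1 f2]] := graded_idem gU.
  have ef : e * f0 = f0.
    by apply: sapply_inj => x; rewrite sapplyM; apply/eigen1P/Ue; exact: f1.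
  (* Composing with [e] kills the complement of its image and changes nothing on [U]. *)
  exists (f0 * e); split=> [x|x Ux||]; rewrite ?sapplyM ?f1 //.
  - by move/eigen1P: (Ue _ Ux) => ->; rewrite f2.
  - by rewrite mulrA ef.
  - by rewrite -mulrA ee.
have [f [f1 f2 ef fe]] := corner T Tc Te.
case: estar => [es|[es1 es2]]; last first.
  exists f; apply: (splits_of Tc) => //; left; split.
    by rewrite -fe starM mulrA -(mulrA f) es1 mulr0 mul0r.
  by rewrite -ef starM mulrA -(mulrA (star f)) es2 mulr0 mul0r.
pose P : {pred drep_module W} := fun x => (x \in T) && `[< forall t : drep_module W, t \in T -> gform x t = 0 >].
have PP x : reflect ((x \in T) /\ forall t : drep_module W, t \in T -> gform x t = 0) (x \in P).
  by apply: (iffP andP) => -[h1 /asboolP h2].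
have Pc : submod_closed P.
  case: (Tc) => T0 TL; split.
    apply/PP; split=> // t _; rewrite /gform big1 // => v _.
    by rewrite trmx0 !mul0mx mxE.
  move=> c x y /PP[Tx xT] /PP[Ty yT]; apply/PP; split; first exact: TL.
  move=> t Tt.
  have -> : c *: x + y = (1 *: ((c *: x : drep_module W) : V) + (y : V) : V) by rewrite scale1r.
  rewrite form_linl mul1r yT // addr0.
  rewrite (mixed_adj (gform_mixed W)); apply: xT.
  by rewrite -[_ *: _]addr0; apply: TL.
have PT : {subset P <= T} by move=> x /PP[].
have Pe : {subset P <= eigen1} by move=> x /PT/Te.
have [hP|hP] := pselect (exists2 x, x \in P & x != 0).
  have [p [p1 p2 ep pe]] := corner P Pc Pe.
  have iso (x y : drep_module W) : x \in P -> y \in P -> gform x y = 0.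
    by move=> /PP[_ h] /PT; exact: h.
  have [q [q1 q2 qq1 qq2 qe]] := isotropic_idem (submod_graded Pc) p1 p2 iso.
  exists q; apply: (splits_of Pc) => //.
  - by have [x ex /negP Tx] := hTe; exists x => //; apply/negP => /PT.
  - exact: qe.
  - by left.
have nd (x : V) : (x : drep_module W) \in T ->
    (forall t : V, (t : drep_module W) \in T -> gform x t = 0) -> x = 0.
  move=> Tx xT; apply: contrapT => /eqP x0; apply: hP; exists x => //.
  by apply/PP.
have [p [p1 p2 ps]] := nondegenerate_idem (submod_graded Tc) f1 f2 nd.
exists p; apply: (splits_of Tc) => //; last by right.
have ep : e * p = p by apply: sapply_inj => x; rewrite sapplyM; apply/eigen1P/Te; exact: p1.
by rewrite -ps -{1}es -starM ep.
Qed.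

End Splitting.

(** * A semisimple point with the same values of the invariants *)

Section SemisimpleDegeneration.
Variables (F : numFieldType) (Q : smquiver) (G : smsetting F Q).
Local Notation d := (vdim G).
Local Notation V := (vspace_sum F d).
Local Notation S := (Sgam G).
Local Notation star := (@sstar F Q G : S -> S).

Definition decomposes (W : DRep G) (J : finType) (e : J -> S) (sigma : J -> J) : Prop :=
  oidem e sigma /\ forall i, commutes (e i) W.

Lemma selfadjoint_oidem (f : S) : f * f = f -> star f = f ->
  oidem (fun b : bool => if b then f else 1 - f) id.
Proof.
move=> ff sf; split=> //.
- move=> [] [] /=; [exact: ff | by rewrite mulrBr mulr1 ff subrr | by rewrite mulrBl mul1r ff subrr |].
  by rewrite mulrBl mul1r mulrBr mulr1 ff subrr subr0.
- by rewrite big_bool /= addrC subrK.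
- by move=> [] //=; rewrite starB star1 sf.
Qed.

Lemma star_commutes (W : DRep G) (f : S) :
  (forall a, f (qhead a) *m W a *m f (qtail a) = W a *m f (qtail a)) ->
  forall a, star f (qhead a) *m W a *m star f (qtail a) = star f (qhead a) *m W a.
Proof.
move=> Wf a.
have e : lract f W f = lract 1 W f.
  by apply: functional_extensionality_dep => b; rewrite /lract Wf sgam1 mul1mx.
by have := mstar_lract W f f a; rewrite e mstar_lract star1 /lract sgam1 mulmx1.
Qed.

(** [e] is multiplied by the family of [f], whose members commute with it. In the self-adjoint case
    [W] is kept: the image of [f] and its orthogonal are both stable, so [f] already commutes with
    the arrows. *)
Lemma refine_decomposition (W : DRep G) (J : finType) (e : J -> S) sigma i f :
  decomposes W e sigma -> splits W (e i) f ->
  exists (W' : DRep G) (J' : finType) (e' : J' -> S) sigma',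
    [/\ decomposes W' e' sigma', forall phi : inv_ring G, phi W' = phi W &
       (#|[pred i | e i != 0%R]| < #|[pred i | e' i != 0%R]|)%N].
Proof.
move=> [oe eW] [[ff ef fe f0 fne] [Wf fs]].
have fc j : e j * f = f * e j.
  have [->|ji] := eqVneq j i; first by rewrite ef fe.
  rewrite -{1}ef mulrA (oidM oe) (negPf ji) mul0r.
  by rewrite -fe -mulrA (oidM oe) eq_sym (negPf ji) mulr0.
have gc j : e j * star f = star f * e j.
  by rewrite -[e j](starK (G := G)) (oid_star oe) -!starM fc.
have n0 : e i * f != 0 by rewrite ef.
have ne : e i * f != e i by rewrite ef.
case: fs => [[fg gf]|sf].
  pose y := iso_idem f; pose oy := iso_oidem ff fg gf.
  have ey j k : e j * y k = y k * e j.
    by case: k => [[]|] //=; rewrite !mulrBr !mulrBl mulr1 mul1r fc gc.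
  exists (diagonal_part W oy), (J * option bool)%type, (fun p => e p.1 * y p.2),
    (fun p => (sigma p.1, omap negb p.2)); split.
  - split; first exact: oidem_prod.
    (* The old idempotents commute with the new ones, hence still with the degenerate point. *)
    move=> [j k] /=; apply: commutesM; last exact: (diagonal_commutes W oy k).
    exact: (commutes_diagonal oy (eW j) (ey j)).
  - by move=> phi; exact: (iso_diagonal ff fg gf Wf).
  - exact: (@more_nonzero _ _ _ _ _ _ _ _ _ i (Some true) oe oy).
pose y (b : bool) := if b then f else 1 - f; have oy := selfadjoint_oidem ff sf.
have fW : commutes f W.
  by move=> a; rewrite -Wf; have := star_commutes Wf a; rewrite -/(star f) sf => ->.
have ey j k : e j * y k = y k * e j.
  by case: k => //=; rewrite !mulrBr !mulrBl mulr1 mul1r fc.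
exists W, (J * bool)%type, (fun p => e p.1 * y p.2), (fun p => (sigma p.1, p.2)); split=> //.
  split; first exact: (oidem_prod oe oy).
  move=> [j k] /=; apply: commutesM => //; case: k => //= a.
  by rewrite sgamD sgamN sgam1 mulmxBl mulmxBr fW mul1mx mulmx1.
exact: (@more_nonzero _ _ _ _ _ _ _ _ _ i true oe oy).
Qed.

Lemma decomposition_semisimple (W : DRep G) (J : finType) (e : J -> S) sigma :
  decomposes W e sigma -> (forall i, e i != 0 -> simple_submodule (@eigen1 _ _ _ W (e i))) ->
  semisimple (drep_module W).
Proof.
move=> [oe eW] simp.
(* Zero idempotents are dropped because a simple submodule is nonzero. *)
pose A := [pred i | e i != 0].
exists #|A|, (fun k => @eigen1 _ _ _ W (e (enum_val k))); split.
  by move=> k; apply: simp; have := enum_valP k.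
move=> x.
have sumA (u : J -> V) : (forall i, e i = 0 -> u i = 0) -> \sum_(k < #|A|) u (enum_val k) = \sum_i u i.
  move=> u0; rewrite -(@big_enum_val _ _ _ _ A u) /= big_mkcond /=; apply: eq_bigr => i _.
  by rewrite inE; case: eqVneq => //= /u0.
exists [ffun k => sapply (e (enum_val k)) x]; split.
  split.
    by move=> k; rewrite ffunE; apply/eigen1P; rewrite -sapplyM (oidM oe) eqxx.
  rewrite -[LHS]sapply1 -(oid_sum oe) sapply_suml -sumA => [|i ->]; last exact: sapply0l.
  by apply: eq_bigr => k _; rewrite ffunE.
move=> u [uS xu]; apply/ffunP => k; rewrite ffunE xu.
have E : sapply (e (enum_val k)) (\sum_l u l) = \sum_l sapply (e (enum_val k)) (u l).
  by apply: (big_morph (sapply (e (enum_val k)))); [exact: sapplyD | exact: sapply0].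
rewrite [LHS]E (bigD1 k) //= big1 ?addr0 => [|l lk].
  by apply/eigen1P.
have /eigen1P <- := uS l.
rewrite -sapplyM (oidM oe); case: eqP => [/enum_val_inj kl|_]; last exact: sapply0l.
by rewrite kl eqxx in lk.
Qed.

Lemma semisimple_degeneration (W : DRep G) : exists W' : DRep G,
  semisimple (drep_module W') /\ forall phi : inv_ring G, phi W' = phi W.
Proof.
pose p r := `[< exists (W' : DRep G) (J : finType) (e : J -> S) sigma,
   [/\ decomposes W' e sigma, forall phi : inv_ring G, phi W' = phi W &
      #|[pred i | e i != 0]| = r] >].
have exp : exists r, p r.
  eexists; apply/asboolP; exists W, unit, (fun _ => 1), id; split=> //; split.
    split=> //; [by move=> [] []; rewrite mulr1 | by rewrite big_const cardT enumT /= unlock /= addr0 | ].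
    by move=> _; rewrite star1.
  by move=> _ a; rewrite sgam1 mul1mx mulmx1.
have pb r : p r -> (r <= dimV d)%N.
  move=> /asboolP[W' [J [e [sigma [[oe _] _ <-]]]]]; exact: nonzero_idem_bound oe.
case: (ex_maxnP exp pb) => r /asboolP[W' [J [e [sigma [de dW dr]]]]] rmax.
exists W'; split=> //; apply: (decomposition_semisimple de) => i ei.
have [oe eW] := de.
have ee : e i * e i = e i by rewrite (oidM oe) eqxx.
have es : star (e i) = e i \/ (e i * star (e i) = 0 /\ star (e i) * e i = 0).
  rewrite (oid_star oe); have [->|ni] := eqVneq (sigma i) i; [by left | right].
  by rewrite !(oidM oe) eq_sym (negPf ni).
have [//|[f sf]] := simple_or_splits (eW i) ee ei es.
have [W2 [J2 [e2 [s2 [de2 dW2]]]]] := refine_decomposition de sf.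
rewrite dr ltnNge => /negP[]; apply: rmax; apply/asboolP.
by exists W2, J2, e2, s2; split=> // phi; rewrite dW2.
Qed.

End SemisimpleDegeneration.

(** * Isomorphic points lie in one orbit *)

Section SquareRoot.
Variable C : numClosedFieldType.

(** Hensel lifting and interpolation in one induction, roots being allowed to repeat. If [c] is
    already a root of [q], the equation for [t] is linear, solvable since [p.[c] ^+ 2 = c] is not 0;
    otherwise [t] gives the new polynomial the value [sqrtC c] at [c]. *)
Lemma sqrt_X_mod (s : seq C) : 0 \notin s ->
  exists p : {poly C}, (\prod_(c <- s) ('X - c%:P) %| p ^+ 2 - 'X)%R.
Proof.
elim: s => [|c s IH]; first by exists 0; rewrite big_nil dvd1p.
rewrite inE negb_or eq_sym => /andP[c0 /IH[p]]; rewrite big_cons.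
set q := \prod_(_ <- _) _ => /dvdpP[r pr].
suff [t ht] : exists t, root (r + (2 * t) *: p + t ^+ 2 *: q) c.
  exists (p + t *: q).
  have -> : (p + t *: q) ^+ 2 - 'X = (r + (2 * t) *: p + t ^+ 2 *: q) * q.
    have -> : (p + t *: q) ^+ 2 - 'X = (p ^+ 2 - 'X) + (2 * t) *: p * q + t ^+ 2 *: q * q.
      by rewrite -!mul_polyC polyCM polyC_exp polyC_natr; ring.
    by rewrite pr !mulrDl.
  by rewrite dvdp_mul // dvdp_XsubCl.
have pc : p.[c] ^+ 2 - c = r.[c] * q.[c].
  by have /(congr1 (fun u : {poly C} => u.[c])) := pr; rewrite !hornerE.
have [qc|qc] := eqVneq q.[c] 0.
  have pc0 : p.[c] != 0.
    apply: contraNneq c0 => p0; move: pc; rewrite qc mulr0 p0 expr0n /= sub0r => /eqP.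
    by rewrite oppr_eq0.
  exists (- r.[c] / (2 * p.[c])); apply/rootP.
  rewrite !hornerD !hornerZ qc mulr0 addr0.
  by field.
exists ((sqrtC c - p.[c]) / q.[c]); apply/rootP; rewrite !hornerD !hornerZ.
apply: (mulfI qc); rewrite mulr0.
have -> : q.[c] * (r.[c] + 2 * ((sqrtC c - p.[c]) / q.[c]) * p.[c] +
     ((sqrtC c - p.[c]) / q.[c]) ^+ 2 * q.[c]) = r.[c] * q.[c] + (sqrtC c ^+ 2 - p.[c] ^+ 2).
  by field.
by rewrite -pc sqrtCK; ring.
Qed.

(** A square root that is a polynomial in [H] inherits what commutes with [H] and the forms for
    which [H] is self-adjoint. *)
Lemma mx_sqrt n (H : 'M[C]_n) : H \in unitmx -> exists K : 'M[C]_n, [/\ K *m K = H,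
  forall X, X *m H = H *m X -> X *m K = K *m X &
  forall Z, H^T *m Z = Z *m H -> K^T *m Z = Z *m K].
Proof.
case: n H => [|n] H Hu.
  by exists 0; split=> *; apply/matrixP => -[].
have [s cs] := closed_field_poly_normal (char_poly H).
rewrite (monicP (char_poly_monic H)) scale1r in cs.
have s0 : 0 \notin s.
  apply: contraTN Hu => s0; rewrite unitmxE unitfE negbK.
  have : root (char_poly H) 0 by rewrite cs root_prod_XsubC.
  rewrite -eigenvalue_root_char => /eigenvalueP[v vH v0].
  by apply/det0P; exists v; rewrite // vH scale0r.
have [p] := sqrt_X_mod s0; rewrite -cs => /dvdpP[r pr].
exists (horner_mx H p); split.
- apply/eqP; rewrite -subr_eq0 mulmxE -rmorphM -{2}[H]horner_mx_X -rmorphB /= -expr2 pr.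
  by rewrite rmorphM /= Cayley_Hamilton mulr0.
- by move=> X XH; apply: comm_mx_horner.
by move=> Z HZ; rewrite trmx_horner; apply: horner_mx_intertwine.
Qed.

End SquareRoot.

(** * Isometries from module isomorphisms *)

Section Orbits.
Variables (C : numClosedFieldType) (Q : smquiver) (G : smsetting C Q).
Local Notation d := (vdim G).
Local Notation V := (vspace_sum C d).
Local Notation S := (Sgam G).
Local Notation star := (@sstar C Q G : S -> S).

Lemma commutes_Dmx (W : rep C d) (s : S) a : commutes s W ->
  Dmx s *m opmx (arr_act W a) = opmx (arr_act W a) *m Dmx s.
Proof.
move=> sW; apply: mx_ext => x.
have lin := @arr_act_linear _ _ _ W a.
by rewrite -!mulmxA (opmxE lin) !DmxE (opmxE lin) sapply_arr_act.
Qed.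

Lemma Dmx_commutes (W : rep C d) (s : S) :
  (forall a, Dmx s *m opmx (arr_act W a) = opmx (arr_act W a) *m Dmx s) -> commutes s W.
Proof.
move=> sW a; apply/matrixP => i j.
have e x : sapply s (arr_act W a x) = arr_act W a (sapply s x).
  apply: (can_inj (@coordsK C Q d)).
  have lin := @arr_act_linear _ _ _ W a.
  by rewrite -DmxE -!(opmxE lin) mulmxA sW -mulmxA DmxE.
have := congr1 (fun x : V => x (qhead a) i 0) (e (vinj (delta_mx j 0))).
by rewrite /arr_act !sapply_vinj !vinj_in !mulmxA -!colE !mxE.
Qed.

Lemma commutes_inv (W : rep C d) (h hi : S) : h * hi = 1 -> hi * h = 1 ->
  commutes h W -> commutes hi W.
Proof.
move=> hhi hih hW a.
have h1 v : h v *m hi v = 1%:M by rewrite -sgamM hhi.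
have h2 v : hi v *m h v = 1%:M by rewrite -sgamM hih.
transitivity (hi (qhead a) *m (W a *m h (qtail a)) *m hi (qtail a)).
  by rewrite -!mulmxA h1 mulmx1.
by rewrite -hW !mulmxA h2 mul1mx.
Qed.

(** A module map commutes with the vertices, so it has no component between different summands. *)
Lemma mod_iso_sgam (W W' : DRep G) : DRep_isomorphic W W' ->
  exists f f' : S, [/\ f * f' = 1, f' * f = 1 &
    forall a, f (qhead a) *m W a = W' a *m f (qtail a)].
Proof.
move=> [h [h' hK h'K]].
have grad (M N : rep C d) (k : {linear repmod M -> repmod N}) :
    exists s : S, forall x : V, (k x : V) = sapply s x.
  have lk v : linear (fun x : V => (k x : V) v : 'cV[C]_(d v)).
    move=> c x y; rewrite -[c *: x](scalar_act (W := M)).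
    by rewrite linearP (scalar_act (W := N)).
  pose s v := projT1 (cid (linear_vinj (lk v))).
  have sP v x : (k x : V) v = \sum_w s v w *m x w by rewrite /s; case: cid => t /= ->.
  exists (fun v => s v v) => x; apply: Defs.vspaceP => v.
  have -> : (k x : V) v = (k (vert_act v x : repmod M) : V) v.
    by rewrite -(velt_act (W := M)) linearZ /= velt_act /vert_act vinj_in.
  rewrite sP (bigD1 v) //= /vert_act vinj_in big1 ?addr0 // => w wv.
  by rewrite vinj_out 1?eq_sym // mulmx0.
have [f hf] := grad _ _ h.
have lh' : linear (h' : drep_module W' -> drep_module W).
  by move=> c x y; apply: (can_inj hK); rewrite linearP !h'K.
pose gl := GRing.isLinear.Build _ _ _ _ h' lh'.
pose k' : {linear drep_module W' -> drep_module W} := HB.pack h' gl.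
have [f' hf'] := grad _ _ k'.
exists f, f'; split.
- by apply: sapply_inj => x; rewrite sapplyM sapply1 -hf' -hf; exact: h'K.
- by apply: sapply_inj => x; rewrite sapplyM sapply1 -hf -hf'; exact: hK.
move=> a; apply/matrixP => i j.
have : h (aelt C a *: (vinj (delta_mx j 0) : drep_module W)) =
    aelt C a *: h (vinj (delta_mx j 0) : drep_module W) by rewrite linearZ.
rewrite !aelt_act !hf => /(congr1 (fun x : V => x (qhead a) i 0)).
by rewrite /arr_act !sapply_vinj !vinj_in !mulmxA -!colE !mxE.
Qed.

Lemma iso_same_orbit (W W' : DRep G) : DRep_isomorphic W W' ->
  exists g : DGL G, forall a, W' a = dact g W a.
Proof.
move=> /mod_iso_sgam[f [f' [ff' f'f fW]]].
pose h := star f * f; pose hi := f' * star f'.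
have hhi : h * hi = 1 by rewrite /h /hi mulrA -(mulrA _ f) ff' mulr1 -starM f'f star1.
have hih : hi * h = 1 by rewrite /h /hi mulrA -(mulrA f') -starM ff' star1 mulr1.
have sh : star h = h by rewrite starM starK.
have hW : commutes h W.
  (* [W' = f W f'] is fixed by the involution, which gives a second expression of [W']; comparing
     the two makes [h] commute with the arrows. *)
  have e : (drep_val W' : rep C d) = lract f W f'.
    apply: functional_extensionality_dep => a.
    by rewrite /lract fW -mulmxA -sgamM ff' sgam1 mulmx1.
  have e' : (drep_val W' : rep C d) = lract (star f') W (star f).
    apply: functional_extensionality_dep => a.
    by rewrite -[LHS]drepP e mstar_lract.
  have q v : star f v *m star f' v = 1%:M by rewrite -sgamM -starM f'f star1 sgam1.
  by move=> a; rewrite /h !sgamM -mulmxA fW e' /lract !mulmxA q mul1mx.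
have Hu : Dmx h \in unitmx.
  by have := congr1 (@Dmx _ _ G) hhi; rewrite DmxM Dmx1 => /mulmx1_unit[].
have [K [KK Kc Kt]] := mx_sqrt Hu.
have [k Kk] : exists k : S, K = Dmx k.
  by apply: comm_DmxP => v; rewrite (Kc (Emx G v)) // Dmx_comm.
have kk : k * k = h by apply: (@Dmx_inj _ _ G); rewrite DmxM -Kk.
have sk : star k = k.
  apply: (@Dmx_inj _ _ G); rewrite -Kk; apply: (can_inj (mulKmx (gram_unit G))).
  by rewrite -Dmx_star -Kk; apply: Kt; rewrite Dmx_star -/(star h) sh.
have kh : k * h = h * k by rewrite -kk mulrA.
have kW : commutes k W.
  apply: Dmx_commutes => a; rewrite -Kk; apply: esym; apply: Kc.
  by rewrite commutes_Dmx.
have hiW : commutes hi W by exact: commutes_inv hhi hih hW.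
(* [k * hi] is the inverse square root of [h]. *)
pose g : S := f * (k * hi).
have shi : star hi = hi by rewrite starM starK.
have gg : star g * g = 1.
  transitivity (hi * (k * h) * (k * hi)).
    by rewrite /g (starM f) (starM k) sk shi /h !mulrA.
  have cancel (x y z : S) : y * x = 1 -> z * z = x -> x * y = 1 -> y * (x * z) * (z * y) = 1.
    by move=> yx zz xy; rewrite !mulrA yx mul1r zz.
  by rewrite kh; exact: cancel hih kk hhi.
have gg' : g * star g = 1.
  apply: (@Dmx_inj _ _ G); rewrite DmxM Dmx1; apply: mulmx1C.
  by rewrite -DmxM gg Dmx1.
exists (@MkDGL _ _ _ g (fun v => congr1 (fun s : S => s v) gg')) => a /=.
have gW : g (qhead a) *m W a = W' a *m g (qtail a).
  by rewrite /g sgamM -mulmxA (commutesM kW hiW) mulmxA fW -mulmxA.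
by rewrite gW -mulmxA -sgamM gg' sgam1 mulmx1.
Qed.

End Orbits.

(** * Regular functions and traces *)

Section RegularFunctions.
Variables (F : fieldType) (Q : smquiver) (G : smsetting F Q).
Local Notation d := (vdim G).
Local Notation V := (vspace_sum F d).
Local Notation rep := (rep F d).
Import mpoly.

Definition rep_coord (W : rep) (i : 'I_#|{: Defs.coord G}|) : F :=
  W (tag (enum_val i)) (tagged (enum_val i)).1 (tagged (enum_val i)).2.

(** Regularity on the whole of [rep]: the point given by the Nullstellensatz is at first only there,
    and the equations of [DRep] are tested on it. *)
Definition regular_rep (f : rep -> F) : Prop :=
  exists p : mpoly #|{: Defs.coord G}| F, forall W, f W = meval (rep_coord W) p.

Lemma regular_of_rep (f : rep -> F) : regular_rep f -> regular (fun W : DRep G => f W).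
Proof. by move=> [p fp]; exists p => W; rewrite fp. Qed.

Lemma regular_rep_ext f f' : regular_rep f -> f =1 f' -> regular_rep f'.
Proof. by move=> [p fp] e; exists p => W; rewrite -e. Qed.

Lemma regular_repC c : regular_rep (fun=> c).
Proof. by exists (mpolyC _ c) => W; rewrite mevalC. Qed.

Lemma regular_repD f f' : regular_rep f -> regular_rep f' -> regular_rep (fun W => f W + f' W).
Proof. by move=> [p fp] [q fq]; exists (p + q) => W; rewrite mevalD fp fq. Qed.

Lemma regular_repM f f' : regular_rep f -> regular_rep f' -> regular_rep (fun W => f W * f' W).
Proof. by move=> [p fp] [q fq]; exists (p * q) => W; rewrite mevalM fp fq. Qed.

Lemma regular_rep_sum (I : Type) (r : seq I) (f : I -> rep -> F) :
  (forall i, regular_rep (f i)) -> regular_rep (fun W => \sum_(i <- r) f i W).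
Proof.
move=> rf; elim: r => [|i r IH].
  by apply: regular_rep_ext (regular_repC 0) _ => W; rewrite big_nil.
by apply: regular_rep_ext (regular_repD (rf i) IH) _ => W; rewrite big_cons.
Qed.

Lemma regular_rep_entry a i j : regular_rep (fun W => W a i j).
Proof.
exists 'X_(enum_rank (Tagged (fun a => ('I_(d (qhead a)) * 'I_(d (qtail a)))%type) (i, j) : Defs.coord G)) => W.
by rewrite mevalXU /rep_coord enum_rankK.
Qed.

Definition regular_vec (x : rep -> V) : Prop := forall v i, regular_rep (fun W => x W v i 0).

Lemma regular_vinj (v : vert Q) (y : rep -> 'cV[F]_(d v)) : (forall i, regular_rep (fun W => y W i 0)) ->
  regular_vec (fun W => vinj (y W)).
Proof.
move=> ry w i; have [e|vw] := eqVneq v w.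
  case: _ / e i => i.
  by apply: regular_rep_ext (ry i) _ => W; rewrite vinj_in.
by apply: regular_rep_ext (regular_repC 0) _ => W; rewrite vinj_out // mxE.
Qed.

Lemma regular_arr_act a x : regular_vec x -> regular_vec (fun W => arr_act W a (x W)).
Proof.
move=> rx; apply: regular_vinj => i.
have h : regular_rep (fun W => \sum_j W a i j * x W (qtail a) j 0).
  by apply: regular_rep_sum => j; apply: regular_repM => //; exact: regular_rep_entry.
by apply: regular_rep_ext h _ => W; rewrite mxE.
Qed.

Lemma regular_path_act (x : V) p : regular_vec (fun W => path_act W x p).
Proof.
rewrite /path_act; move: (val p) => [v s] /=.
elim: s => [|a s IH] /=; last exact: regular_arr_act.
by apply: regular_vinj => i; exact: regular_repC.
Qed.

Lemma regular_opmx (L : rep -> V -> V) i j :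
  (forall x, regular_vec (fun W => L W x)) -> regular_rep (fun W => opmx (L W) i j).
Proof.
move=> rL; have := rL (uncoords (delta_mx j 0)) (tag (enum_val i)) (tagged (enum_val i)).
by move/regular_rep_ext; apply => W; rewrite !mxE.
Qed.

Lemma regular_mstar (a : arr Q) i j : regular_rep (fun W => mstar W a i j).
Proof.
have rs m n p (A : rep -> 'M[F]_(m, n)) (B : rep -> 'M[F]_(n, p)) :
    (forall i j, regular_rep (fun W => A W i j)) -> (forall i j, regular_rep (fun W => B W i j)) ->
    forall i j, regular_rep (fun W => (A W *m B W) i j).
  move=> rA rB k l.
  have h : regular_rep (fun W => \sum_t A W k t * B W t l).
    by apply: regular_rep_sum => t; apply: regular_repM.
  by apply: regular_rep_ext h _ => W; rewrite mxE.
pose c : F := (sgn a * eps (qtail a))%:~R.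
have h : regular_rep (fun W => c * (invmx (gamc G (qhead a)) *m (mphi W a)^T *m gamc G (qtail a)) i j).
  apply: regular_repM; first exact: regular_repC.
  apply: (rs _ _ _ (fun W => invmx (gamc G (qhead a)) *m (mphi W a)^T)); last by move=> *; exact: regular_repC.
  apply: (rs _ _ _ (fun=> invmx (gamc G (qhead a))) (fun W => (mphi W a)^T)).
    by move=> *; exact: regular_repC.
  move=> k l; have := @regular_rep_entry (phi1 a).
  move=> re; apply: regular_rep_ext (re _ _) _ => W; rewrite mxE /mphi castmxE //.
by apply: regular_rep_ext h _ => W; rewrite mstarE [RHS]mxE.
Qed.

End RegularFunctions.

(** * Traces of paths as invariant functions *)

Section Traces.
Variables (F : fieldType) (Q : smquiver) (G : smsetting F Q).
Local Notation d := (vdim G).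
Local Notation V := (vspace_sum F d).
Local Notation S := (Sgam G).

Lemma dgl_starl (g : DGL G) : (sstar g : S) * (g : S) = 1.
Proof.
have gg : (g : S) * (sstar g : S) = 1 by apply: SgamP => v; exact: dglP.
apply: (@Dmx_inj _ _ G); rewrite DmxM Dmx1; apply: mulmx1C.
by rewrite -DmxM gg Dmx1.
Qed.

Lemma path_act_dact (g : DGL G) (W : DRep G) (x : V) p :
  path_act (dact g W) (sapply g x) p = sapply g (path_act W x p).
Proof.
rewrite /path_act; move: (val p) => [v s] /=; elim: s => [|a s IH] /=.
  by rewrite /vert_act sapply_vinj.
rewrite IH /arr_act sapply_vinj; congr vinj; rewrite /= /sapply.
have h v' : sstar g v' *m g v' = 1%:M by rewrite -[LHS]/(((sstar g : S) * (g : S)) v') dgl_starl.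
by rewrite -!mulmxA (mulmxA (sstar g _)) h mul1mx.
Qed.

Definition actmx (W : rep F d) (c : pathalg F Q) : 'M[F]_(dimV d) :=
  opmx (fun x : V => (c *: (x : repmod W) : V)).

Lemma act_linear (W : rep F d) c : linear (fun x : V => (c *: (x : repmod W) : V)).
Proof. exact: linext_path_act_linear. Qed.

Lemma actmxE (W : rep F d) c x : actmx W c *m coords x = coords (c *: (x : repmod W) : V).
Proof. by rewrite opmxE //; exact: act_linear. Qed.

Lemma actmxM W c c' : actmx W (c * c') = actmx W c *m actmx W c'.
Proof. by apply: mx_ext => x; rewrite -mulmxA !actmxE -scalerA. Qed.

Lemma actmx1 W : actmx W 1 = 1%:M.
Proof. by apply: mx_ext => x; rewrite actmxE scale1r mul1mx. Qed.

Lemma actmxL W a c c' : actmx W (a *: c + c') = a *: actmx W c + actmx W c'.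
Proof.
apply: mx_ext => x; rewrite mulmxDl -scalemxAl !actmxE -linearP; congr coords.
exact: repmod_scaleZDl.
Qed.

Definition path_trace p (W : DRep G) : F^o := \tr (actmx W (pelt F p)).

Lemma path_trace_inv p : path_trace p \in @reg_inv F Q G.
Proof.
apply/asboolP; split.
  apply: (@regular_of_rep _ _ _ (fun W => \tr (actmx W (pelt F p)))).
  apply: regular_rep_sum => i; apply: regular_opmx => x v j.
  have := @regular_path_act F Q G x p v j; move/regular_rep_ext; apply => W.
  by rewrite -[_ *: _]/(linext _ _) linext_pelt.
move=> g W; rewrite /path_trace.
have gg : (g : S) * (sstar g : S) = 1 by apply: SgamP => v; exact: dglP.
have e : actmx (dact g W) (pelt F p) *m Dmx (g : S) = Dmx (g : S) *m actmx W (pelt F p).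
  apply: mx_ext => x; rewrite -!mulmxA DmxE !actmxE DmxE; congr coords.
  have pa (M : rep F d) (y : V) : (pelt F p *: (y : repmod M) : V) = path_act M y p.
    exact: linext_pelt.
  by rewrite !pa path_act_dact.
rewrite -[actmx (dact g W) _]mulmx1 -(Dmx1 G) -gg DmxM mulmxA e.
by rewrite -mulmxA mxtrace_mulC -mulmxA -DmxM dgl_starl Dmx1 mulmx1.
Qed.

Lemma same_quot_trace (W W' : DRep G) : quot_map W =1 quot_map W' ->
  forall c, \tr (actmx W c) = \tr (actmx W' c).
Proof.
move=> qW; apply: (@pathalg_ext F Q F^o) => [a c c'|a c c'|p].
- by rewrite actmxL mxtraceD mxtraceZ.
- by rewrite actmxL mxtraceD mxtraceZ.
exact: (qW (InvRing (path_trace_inv p))).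
Qed.

End Traces.

(** * Complete reducibility of semisimple modules *)

Section SemisimpleModules.
Variables (F : numFieldType) (Q : smquiver) (G : smsetting F Q).
Local Notation d := (vdim G).
Local Notation V := (vspace_sum F d).
Variable W : rep F d.
Local Notation M := (repmod W).

Definition row_of (x : V) : 'rV[F]_(dimV d) := (coords x)^T.
Definition of_row (u : 'rV[F]_(dimV d)) : V := uncoords u^T.

Lemma row_ofK : cancel row_of of_row.
Proof. by move=> x; rewrite /of_row trmxK coordsK. Qed.

Lemma of_rowK : cancel of_row row_of.
Proof. by move=> u; rewrite /row_of uncoordsK trmxK. Qed.

Lemma row_ofL a x y : row_of (a *: x + y) = a *: row_of x + row_of y.
Proof. by rewrite /row_of linearP linearP. Qed.

Lemma row_ofD (x y : M) : row_of (x + y : M) = row_of x + row_of y.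
Proof. by have := row_ofL 1 (x : V) (y : V); rewrite !scale1r. Qed.

Lemma row_of_act (c : pathalg F Q) (x : M) : row_of (c *: x : M) = row_of x *m (actmx W c)^T.
Proof. by rewrite /row_of -actmxE trmx_mul. Qed.

(* Row vectors are acted upon from the right, by the transposed matrices. *)
Definition act_alg (X : 'M[F]_(dimV d)) : Prop := exists c, X = (actmx W c)^T.

Lemma submod_scale (T : {pred M}) (c : pathalg F Q) (x : M) : submod_closed T -> x \in T -> c *: x \in T.
Proof. by move=> [T0 TL] Tx; rewrite -[_ *: _]addr0; apply: TL. Qed.

Lemma submodD (T : {pred M}) (x y : M) : submod_closed T -> x \in T -> y \in T -> x + y \in T.
Proof. by move=> [T0 TL] Tx Ty; rewrite -[x]scale1r; apply: TL. Qed.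

Definition row_pred (U : 'M[F]_(dimV d)) : {pred M} := fun x => (row_of x <= U)%MS.

Lemma row_predE U x : (x \in row_pred U) = (row_of x <= U)%MS.
Proof. by []. Qed.

Lemma stable_mx_submod (U : 'M[F]_(dimV d)) : stable_under act_alg U -> submod_closed (row_pred U).
Proof.
move=> sU; split; first by rewrite row_predE /row_of linear0 trmx0 sub0mx.
move=> c x y; rewrite !row_predE => xU yU.
rewrite row_ofD; apply: addmx_sub => //; rewrite row_of_act.
by apply: submx_trans (sU _ (ex_intro _ c erefl)); exact: submxMr.
Qed.

Lemma submod_stable_mx (T : {pred M}) : submod_closed T ->
  exists2 U : 'M[F]_(dimV d), stable_under act_alg U &
    forall x : M, x \in T <-> (row_of x <= U)%MS.
Proof.
move=> Tc; have [T0 TL] := Tc.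
have [|a u v Tu Tv|U HU] := @subspace_mx _ _ (fun u => (of_row u : M) \in T).
- by rewrite /of_row trmx0 linear0.
- have -> : of_row (a *: u + v) = a *: (of_row u : V) + of_row v :> V by rewrite /of_row !linearP.
  by rewrite -(scalar_act (W := W)); apply: TL.
exists U; last by move=> x; rewrite -HU row_ofK.
move=> _ [c ->]; apply/row_subP => i; rewrite row_mul.
have /HU h : (row i U <= U)%MS by exact: row_sub.
rewrite -[row i U]of_rowK -row_of_act; apply/HU; rewrite row_ofK.
exact: submod_scale.
Qed.

(** Take a maximal set [J] of simple summands whose sum meets [U] in 0. By maximality, any other
    summand [S k] meets the sum of [U] and the [J]-part nontrivially, and being simple it lies in
    it. *)
Lemma semisimple_reducible : semisimple M -> completely_reducible act_alg.
Proof.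
move=> [n [S [simpS decS]]] U sU.
pose PU := row_pred U.
pose sumJ (J : {set 'I_n}) (x : M) := exists2 u : 'I_n -> M, forall k, u k \in S k & x = \sum_(k in J) u k.
have Sc k : submod_closed (S k) by case: (simpS k).
have S0 k : 0 \in S k by case: (Sc k).
pose PJ J : {pred M} := fun x => `[< sumJ J x >].
have PJc J : submod_closed (PJ J).
  split; first by apply/asboolP; exists (fun=> 0) => //; rewrite big1.
  move=> c x y /asboolP[u uS ->] /asboolP[v vS ->]; apply/asboolP.
  exists (fun k => c *: u k + v k); first by move=> k; case: (Sc k) => _; apply.
  by rewrite scaler_sumr -big_split.
pose good (J : {set 'I_n}) := `[< forall x, x \in PU -> x \in PJ J -> x = 0 >].
have good0 : good finset.set0.
  by apply/asboolP => x _ /asboolP[u _ ->]; rewrite big_set0.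
have [J /maxsetP[/asboolP gJ Jmax] _] := maxset_exists good0.
have [V0 sV0 HV] := submod_stable_mx (PJc J).
exists V0 => //.
have disj : (U :&: V0 = 0)%MS.
  apply/eqP/rowV0P => v; rewrite sub_capmx -[v]of_rowK => /andP[vU vV].
  have -> : (of_row v : M) = 0 by apply: gJ; [exact: vU | apply/HV].
  by rewrite /row_of linear0 trmx0.
split=> //; apply/eqmxP; rewrite submx1; apply/row_subP => i.
have UV : submod_closed (row_pred (U + V0)%MS).
  apply: stable_mx_submod => X AX; rewrite addsmxMr.
  by apply: addsmxS; [exact: sU | exact: sV0].
rewrite -[row i _]of_rowK; move: (of_row _) => x.
have [u [[uS xu] _]] := decS x.
suff h k y : y \in S k -> (row_of y <= U + V0)%MS.
  rewrite xu; elim/big_rec: _ => [|k y _ IH]; first by case: UV.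
  by apply: (submodD UV) => //; apply: h.
move=> Sy; have [kJ|kJ] := boolP (k \in J).
  apply: submx_trans (addsmxSr _ _); apply/HV/asboolP.
  exists (fun l => if l == k then y else 0); first by move=> l; case: eqP => [->|].
  by rewrite (bigD1 k) //= eqxx big1 ?addr0 // => l /andP[_ /negPf->].
have : ~ good (k |: J).
  move=> g; have e := Jmax _ g (finset.subsetUr _ _); move: kJ.
  by rewrite -e !inE eqxx.
move=> ng; have : ~ forall x, x \in PU -> x \in PJ (k |: J) -> x = 0.
  by move=> g; apply: ng; apply/asboolP.
move=> /existsNP[z /not_implyP[zU /not_implyP[/asboolP[v vS zv] z0]]].
have zE : z = v k + \sum_(l in J) v l by rewrite zv big_setU1.
have svJ : (row_of (\sum_(l in J) v l : M)%R <= V0)%MS by apply/HV/asboolP; exists v.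
have vk0 : v k != 0.
  apply/negP => /eqP vk; apply: z0; apply: gJ => //; apply/asboolP.
  by exists v => //; rewrite zE vk add0r.
have vkUV : (row_of (v k) <= U + V0)%MS.
  have -> : v k = (-1) *: (\sum_(l in J) v l : V) + z :> V.
    by rewrite zE scaleN1r addrC addrK.
  rewrite row_ofL; apply: addmx_sub.
    by apply: scalemx_sub; apply: submx_trans svJ (addsmxSr _ _).
  by apply: submx_trans (addsmxSl _ _).
pose T : {pred M} := fun x => (x \in S k) && (row_of x <= U + V0)%MS.
have Tc : submod_closed T.
  case: (Sc k) (UV) => h1 h2 [h3 h4]; split; first by apply/andP.
  by move=> c a b /andP[a1 a2] /andP[b1 b2]; apply/andP; split; [apply: h2 | apply: h4].
have [_ _ /(_ T Tc)] := simpS k.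
case; first by move=> a /andP[].
  move=> T0; case/negP: vk0; have vT : v k \in T by apply/andP.
  exact: (T0 _ vT).
by move=> /(_ y Sy) /andP[].
Qed.

End SemisimpleModules.

(** * Semisimple points with equal invariants are isomorphic *)

Section IsoFromTraces.
Variables (F : numFieldType) (Q : smquiver) (G : smsetting F Q).
Local Notation d := (vdim G).

Lemma same_quot_iso (W W' : DRep G) : semisimple (drep_module W) -> semisimple (drep_module W') ->
  quot_map W =1 quot_map W' -> DRep_isomorphic W W'.
Proof.
move=> ssW ssW' qW.
pose P X Y := exists c, X = (actmx W c)^T /\ Y = (actmx W' c)^T.
have mP : matrix_algebra P.
  split.
  - by exists 1; rewrite !actmx1 trmx1.
  - move=> a X Y X' Y' [c [-> ->]] [c' [-> ->]]; exists (a *: c + c').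
    by rewrite !actmxL !linearP.
  (* Transposition reverses products, hence [c' * c]. *)
  - move=> X Y X' Y' [c [-> ->]] [c' [-> ->]]; exists (c' * c).
    by rewrite !actmxM !trmx_mul.
have redE (A B : 'M[F]_(dimV d) -> Prop) : (forall X, A X <-> B X) ->
    completely_reducible A -> completely_reducible B.
  move=> AB rA U sU; have [|D sD sup] := rA U; first by move=> X /AB/sU.
  by exists D => // X /AB/sD.
have red1 : completely_reducible (left_alg P).
  apply: redE (semisimple_reducible ssW) => X; split; first by move=> [c ->]; exists (actmx W' c)^T, c.
  by move=> [Y [c [-> _]]]; exists c.
have red2 : completely_reducible (right_alg P).
  apply: redE (semisimple_reducible ssW') => X; split; first by move=> [c ->]; exists (actmx W c)^T, c.
  by move=> [Y [c [_ ->]]]; exists c.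
have trP X Y : P X Y -> \tr X = \tr Y.
  by move=> [c [-> ->]]; rewrite !mxtrace_tr; exact: same_quot_trace.
have [f [g [fg gf fP]]] := same_trace_iso mP red1 red2 trP.
pose h (x : drep_module W) : drep_module W' := of_row (row_of x *m f).
have lh : linear h.
  move=> c x y; apply: (can_inj (@row_ofK F Q G)).
  rewrite row_ofD row_of_act !of_rowK row_ofD row_of_act mulmxDl -!mulmxA.
  by rewrite (fP _ _ (ex_intro _ c (conj erefl erefl))).
pose gl := GRing.isLinear.Build _ _ _ _ h lh.
pose k : {linear drep_module W -> drep_module W'} := HB.pack h gl.
exists k; exists (fun y : drep_module W' => of_row (row_of y *m g) : drep_module W) => x.
  by rewrite /= /h of_rowK -mulmxA fg mulmx1 row_ofK.
by rewrite /= /h of_rowK -mulmxA gf mulmx1 row_ofK.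
Qed.

End IsoFromTraces.

(** * Points of the quotient *)

Section Reductive.
Local Open Scope sesquilinear_scope.
Variables (C : numClosedFieldType) (Q : smquiver) (G : smsetting C Q).
Local Notation d := (vdim G).
Local Notation V := (vspace_sum C d).
Local Notation S := (Sgam G).
Local Notation N := (dimV d).
Local Notation star := (@sstar C Q G : S -> S).

Lemma selfadjoint_isometries_any n (Z eps : 'M[C]_n) : Z \in unitmx -> Z^T = Z *m eps ->
  eps *m eps = 1%:M -> eps^T = eps -> eps ^t* = eps ->
  exists2 b : 'M[C]_n, b \in unitmx &
    forall X, X^T *m Z *m X = Z -> X *m eps = eps *m X ->
    exists Y, [/\ Y^T *m Z *m Y = Z, b *m Y *m invmx b = (b *m X *m invmx b) ^t* &
      forall E, E ^t* = E -> E *m (Z ^t* *m Z) = Z ^t* *m Z *m E -> X *m E = E *m X -> Y *m E = E *m Y].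
Proof.
case: n Z eps => [|n] Z eps; last exact: selfadjoint_isometries.
move=> *; exists 1%:M; first exact: unitmx1.
by move=> X *; exists X; split=> *; apply/matrixP => -[].
Qed.

Lemma epsmx_coords (x : V) : epsmx G *m coords x = coords (fun v => (eps v)%:~R *: x v : 'cV[C]_(d v)).
Proof. by rewrite mul_diag_mx; apply/colP => i; rewrite !mxE. Qed.

Lemma Dmx_epsmx (s : S) : Dmx s *m epsmx G = epsmx G *m Dmx s.
Proof.
apply: mx_ext => x; rewrite -!mulmxA DmxE !epsmx_coords DmxE; congr coords.
by apply: Defs.vspaceP => v; rewrite /sapply scalemxAr.
Qed.

(** The form pairs the summand of [v] with that of [phi0 v]. As a consequence each vertex projection
    commutes with the product of the adjoint of [gram G] and [gram G]. *)
Lemma gram_Emx v : gram G *m Emx G v = Emx G (phi0 v) *m gram G.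
Proof.
have ET w : (Emx G w)^T = Emx G w by rewrite Emx_diag tr_diag_mx.
apply: gram_ext => x y.
have <- : gform x (vert_act v y) = ((coords x)^T *m (gram G *m Emx G v) *m coords y) 0 0.
  by rewrite gramE -EmxE !mulmxA.
have <- : gform (vert_act (phi0 v) x) y = ((coords x)^T *m (Emx G (phi0 v) *m gram G) *m coords y) 0 0.
  by rewrite gramE -EmxE trmx_mul ET !mulmxA.
rewrite -(velt_act (W := rep0 G)) -(velt_act (W := rep0 G)) (mixed_adj (gform_mixed (rep0 G))).
by rewrite star_velt phi0K.
Qed.

(** [DGL] is the group of graded isometries. The clause on [E] in [selfadjoint_isometries], applied
    to the vertex projections, keeps the adjoint isometry graded. *)
Lemma dgl_adjoint : exists2 b : 'M[C]_N, b \in unitmx &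
  forall g : DGL G, exists g' : DGL G,
    b *m Dmx (g' : S) *m invmx b = (b *m Dmx (g : S) *m invmx b) ^t*.
Proof.
have eps_real v : Num.conj ((eps v)%:~R : C) = (eps v)%:~R by rewrite rmorph_int.
have [|||b bu H] := @selfadjoint_isometries_any _ _ (epsmx G) (gram_unit G) (gram_tr G).
- apply: mx_ext => x; rewrite -mulmxA !epsmx_coords mul1mx; congr coords.
  by apply: Defs.vspaceP => v; rewrite scalerA epsM scale1r.
- exact: tr_diag_mx.
- rewrite tr_diag_mx map_diag_mx; congr diag_mx; apply/rowP => i.
  by rewrite !mxE; exact: eps_real.
exists b => // g.
have iso (s : S) : star s * s = 1 <-> (Dmx s)^T *m gram G *m Dmx s = gram G.
  rewrite Dmx_star -mulmxA -DmxM; split=> [->|e]; first by rewrite Dmx1 mulmx1.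
  by apply: (@Dmx_inj _ _ G); rewrite Dmx1 -[LHS](mulKmx (gram_unit G)) e mulVmx ?gram_unit.
have [Y [YZ Yb YE]] := H (Dmx (g : S)) ((iso _).1 (dgl_starl g)) (Dmx_epsmx _).
have Eh v : (Emx G v) ^t* = Emx G v.
  rewrite Emx_diag tr_diag_mx map_diag_mx; congr diag_mx; apply/rowP => i.
  by rewrite !mxE rmorph_nat.
have [s Ys] : exists s : S, Y = Dmx s.
  apply: comm_DmxP => v; apply: YE => //; last exact: Dmx_comm.
  have e : Emx G v *m gram G ^t* = gram G ^t* *m Emx G (phi0 v).
    by rewrite -{1}(Eh v) -{1}(Eh (phi0 v)) -!map_mxM -!trmx_mul gram_Emx.
  by rewrite mulmxA e -!mulmxA gram_Emx.
have ss : star s * s = 1 by apply/iso; rewrite -Ys.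
have ss' : s * star s = 1.
  apply: (@Dmx_inj _ _ G); rewrite DmxM Dmx1; apply: mulmx1C.
  by rewrite -DmxM ss Dmx1.
exists (@MkDGL _ _ _ s (fun v => congr1 (fun s : S => s v) ss')).
by rewrite /= -Ys.
Qed.

(** Entries of the full matrices of the arrows on [V], since the change of basis [b] acts on all of
    [V]; [None] is the constant coordinate. *)
Definition coord_index := option (arr Q * ('I_N * 'I_N)).

Variable b : 'M[C]_N.

Definition arrmx (W : rep C d) a : 'M[C]_N := b *m opmx (arr_act W a) *m invmx b.

(* The constant coordinate 1 turns polynomials of bounded degree into tensors of one degree. *)
Definition xvec (W : rep C d) : 'cV[C]_#|{: coord_index}| :=
  \col_j if enum_val j is Some (a, (i, k)) then arrmx W a i k else 1.

(** The map sending each arrow matrix [A] to [X A X'], written on entries: one Kronecker block per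
    arrow, and 1 on the constant coordinate. *)
Definition conj_mx (X X' : 'M[C]_N) : 'M[C]_#|{: coord_index}| :=
  \matrix_(j, l) match enum_val j, enum_val l with
    | Some (a, (i, k)), Some (a', (i', k')) => (a == a')%:R * (X i i' * X' k' k)
    | None, None => 1
    | _, _ => 0
    end.

Definition dglmx (g : DGL G) : 'M[C]_N := b *m Dmx (g : S) *m invmx b.
Definition dglmxV (g : DGL G) : 'M[C]_N := b *m Dmx (star g) *m invmx b.

Hypothesis bu : b \in unitmx.

Lemma conj_mul (X Y : 'M[C]_N) :
  (b *m X *m invmx b) *m (b *m Y *m invmx b) = b *m (X *m Y) *m invmx b.
Proof. by rewrite !mulmxA -(mulmxA (b *m X) (invmx b) b) mulVmx // mulmx1. Qed.

Lemma dglmxVK g : dglmx g *m dglmxV g = 1%:M.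
Proof.
have gg : (g : S) * star g = 1 by apply: SgamP => v; exact: dglP.
by rewrite /dglmx /dglmxV conj_mul -DmxM gg Dmx1 mulmx1 mulmxV.
Qed.

Lemma arrmx_dact g (W : DRep G) a : arrmx (dact g W) a = dglmx g *m arrmx W a *m dglmxV g.
Proof.
rewrite /dglmx /dglmxV /arrmx.
have -> : opmx (arr_act (dact g W) a) = Dmx (g : S) *m opmx (arr_act W a) *m Dmx (star g).
  apply: mx_ext => x.
  have lin M := @arr_act_linear C Q d M a.
  rewrite -!mulmxA (opmxE (lin _)) DmxE (opmxE (lin _)) DmxE; congr coords.
  by rewrite /arr_act sapply_vinj /= !mulmxA.
by rewrite !conj_mul !mulmxA.
Qed.

Lemma big_option_sum (T : finType) (f : option T -> C) :
  \sum_o f o = f None + \sum_t f (Some t).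
Proof.
rewrite (bigD1 None) //=; congr (_ + _).
rewrite (reindex_omap Some id) /=; last by case.
by apply: eq_bigl => t; rewrite eqxx.
Qed.

Lemma xvec_dact g (W : DRep G) : xvec (dact g W) = conj_mx (dglmx g) (dglmxV g) *m xvec W.
Proof.
apply/colP => j; rewrite !mxE.
rewrite (reindex (@enum_rank _)) /=; last by exists enum_val => l _; rewrite ?enum_rankK ?enum_valK.
under eq_bigr do rewrite !mxE enum_rankK.
rewrite big_option_sum; case: (enum_val j) => [[a [i k]]|]; last first.
  by rewrite mulr1 big1 ?addr0 // => -[a [i k]] _; rewrite mul0r.
rewrite mul0r add0r arrmx_dact.
transitivity (\sum_a' \sum_p (a == a')%:R * (dglmx g i p.1 * dglmxV g p.2 k) * arrmx W a' p.1 p.2).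
  rewrite (bigD1 a) //= [X in _ + X]big1 ?addr0 => [|a' aa']; last first.
    by apply: big1 => p _; rewrite eq_sym (negPf aa') !mul0r.
  rewrite eqxx -(pair_bigA _ (fun i' k' => 1 * (dglmx g i i' * dglmxV g k' k) * arrmx W a i' k')) /=.
  rewrite exchange_big mxE; apply: eq_bigr => k' _; rewrite mxE mulr_suml.
  by apply: eq_bigr => i' _; rewrite mul1r mulrAC.
rewrite pair_bigA; apply: eq_bigr => -[a' [i' k']] _ //.
Qed.

Lemma conj_mx_adj (g g' : DGL G) : dglmx g' = (dglmx g) ^t* ->
  conj_mx (dglmx g') (dglmxV g') = (conj_mx (dglmx g) (dglmxV g)) ^t*.
Proof.
move=> e.
have eV : dglmxV g' = (dglmxV g) ^t*.
  have h : (dglmx g) ^t* *m (dglmxV g) ^t* = 1%:M.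
    by rewrite -map_mxM -trmx_mul (mulmx1C (dglmxVK g)) trmx1 map_mx1.
  have u : (dglmx g) ^t* \in unitmx by case/mulmx1_unit: h.
  by apply: (can_inj (mulKmx u)); rewrite h -e dglmxVK.
apply/matrixP => j l; rewrite !mxE.
case: (enum_val j) => [[a [i k]]|]; case: (enum_val l) => [[a' [i' k']]|];
  rewrite ?rmorph0 ?rmorph1 //.
by rewrite !rmorphM rmorph_nat eq_sym e eV !mxE.
Qed.

Lemma xvec_const W : xvec W (enum_rank (None : coord_index)) 0 = 1.
Proof. by rewrite mxE enum_rankK. Qed.

Lemma regular_rep_xvec j : regular_rep (fun W => xvec W j 0).
Proof.
case e : (enum_val j) => [[a [i k]]|]; last first.
  by apply: regular_rep_ext (regular_repC G 1) _ => W; rewrite mxE e.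
have ro l l' : regular_rep (fun W : rep C d => opmx (arr_act W a) l l').
  apply: (@regular_opmx _ _ G (fun W => arr_act W a)) => x; apply: regular_arr_act => v p.
  exact: regular_repC.
have h : regular_rep (fun W : rep C d => \sum_l' (\sum_l b i l * opmx (arr_act W a) l l') * invmx b l' k).
  apply: regular_rep_sum => l'; apply: regular_repM; last exact: regular_repC.
  by apply: regular_rep_sum => l; apply: regular_repM => //; exact: regular_repC.
apply: regular_rep_ext h _ => W; rewrite [RHS]mxE e /arrmx mxE; apply: eq_bigr => l' _.
by rewrite mxE.
Qed.

Lemma poly_deg_regular k (f : rep C d -> C) : poly_deg xvec k f -> regular_rep f.
Proof.
elim: k f => [|k IH] f.
  by move=> /poly_deg0[a fa]; apply: regular_rep_ext (regular_repC G a) _ => W; rewrite fa.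
move=> /poly_degS[fs fsk ff].
have h : regular_rep (fun W => \sum_i xvec W i 0 * fs i W).
  by apply: regular_rep_sum => i; apply: regular_repM; [exact: regular_rep_xvec | apply: IH].
by apply: regular_rep_ext h _ => W; rewrite ff.
Qed.

(** With [regular_poly_fun], this identifies the functions given by tensors with the coordinate ring
    of [DRep]. *)
Lemma poly_fun_regular (f : DRep G -> C) : poly_fun (fun W : DRep G => xvec W) f -> regular f.
Proof.
move=> [k [c fc]].
have : regular_rep (fun W => tfun xvec c W) by apply: (@poly_deg_regular k); exists c.
by move=> [p hp]; exists p => W; rewrite fc -hp.
Qed.

Lemma entry_opmx (W : rep C d) a i j : W a i j = opmx (arr_act W a) (ix i) (ix j).
Proof.
have -> : opmx (arr_act W a) (ix i) (ix j) = coords (arr_act W a (vinj (delta_mx j 0))) (ix i) 0.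
  rewrite mxE; congr (coords (arr_act W a _) _ _).
  apply: (can_inj (@coordsK C Q d)); rewrite uncoordsK; apply/colP => l.
  rewrite -(ix_val l) coordsE mxE eqxx andbT.
  case: (enum_val l) => v p /=.
  have [e|vw] := eqVneq (qtail a) v.
    case: _ / e p => p; rewrite vinj_in mxE eqxx andbT /ix (inj_eq enum_rank_inj).
    by rewrite -tag_eqE /tag_eq /= eqxx tagged_asE.
  rewrite vinj_out // mxE /ix (inj_eq enum_rank_inj) -tag_eqE /tag_eq /=.
  by rewrite eq_sym (negPf vw).
by rewrite coordsE /arr_act !vinj_in -colE mxE.
Qed.

Lemma regular_poly_fun (p : mpoly.mpoly #|{: Defs.coord G}| C) :
  poly_fun (fun W : DRep G => xvec W) (fun W => mpoly.meval (fun i => coordv W (enum_val i)) p).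
Proof.
pose x (W : DRep G) := xvec W.
have ext f f' : poly_fun x f -> f =1 f' -> poly_fun x f'.
  by move=> [k [c fc]] e; exists k, c => W; rewrite -e.
have xc := fun W : DRep G => xvec_const W.
elim/mpoly_ind_gen: p => [c|i|p q hp hq|p q hp hq].
- by apply: ext (poly_fun_const x c) _ => W; rewrite mpoly.mevalC.
- case e : (enum_val i) => [a [k l]].
  (* An entry of [W] is recovered from [arrmx] by undoing the change of basis. *)
  have h : poly_fun x (fun W => \sum_l' (\sum_k' invmx b (ix k) k' * arrmx W a k' l') * b l' (ix l)).
    apply: (poly_fun_sum xc) => l'; apply: poly_funM; last exact: poly_fun_const.
    apply: (poly_fun_sum xc) => k'; apply: poly_funM; first exact: poly_fun_const.
    apply: ext (poly_fun_coord x (enum_rank (Some (a, (k', l')) : coord_index))) _ => W.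
    by rewrite /x mxE enum_rankK.
  apply: ext h _ => W; rewrite mpoly.mevalXU e /coordv /= entry_opmx.
  have -> : opmx (arr_act W a) = invmx b *m arrmx W a *m b.
    by rewrite /arrmx !mulmxA mulVmx // mul1mx -mulmxA mulVmx // mulmx1.
  by rewrite [RHS]mxE; apply: eq_bigr => l' _; rewrite mxE.
- by apply: ext (poly_funD xc hp hq) _ => W; rewrite mpoly.mevalD.
by apply: ext (poly_funM hp hq) _ => W; rewrite mpoly.mevalM.
Qed.

End Reductive.

(** * Every character of the ring of invariants is a point evaluation *)

Section Surjectivity.
Local Open Scope sesquilinear_scope.
Variables (R : realType) (Q : smquiver) (G : smsetting R[i] Q).
Local Notation C := R[i].
Local Notation d := (vdim G).
Import mpoly.
Local Notation MP := (mpoly #|{: Defs.coord G}| C).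

Lemma inv_sumE (I : Type) (r : seq I) (f : I -> inv_ring G) (W : DRep G) :
  (\sum_(i <- r) f i : inv_ring G) W = \sum_(i <- r) f i W.
Proof. exact: (big_morph (fun phi : inv_ring G => phi W)). Qed.

Lemma quot_fiber (chi : Diss G) : exists W : DRep G, quot_map W =1 chi.
Proof.
have [b bu bP] := @dgl_adjoint C Q G.
pose x (W : DRep G) := xvec b W.
pose A g := conj_mx (dglmx b g) (dglmxV b g).
have A_adj g : exists g', A g' = (A g) ^t*.
  by have [g' e] := bP g; exists g'; apply: conj_mx_adj.
have x_act g W : x (dact g W) = A g *m x W by exact: xvec_dact.
have xc (W : DRep G) := xvec_const b W.
pose ev (p : MP) (W : DRep G) : C := meval (fun i => coordv W (enum_val i)) p.
(* The preimage in the polynomial ring of the ideal generated by the kernel of [chi]. With [r] empty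
   it contains all polynomials that vanish on [DRep], which forces the common zero into [DRep]. *)
pose I (p : MP) := exists2 r : seq (inv_ring G * MP), all (fun z => chi z.1 == 0) r &
  forall W, ev p W = \sum_(z <- r) z.1 W * ev z.2 W.
have pI : proper_ideal I.
  split.
  - move=> p q [r r0 hr] [s s0 hs]; exists (r ++ s); first by rewrite all_cat r0.
    by move=> W; rewrite big_cat /= -hr -hs /ev mevalD.
  - move=> p q [r r0 hr]; exists [seq (z.1, p * z.2) | z <- r]; first by rewrite all_map.
    move=> W; rewrite big_map /= /ev mevalM -/(ev q W) hr mulr_sumr; apply: eq_bigr => z _.
    by rewrite /ev mevalM mulrCA.
  (* If 1 were in [I], [reynolds_unit] would make the coefficients invariant, so 1 would be a
     combination of kernel elements within the ring of invariants, and [chi] would kill it. *)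
  move=> [r r0 hr].
  have pf (z : inv_ring G * MP) : poly_fun x (z.1 : DRep G -> C).
    have /asboolP[[p zp] _] := inv_funP z.1.
    have [k [c hc]] := regular_poly_fun bu p.
    by exists k, c => W; rewrite zp hc.
  have inv1 (z : inv_ring G * MP) : act_invariant (@dact C Q G) (z.1 : DRep G -> C).
    by have /asboolP[_ h] := inv_funP z.1.
  have pq (z : inv_ring G * MP) : poly_fun x (ev z.2) by exact: regular_poly_fun.
  have rE W : \sum_(z <- r) z.1 W * ev z.2 W = 1 by rewrite -hr /ev meval1.
  have [q0 [q0p q0i q0E]] := reynolds_unit x_act A_adj xc pf inv1 pq rE.
  have q0r z : (q0 z : DRep G -> C^o) \in @reg_inv C Q G.
    by apply/asboolP; split; [exact: poly_fun_regular (q0p z) | exact: q0i].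
  have e1 : \sum_(z <- r) z.1 * InvRing (q0r z) = 1 :> inv_ring G.
    apply: val_inj; apply: functional_extensionality_dep => W.
    by rewrite -[LHS]/((\sum_(z <- r) z.1 * InvRing (q0r z) : inv_ring G) W) inv_sumE; exact: q0E.
  have := rmorph1 chi; rewrite -e1 rmorph_sum /= big_seq big1 => [/eqP|z zr].
    by rewrite eq_sym oner_eq0.
  by rewrite rmorphM /= (eqP (allP r0 z zr)) mul0r.
have [m Im] := nullstellensatz (@uncountable_complex R) pI.
pose W0 : rep C d := fun a => \matrix_(i, j)
  m (enum_rank (Tagged (fun a => ('I_(d (qhead a)) * 'I_(d (qtail a)))%type) (i, j) : Defs.coord G)).
have W0m : rep_coord (G := G) W0 =1 m.
  move=> i; rewrite /rep_coord mxE /Tagged; congr (m _).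
  by rewrite -[RHS]enum_valK; congr enum_rank; case: (enum_val i) => a [k l].
have W0P a : mstar W0 a = W0 a.
  apply/matrixP => i j.
  have [p hp] := regular_mstar (G := G) i j; have [q hq] := @regular_rep_entry _ _ G a i j.
  rewrite hp hq; apply/eqP; rewrite -subr_eq0 -mevalB; apply/eqP.
  rewrite (meval_eq _ W0m); apply: Im; exists [::] => // W.
  by rewrite big_nil /ev mevalB -[meval _ p]hp -[meval _ q]hq drepP subrr.
exists (MkDRep W0P) => phi.
have /asboolP[[p hp] _] := inv_funP phi.
(* [phi - chi phi *: 1] lies in the kernel of [chi], so it vanishes at the point found. *)
have Ip : I (p - (chi phi)%:MP).
  exists [:: (phi - chi phi *: 1, 1)].
    by rewrite /= andbT linearB linearZ /= rmorph1 mulr1 subrr.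
  move=> W; rewrite big_seq1 /ev mevalB mevalC meval1 mulr1 /= -hp.
  exact: (congr1 (fun z => phi W - z) (esym (mulr1 (chi phi)))).
have := Im _ Ip; rewrite -(meval_eq _ W0m) mevalB mevalC => /eqP.
by rewrite subr_eq0 => /eqP <-; rewrite -[LHS]/(phi (MkDRep W0P)) hp.
Qed.

End Surjectivity.

Theorem corollary4p1 (R : realType) (Q : smquiver) (G : smsetting R[i] Q) :
  (forall W W' : DRep G, ss_mixed W -> ss_mixed W' ->
     (quot_map W =1 quot_map W' <-> DRep_isomorphic W W')) /\
  (forall chi : Diss G, exists W : DRep G, ss_mixed W /\ quot_map W =1 chi).
Proof.
split=> [W W' [ssW _] [ssW' _]|chi].
  split=> [qW|/iso_same_orbit[g gW] phi]; first exact: (same_quot_iso ssW ssW' qW).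
  have /asboolP[[p phip] phi_inv] := inv_funP phi.
  change (phi W = phi W').
  rewrite -(phi_inv g W) !phip; apply: mpoly.meval_eq => i.
  by rewrite /coordv gW.
have [W Wchi] := quot_fiber chi.
have [W' [ssW' eW']] := semisimple_degeneration W.
exists W'; split=> [|phi].
  by split; [exact: ssW' | exact: (gform_mixed W')].
by rewrite -Wchi; exact: eW'.
Qed.
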